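(* Fix a positive integer $r$, and let $G$ be an $r$-critical graph with $n$ vertices, where $n\le 1.23\,r$. If $$27.48 \le \frac{(r-1)^3(n-r-1)^3}{(n-1)^3\,n\,(n+2r)},$$ then $\mathrm{cr}(G)\ge \mathrm{cr}(K_r)$ (that is, $G$ is not a counterexample to Albertson's Conjecture). In particular, $\mathrm{cr}(G)\ge \mathrm{cr}(K_r)$ holds if $r\ge 125{,}000$ and $1.10\,r\le n\le 1.23\,r$; and it holds if $r\ge 825{,}000$ and $1.05\,r\le n\le 1.23\,r$.
   Context: Graphs are finite and simple. $\chi(G)$ denotes the chromatic number of $G$, and $K_r$ the complete graph on $r$ vertices. A graph $G$ is $r$-critical if $\chi(G)=r$ and $\chi(H)<r$ for every proper subgraph $H$ of $G$. The crossing number $\mathrm{cr}(G)$ is the minimum number of edge crossings over all drawings of $G$ in the plane. Albertson's Conjecture states that if $\chi(G)\ge r$, then $\mathrm{cr}(G)\ge \mathrm{cr}(K_r)$; an $r$-critical graph $G$ is a counterexample if $\mathrm{cr}(G)<\mathrm{cr}(K_r)$. *)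

(* Defs.v *)
From HB Require Import structures.
From mathcomp Require Import all_boot all_order all_algebra.
From mathcomp Require Import all_classical all_reals all_analysis.
From mathcomp Require Import ring lra.
Import Order.TTheory GRing.Theory Num.Theory.
Import numFieldNormedType.Exports.

Set Implicit Arguments.
Unset Strict Implicit.
Unset Printing Implicit Defensive.

Local Open Scope classical_set_scope.
Local Open Scope ring_scope.

(* Finite simple graphs whose vertices are taken from an ambient finite type,
   so that a subgraph of G is again a graph over the same type. *)
Record graph (T : finType) := Graph {
  vset : {set T};
  eset : {set {set T}};
  eset_ok : [forall e in eset, (e \subset vset) && (#|e| == 2%N)]
}.

Lemma esetP (T : finType) (G : graph T) e :
  e \in eset G -> (e \subset vset G) && (#|e| == 2%N).
Proof. exact: (forall_inP (eset_ok G)). Qed.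

Section Coloring.
Variable T : finType.
Implicit Types G H : graph T.

Definition subgraph H G : Prop :=
  vset H \subset vset G /\ eset H \subset eset G.

Definition proper_subgraph H G : Prop := subgraph H G /\ H <> G.

Definition proper_coloring G (c : T -> nat) : Prop :=
  forall x y, [set x; y]%SET \in eset G -> c x != c y.

Definition colorable G (k : nat) : Prop :=
  exists c, proper_coloring G c /\ forall x, x \in vset G -> (c x < k)%N.

Lemma colorable_exists G : exists k, `[< colorable G k >].
Proof.
exists #|T|; apply/asboolP; exists (fun x => nat_of_ord (enum_rank x)).
split=> [x y /esetP /andP[_]|x _]; last exact: ltn_ord.
by rewrite cards2; apply: contraTneq => /ord_inj/enum_rank_inj ->; rewrite eqxx.
Qed.

Definition chromatic_number G : nat := ex_minn (colorable_exists G).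

Definition critical (r : nat) G : Prop :=
  chromatic_number G = r /\
  forall H, proper_subgraph H G -> (chromatic_number H < r)%N.

End Coloring.

Lemma complete_ok (r : nat) :
  [forall e in [set e : {set 'I_r} | #|e| == 2%N]%SET,
     (e \subset [set: 'I_r]%SET) && (#|e| == 2%N)].
Proof. by apply/forall_inP => e; rewrite inE finset.subsetT. Qed.

Definition complete (r : nat) : graph 'I_r := Graph (complete_ok r).

(* Each edge is a simple arc, parametrized by the unit interval in either
   direction, which joins its two ends and meets no vertex in between.  Only
   the values of pos on vset G, and of arc e on the unit interval for e an
   edge, are relevant. *)
Record drawing (R : realType) (T : finType) (G : graph T) := Drawing {
  pos : T -> R * R;
  arc : {set T} -> R -> R * R;
  pos_inj : {in vset G &, injective pos};
  arc_continuous : forall e, e \in eset G ->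
    {within `[0, 1]%classic, continuous (arc e)};
  arc_inj : forall e, e \in eset G -> {in `[0, 1] &, injective (arc e)};
  arc_ends : forall e, e \in eset G ->
    [set arc e 0; arc e 1]%classic = (pos @` [set` e])%classic;
  arc_avoids : forall e, e \in eset G ->
    forall t x, t \in `]0, 1[ -> x \in vset G -> arc e t <> pos x
}.

Section Crossing.
Variables (R : realType) (T : finType).
Implicit Type G : graph T.

Definition arc_interior G (D : drawing R G) (e : {set T}) : set (R * R) :=
  (arc D e @` `]0, 1[)%classic.

(* A crossing is an unordered pair of distinct edges together with a point
   interior to both.  Hence a point common to k edges counts 'C(k, 2) times, and
   a point where two edges touch counts as well; as such points can be perturbed
   away without increasing the count, the minimum is the same as over drawings
   in which edges cross transversally and no three edges meet at a point. *)
Definition crossings G (D : drawing R G) : set ({set {set T}} * (R * R)) :=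
  [set c : {set {set T}} * (R * R) |
     [/\ c.1 \subset eset G, #|c.1| = 2%N &
         forall e, e \in c.1 -> arc_interior D e c.2]]%classic.

Definition drawable G (k : nat) : Prop :=
  exists D : drawing R G, (crossings D #= `I_k)%card.

(* Drawable with finitely many crossings: put the vertices on the parabola
   y = x ^ 2 and draw every edge as a chord. *)
Section Parabola.
Variable G : graph T.

Definition para_x (x : T) : R := (enum_rank x)%:R.
Definition para_pos (x : T) : R * R := (para_x x, para_x x ^+ 2).
Definition chord (a b t : R) : R * R :=
  let x := a + t * (b - a) in (x, (a + b) * x - a * b).
Definition para_arc (e : {set T}) : R -> R * R :=
  let s := [seq para_x x | x in e] in chord s`_0 s`_1.

Lemma para_x_inj : injective para_x.
Proof. by move=> x y /eqP; rewrite eqr_nat => /eqP/ord_inj/enum_rank_inj. Qed.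

Lemma para_arcE e : e \in eset G -> exists x y : T,
  [/\ e = [set x; y]%SET, x != y & para_arc e = chord (para_x x) (para_x y)].
Proof.
move=> /esetP/andP[_ /eqP e2].
have := enum_uniq e; have := mem_enum e; rewrite /para_arc /image_mem.
move: e2; rewrite cardE; case: (enum e) => [|x [|y []]] //= _ eE.
rewrite inE andbT => xy; exists x, y; split=> //.
by apply/setP => z; rewrite -eE !inE.
Qed.

Lemma chord_continuous (a b : R) : continuous (chord a b).
Proof.
have cvg_x : continuous (fun t : R => a + t * (b - a)).
  move=> t; apply: cvgD; first exact: cvg_cst.
  by apply: cvgM; [exact: cvg_id|exact: cvg_cst].
have cvg_y : continuous (fun t : R => (a + b) * (a + t * (b - a)) - a * b).
  move=> t; apply: cvgB; last exact: cvg_cst.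
  by apply: cvgM; [exact: cvg_cst|exact: cvg_x].
by move=> t; exact: (cvg_pair (cvg_x t) (cvg_y t)).
Qed.

Lemma chord_inj (a b : R) : a != b -> injective (chord a b).
Proof.
move=> ab s t [/addrI/mulIf + _]; apply.
by rewrite subr_eq0 eq_sym.
Qed.

Lemma para_pos_inj : {in vset G &, injective para_pos}.
Proof. by move=> x y _ _ [/para_x_inj]. Qed.

Lemma para_arc_continuous e : e \in eset G ->
  {within `[0, 1]%classic, continuous (para_arc e)}.
Proof. by move=> _; exact/continuous_subspaceT/chord_continuous. Qed.

Lemma para_arc_inj e : e \in eset G -> {in `[0, 1] &, injective (para_arc e)}.
Proof.
move=> /para_arcE[x [y [_ xy ->]]] s t _ _; apply: chord_inj.
by rewrite (inj_eq para_x_inj).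
Qed.

Lemma para_arc_ends e : e \in eset G ->
  [set para_arc e 0; para_arc e 1]%classic = (para_pos @` [set` e])%classic.
Proof.
move=> /para_arcE[x [y [-> xy ->]]].
have -> : chord (para_x x) (para_x y) 0 = para_pos x.
  by rewrite /chord /para_pos; congr pair; ring.
have -> : chord (para_x x) (para_x y) 1 = para_pos y.
  by rewrite /chord /para_pos; congr pair; ring.
apply/seteqP; split=> p /=.
  by case=> ->; [exists x|exists y]; rewrite // !inE eqxx ?orbT.
by case=> z; rewrite !inE => /orP[]/eqP-> <-; [left|right].
Qed.

Lemma para_arc_avoids e : e \in eset G ->
  forall t x, t \in `]0, 1[ -> x \in vset G -> para_arc e t <> para_pos x.
Proof.
move=> /para_arcE[x [y [_ xy ->]]] t z; rewrite in_itv/= => /andP[t0 t1] _.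
have {}xy : para_x y - para_x x != 0.
  by rewrite subr_eq0 (inj_eq para_x_inj) eq_sym.
rewrite /chord /para_pos; move: (para_x x) (para_x y) (para_x z) xy.
move=> a b c ab [<-] /eqP; rewrite -subr_eq0.
set d := (X in X == 0); have -> : d = t * (1 - t) * (b - a) ^+ 2 by rewrite /d; ring.
by rewrite mulf_eq0 expf_eq0 /= (negbTE ab) orbF mulf_eq0 subr_eq0 (gt_eqF t0) (gt_eqF t1).
Qed.

Definition para_drawing : drawing R G := Drawing para_pos_inj
  para_arc_continuous para_arc_inj para_arc_ends para_arc_avoids.

Lemma para_crossing_inj e f p q : e \in eset G -> f \in eset G -> e != f ->
  arc_interior para_drawing e p -> arc_interior para_drawing f p ->
  arc_interior para_drawing e q -> arc_interior para_drawing f q -> p = q.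
Proof.
have line g u : g \in eset G -> arc_interior para_drawing g u ->
    forall x y, g = [set x; y]%SET -> x != y ->
    u.2 = (para_x x + para_x y) * u.1 - para_x x * para_x y.
  move=> /para_arcE[x [y [gE xy gA]]] [t _ <-] x' y' gE' xy'.
  have -> : arc para_drawing g t = chord (para_x x) (para_x y) t.
    by rewrite -gA.
  have : x' \in g /\ y' \in g by rewrite gE' !inE !eqxx orbT.
  rewrite gE !inE => -[/orP[]/eqP ?/orP[]/eqP ?]; subst x' y' => //=.
  - by rewrite eqxx in xy'.
  - by ring.
  - by rewrite eqxx in xy'.
move=> eG fG ef pe pf qe qf.
have [x [y [eE xy _]]] := para_arcE eG.
have [z [w [fE zw _]]] := para_arcE fG.
have := line _ _ eG pe _ _ eE xy; have := line _ _ fG pf _ _ fE zw.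
have := line _ _ eG qe _ _ eE xy; have := line _ _ fG qf _ _ fE zw.
case: p q {pe pf qe qf} => [p1 p2] [q1 q2] /= qf qe pf pe.
have [pq|pq] := eqVneq p1 q1; first by subst q1; rewrite pe qe.
have sE : para_x x + para_x y = para_x z + para_x w.
  apply/eqP; rewrite -subr_eq0.
  have : (para_x x + para_x y - (para_x z + para_x w)) * (p1 - q1) == 0.
    apply/eqP; lra.
  by rewrite mulf_eq0 subr_eq0 (subr_eq0 p1) (negbTE pq) orbF -subr_eq0.
have mE : para_x x * para_x y = para_x z * para_x w.
  by move: pe; rewrite pf sE => /addrI/oppr_inj.
have : (para_x x - para_x z) * (para_x x - para_x w) == 0.
  apply/eqP; transitivity (para_x x ^+ 2 - (para_x z + para_x w) * para_x x
     + para_x z * para_x w); first by ring.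
  by rewrite -sE -mE; ring.
rewrite mulf_eq0 !subr_eq0 !(inj_eq para_x_inj) => /orP[]/eqP xE; subst x.
  by move: sE ef => /addrI/para_x_inj yE; rewrite eE fE yE eqxx.
move: sE ef; rewrite addrC => /addIr/para_x_inj yE.
by rewrite eE fE yE finset.setUC eqxx.
Qed.

Lemma drawable_exists : exists k, `[< drawable G k >].
Proof.
suff /finite_setP[k Ek] : finite_set (crossings para_drawing).
  by exists k; apply/asboolP; exists para_drawing.
have fst_inj : {in crossings para_drawing &, injective fst}.
  move=> [P p] [Q q]; rewrite !inE => -[/= PG P2 Pp] [/= _ _ Qq] PQ.
  subst Q; congr pair.
  have /eqP/cards2P[e [f [ef PE]]] := P2.
  have eP : e \in P by rewrite PE !inE eqxx.
  have fP : f \in P by rewrite PE !inE eqxx orbT.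
  by apply: (para_crossing_inj _ _ ef); do ?[exact: Pp|exact: Qq];
    exact: (fintype.subsetP PG).
by rewrite -(eq_finite_set (inj_card_eq fst_inj)); exact: finite_finset.
Qed.

End Parabola.

Definition crossing_number G : nat := ex_minn (drawable_exists G).

End Crossing.
Arguments crossing_number R {T} G.

(* Main.v *)
(* Let h be non-adjacency in G, n = |V(G)| and q = n - r.  The colour classes of
   an optimal colouring form a partition of V(G) into r cliques of h.  If such a
   partition also has as few singletons as possible then, G being critical, each
   component of h contains at most one singleton class (Gallai).  Hence a
   transversal S of the classes omits a set W of q vertices, all but 2q vertices
   of S are adjacent to every other vertex of G, and at most q(q + 1) pairs in S
   are not edges of G.  These pairs can be joined by pairwise edge-disjoint paths
   of length at most 4 which together with the edges inside S leave unused all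
   edges between W and some set U of r - 3q - 4 universal vertices.

   Take a drawing of G with cr(G) crossings, keep the edges inside S, and draw the
   missing edges of K_r along these paths.  Every new crossing lies near an inner
   vertex v of a path P, and the other edge passes v along some edge vu of G;
   since (P, v, u) determines the crossing, there are at most 3n q(q + 1) of them.
   On the other hand each copy of K_{3,3} between W and U contains a crossing, so
   that at least (q/3)^2 (|U|/3)^2 crossings of the drawing of G are lost.  In the
   range of the theorem this number is larger; the crossing lemma is not needed. *)

(* The edges of a drawing are arbitrary continuous arcs, and drawing a new curve parallel to such an
   arc would take a theorem of Schoenflies type. The new edges therefore run along the old arcs
   themselves, which is why the paths have to be edge-disjoint; new geometry is confined to small
   discs around the vertices, where straight segments replace the arcs. In the same spirit the
   crossing in each K_{3,3} comes from a parity count on a fine grid, without the Jordan curve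
   theorem.

   The paths exist because criticality bounds the h-degree of a vertex u by the number of vertices
   of W in its component: u has enough neighbours in W for all its missing edges, and a universal
   vertex connects the two halves of a path.

   The final count is an injection of the new crossings into the old ones, where those near vertices
   go to the crossings that were lost. The displayed inequality acts through its consequence n - r
   >= 1000, which together with n <= 1.23 r also makes r large. *)
Require Import Defs.
From HB Require Import structures.
From mathcomp Require Import all_boot all_order all_algebra.
From mathcomp Require Import all_classical all_reals all_analysis.
From mathcomp Require Import ring lra zify.
Import Order.TTheory GRing.Theory Num.Theory.
Import numFieldNormedType.Exports.
Set Implicit Arguments.
Unset Strict Implicit.
Unset Printing Implicit Defensive.
Local Open Scope ring_scope.

(** * Optimal partitions into cliques of h, and Gallai's theorem on their singletons *)

Section CliquePartitions.
Import mathcomp.boot.finset mathcomp.boot.fintype.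
Local Open Scope nat_scope.
Variables (T : finType) (h : rel T).
Hypothesis h_sym : symmetric h.
Hypothesis h_irr : irreflexive h.
Implicit Types (V X Y A B : {set T}) (P Q M : {set {set T}}) (x y z : T).

Definition clique A := {in A &, forall x y, x != y -> h x y}.

Definition cpart V P :=
  [/\ {in V, forall x, exists2 A, A \in P & x \in A},
      {in P, forall A, A \subset V /\ A != set0},
      {in P &, forall A B x, x \in A -> x \in B -> A = B} &
      {in P, forall A, clique A}].

(* Compares first the number of parts and then the number of singletons. *)
Definition weight P := \sum_(A in P) (#|T|.+1 + (#|A| == 1)).

Definition opt V P := cpart V P /\ forall Q, cpart V Q -> weight P <= weight Q.

(* X is a union of parts of P, up to points outside all parts. *)
Definition saturated P X := {in P, forall A x y, x \in A -> y \in A -> x \in X -> y \in X}.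

Lemma saturatedC P X : saturated P X -> saturated P (~: X).
Proof.
move=> sX A AP x y xA yA; rewrite !inE; apply: contra => yX.
exact: sX yA xA yX.
Qed.

Lemma saturatedI P X Y : saturated P X -> saturated P Y -> saturated P (X :&: Y).
Proof.
move=> sX sY A AP x y xA yA /setIP[xX xY].
by apply/setIP; split; [exact: sX xA yA xX|exact: sY xA yA xY].
Qed.

Lemma cpart_partition V P : cpart V P -> partition P V.
Proof.
move=> [cov sub disj _]; apply/and3P; split.
- apply/eqP/setP => x; apply/bigcupP/idP => [[A AP xA]|/cov[A AP xA]]; last by exists A.
  by have [/subsetP/(_ x xA)] := sub _ AP.
- apply/trivIsetP => A B AP BP; apply: contraR => /pred0Pn[x /andP[xA xB]].
  by apply/eqP; exact: disj xA xB.
- by apply/negP => /sub[_]; rewrite eqxx.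
Qed.

Lemma cpart_inh V P A : cpart V P -> A \in P -> exists x, x \in A.
Proof. by move=> [_ sub _ _] /sub[_ /set0Pn]. Qed.

Lemma cpart_mem V P A x : cpart V P -> A \in P -> x \in A -> x \in V.
Proof. by move=> [_ sub _ _] /sub[/subsetP + _]; apply. Qed.

Lemma cpart_restr V P X : cpart V P -> saturated P X -> cpart (V :&: X) (P ::&: X).
Proof.
move=> cP sX; have [cov sub disj cl] := cP; split.
- move=> x /setIP[xV xX]; have [A AP xA] := cov _ xV; exists A => //.
  rewrite inE AP; apply/subsetP => y yA; exact: sX xA yA xX.
- move=> A; rewrite inE => /andP[AP AX]; have [AV A0] := sub _ AP.
  by rewrite subsetI AV AX.
- by move=> A B; rewrite !inE => /andP[AP _] /andP[BP _]; exact: disj.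
- by move=> A; rewrite inE => /andP[AP _]; exact: cl.
Qed.

Lemma cpartU V V' P Q : [disjoint V & V'] -> cpart V P -> cpart V' Q ->
  cpart (V :|: V') (P :|: Q).
Proof.
move=> dV cP cQ; have [cov sub disj cl] := cP; have [cov' sub' disj' cl'] := cQ.
have no x : x \in V -> x \in V' -> False by move=> xV; rewrite (disjointFr dV xV).
split.
- move=> x /setUP[/cov|/cov'] [A AP xA]; exists A => //; rewrite inE AP ?orbT //.
- move=> A /setUP[/sub|/sub'] [AV A0]; split=> //; apply: subset_trans AV _.
    exact: subsetUl.
  exact: subsetUr.
- move=> A B /setUP[AP|AP] /setUP[BP|BP] x xA xB.
  + exact: disj xA xB.
  + by case: (no x); [exact: cpart_mem cP AP xA|exact: cpart_mem cQ BP xB].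
  + by case: (no x); [exact: cpart_mem cP BP xB|exact: cpart_mem cQ AP xA].
  + exact: disj' xA xB.
- by move=> A /setUP[/cl|/cl'].
Qed.

Lemma weightU V V' P Q : [disjoint V & V'] -> cpart V P -> cpart V' Q ->
  weight (P :|: Q) = weight P + weight Q.
Proof.
move=> dV cP cQ; rewrite /weight -bigU //=; last first.
  rewrite -setI_eq0; apply/eqP/setP => A; rewrite !inE; apply/negP => /andP[AP AQ].
  have [x xA] := cpart_inh cP AP.
  by have := cpart_mem cQ AQ xA; rewrite (disjointFr dV) // (cpart_mem cP AP xA).
by apply: eq_bigl => A; rewrite !inE.
Qed.

Lemma cardU_cpart V V' P Q : [disjoint V & V'] -> cpart V P -> cpart V' Q ->
  #|P :|: Q| = #|P| + #|Q|.
Proof.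
move=> dV cP cQ; rewrite cardsU (_ : P :&: Q = set0) ?cards0 ?subn0 //.
apply/setP => A; rewrite !inE; apply/negP => /andP[AP AQ].
have [x xA] := cpart_inh cP AP.
by have := cpart_mem cQ AQ xA; rewrite (disjointFr dV) // (cpart_mem cP AP xA).
Qed.

Lemma restrC V P X : cpart V P -> saturated P X -> (P ::&: X) :|: (P ::&: ~: X) = P.
Proof.
move=> cP sX; apply/setP => A; rewrite !inE -andb_orr; apply: andb_idr => AP.
have [x xA] := cpart_inh cP AP; have sXC := saturatedC sX.
have [xX|xX] := boolP (x \in X); apply/orP; [left|right]; apply/subsetP => y yA.
  exact: sX xA yA xX.
by apply: sXC xA yA _ => //; rewrite inE.
Qed.

Lemma disjointIC V X : [disjoint V :&: X & V :&: ~: X].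
Proof. by rewrite -setI_eq0 setIACA setICr setI0. Qed.

Lemma setIC_split V X : (V :&: X) :|: (V :&: ~: X) = V.
Proof. by rewrite -setIUr setUCr setIT. Qed.

Lemma weight_split V P X : cpart V P -> saturated P X ->
  weight P = weight (P ::&: X) + weight (P ::&: ~: X).
Proof.
move=> cP sX; have sXC := saturatedC sX.
by rewrite -(weightU (disjointIC V X) (cpart_restr cP sX) (cpart_restr cP sXC))
  (restrC cP sX).
Qed.

Lemma card_split V P X : cpart V P -> saturated P X ->
  #|P| = #|P ::&: X| + #|P ::&: ~: X|.
Proof.
move=> cP sX; have sXC := saturatedC sX.
by rewrite -(cardU_cpart (disjointIC V X) (cpart_restr cP sX) (cpart_restr cP sXC))
  (restrC cP sX).
Qed.

(** An exchange inside a saturated set leaves the other parts alone, and [weight] and the number of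
    parts are additive over the two sides. Hence optimality is a local property, in the form of the
    next two lemmas. *)
Lemma cpart_swap V P X Q : cpart V P -> saturated P X -> cpart (V :&: X) Q ->
  cpart V (Q :|: (P ::&: ~: X)) /\
  weight (Q :|: (P ::&: ~: X)) = weight Q + weight (P ::&: ~: X) /\
  #|Q :|: (P ::&: ~: X)| = #|Q| + #|P ::&: ~: X|.
Proof.
move=> cP sX cQ; have cC := cpart_restr cP (saturatedC sX); split; last first.
  by rewrite (weightU (disjointIC V X) cQ cC) (cardU_cpart (disjointIC V X) cQ cC).
by rewrite -{1}(setIC_split V X); exact: cpartU (disjointIC V X) cQ cC.
Qed.

Lemma opt_swap_le V P X Q : opt V P -> saturated P X -> cpart (V :&: X) Q ->
  weight (P ::&: X) <= weight Q.
Proof.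
move=> [cP mP] sX cQ; have [cS [wS _]] := cpart_swap cP sX cQ.
by have := mP _ cS; rewrite wS (weight_split cP sX) leq_add2r.
Qed.

Lemma opt_swap V P X Q : opt V P -> saturated P X -> cpart (V :&: X) Q ->
  weight Q = weight (P ::&: X) -> opt V (Q :|: (P ::&: ~: X)).
Proof.
move=> [cP mP] sX cQ wE; have [cS [wS _]] := cpart_swap cP sX cQ; split=> // Q' cQ'.
by rewrite wS wE -(weight_split cP sX) mP.
Qed.

Lemma weightE P : weight P = #|P| * #|T|.+1 + #|[set A in P | #|A| == 1]|.
Proof.
rewrite /weight big_split /= sum_nat_const; congr (_ + _).
rewrite -sum1_card big_mkcond [RHS]big_mkcond; apply: eq_bigr => A _.
by rewrite inE; case: ifP => //= _; case: eqP.
Qed.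

Lemma card_singletons V P : cpart V P -> #|[set A in P | #|A| == 1]| <= #|T|.
Proof.
move=> cP; rewrite -(card_imset _ (@set1_inj T)); apply: subset_leq_card.
apply/subsetP => A; rewrite inE => /andP[_ /cards1P[x ->]].
by apply/imsetP; exists x.
Qed.

(** There are at most [#|T|] singletons, so they cannot make up for one part, which weighs at least
    [#|T|.+1]. *)
Lemma weight_le_card V V' P Q : cpart V P -> cpart V' Q -> weight P <= weight Q -> #|P| <= #|Q|.
Proof.
move=> cP cQ; rewrite !weightE; have := card_singletons cP; have := card_singletons cQ.
move: #|_| #|P| #|Q| #|T| => s p q t; move: #|_| => s'; nia.
Qed.

Lemma opt_card V P Q : opt V P -> cpart V Q -> #|P| <= #|Q|.
Proof. by move=> [cP mP] cQ; apply: weight_le_card cP cQ (mP _ cQ). Qed.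

Lemma cpart0 : cpart set0 set0.
Proof. by split=> [x|x|x y|x]; rewrite inE. Qed.

Lemma cpart1 A : A != set0 -> clique A -> cpart A [set A].
Proof.
move=> A0 cA; split.
- by move=> x xA; exists A; rewrite ?set11.
- by move=> B /set1P->.
- by move=> B C /set1P-> /set1P->.
- by move=> B /set1P->.
Qed.

Lemma clique1 x : clique [set x].
Proof. by move=> y z /set1P-> /set1P->; rewrite eqxx. Qed.

Lemma clique2 x y : h x y -> clique [set x; y].
Proof.
by move=> hxy u v /set2P[]-> /set2P[]->; rewrite ?eqxx // h_sym.
Qed.

Lemma weight_set1 A : weight [set A] = #|T|.+1 + (#|A| == 1).
Proof. by rewrite /weight big_set1. Qed.

Lemma neq_set1 x : [set x] != set0.
Proof. by apply/set0Pn; exists x; rewrite set11. Qed.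

Lemma opt_exists V : exists P, opt V P.
Proof.
pose P1 := [set [set x] | x in V].
have c1 : cpart V P1.
  split.
  - by move=> x xV; exists [set x]; rewrite ?set11 //; apply/imsetP; exists x.
  - by move=> A /imsetP[x xV ->]; rewrite sub1set xV neq_set1.
  - by move=> A B /imsetP[x xV ->] /imsetP[y yV ->] z /set1P-> /set1P->.
  - by move=> A /imsetP[x _ ->]; exact: clique1.
have exw : exists w, `[< exists2 P, cpart V P & weight P = w >].
  by exists (weight P1); apply/asboolP; exists P1.
case: (ex_minnP exw) => w /asboolP[P cP wP] mw; exists P; split=> // Q cQ.
by rewrite wP; apply: mw; apply/asboolP; exists Q.
Qed.

(** If [A] were a singleton, merging it with [x] would save a part. If it had three or more
    elements, moving [y] from [A] to [x] would keep the number of parts and save a singleton. *)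
Lemma opt_single_adj V P x y A : opt V P -> [set x] \in P -> h x y -> A \in P -> y \in A ->
  #|A| = 2.
Proof.
move=> oP xP hxy AP yA; have [cP mP] := oP; have [_ sub disj cl] := cP.
have xy : x != y by apply: contraTneq hxy => ->; rewrite h_irr.
have xA : x \notin A.
  apply/negP => xA; have EA := disj _ _ xP AP x (set11 x) xA.
  by move: yA; rewrite -EA inE eq_sym (negbTE xy).
pose X := x |: A.
have sX : saturated P X.
  move=> B BP u v uB vB; rewrite !inE => /orP[/eqP ux|uA].
    by subst u; have EB := disj _ _ BP xP x uB (set11 x); move: vB; rewrite EB inE => ->.
  by rewrite -(disj _ _ BP AP u uB uA) vB orbT.
have VX : V :&: X = X.
  apply/setIidPr/subsetP => u; rewrite !inE => /orP[/eqP->|uA].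
    exact: cpart_mem cP xP (set11 x).
  exact: cpart_mem cP AP uA.
have PX : P ::&: X = [set [set x]; A].
  apply/setP => B; rewrite !inE; apply/andP/orP => [[BP BX]|[]/eqP->].
  - have [u uB] := cpart_inh cP BP; have := subsetP BX _ uB.
    rewrite !inE => /orP[/eqP ux|uA]; [left|right]; apply/eqP.
      by subst u; exact: disj uB (set11 x).
    exact: disj uB uA.
  - by rewrite xP sub1set !inE eqxx.
  - by rewrite AP subsetUr.
have nA : [set x] != A by apply: contraNneq xA => <-; rewrite set11.
have wX : weight (P ::&: X) = (#|T|.+1).*2 + 1 + (#|A| == 1).
  rewrite PX /weight big_setU1 ?inE //= big_set1 cards1; lia.
have le Q : cpart X Q -> weight (P ::&: X) <= weight Q.
  by move=> cQ; apply: opt_swap_le oP sX _; rewrite VX.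
have A0 : #|A| > 0 by rewrite card_gt0; have [_ ->] := sub _ AP.
have [A1|A1] := eqVneq #|A| 1.
  move: A1 => /eqP/cards1P[z Az].
  move: yA; rewrite Az => /set1P zy; subst z.
  have cX : cpart X [set X].
    apply: cpart1; first by apply/set0Pn; exists x; rewrite !inE eqxx.
    by rewrite /X Az; exact: clique2.
  have := le _ cX; rewrite wX weight_set1 /X cardsU1 xA Az cards1; lia.
apply/eqP; apply: contraT => A2.
have A3 : #|A| > 2 by lia.
have cA : cpart (A :\ y) [set A :\ y].
  apply: cpart1.
    by rewrite -card_gt0 (cardsD1 y) ?yA in A3 *; lia.
  by move=> u v /setD1P[_ uA] /setD1P[_ vA]; exact: (cl _ AP u v uA vA).
have cxy : cpart [set x; y] [set [set x; y]].
  by apply: cpart1; [by apply/set0Pn; exists x; rewrite !inE eqxx|exact: clique2].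
have dj : [disjoint [set x; y] & A :\ y].
  rewrite -setI_eq0; apply/eqP/setP => u; rewrite !inE.
  apply/negP => /andP[/orP[]/eqP-> /andP[]]; rewrite ?eqxx //.
  by rewrite (negbTE xA).
have EX : [set x; y] :|: (A :\ y) = X.
  by apply/setP => u; rewrite !inE; case: (u =P y) => [->|_]; rewrite ?yA ?orbT //= orbF.
have := cpartU dj cxy cA; rewrite EX => /le.
rewrite wX (weightU dj cxy cA) !weight_set1 cards2 xy.
have : #|A :\ y| = #|A|.-1 by rewrite (cardsD1 y A) yA.
move=> ->; lia.
Qed.

Lemma weight_pairs V M : cpart V M -> {in M, forall A, #|A| = 2} ->
  (weight M).*2 = #|T|.+1 * #|V|.
Proof.
move=> cM M2; rewrite (card_partition (cpart_partition cM)) /weight.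
rewrite (eq_bigr (fun=> #|T|.+1)) => [|A /M2->]; last by rewrite addn0.
rewrite [in RHS](eq_bigr (fun=> 2)) => [|A /M2->] //.
rewrite !sum_nat_const; lia.
Qed.

Lemma card_pairs V M : cpart V M -> {in M, forall A, #|A| = 2} -> #|V| = #|M|.*2.
Proof.
move=> cM M2; rewrite (card_partition (cpart_partition cM)).
rewrite (eq_bigr (fun=> 2)) => [|A /M2->] //.
rewrite sum_nat_const; lia.
Qed.

Lemma cpartD1 V P A : cpart V P -> A \in P -> cpart (V :\: A) (P :\ A).
Proof.
move=> [cov sub disj cl] AP; split.
- move=> x /setDP[xV xA]; have [B BP xB] := cov _ xV; exists B => //.
  by rewrite !inE BP andbT; apply: contraNneq xA => <-.
- move=> B /setD1P[BA BP]; have [BV B0] := sub _ BP; split=> //.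
  rewrite subsetD BV; rewrite -setI_eq0; apply/eqP/setP => x; rewrite !inE.
  by apply/negP => /andP[xB xA]; move: BA; rewrite (disj _ _ BP AP x xB xA) eqxx.
- by move=> B C /setD1P[_ BP] /setD1P[_ CP]; exact: disj.
- by move=> B /setD1P[_ BP]; exact: cl.
Qed.

Lemma weight_single_pairs V P x : cpart V P -> [set x] \in P ->
  {in P, forall A, A != [set x] -> #|A| = 2} ->
  (weight P).*2 = #|T|.+1 * #|V|.+1 + 2.
Proof.
move=> cP xP P2; have xV := cpart_mem cP xP (set11 x).
have cM := cpartD1 cP xP.
have M2 : {in P :\ [set x], forall A, #|A| = 2}.
  by move=> A /setD1P[Ax AP]; exact: P2.
have Ew : weight P = #|T|.+1 + 1 + weight (P :\ [set x]).
  by rewrite /weight (big_setD1 _ xP) /= cards1.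
have := weight_pairs cM M2; rewrite Ew; have := cardsD1 x V; rewrite xV => ->.
by move: (weight _) #|_ :\ _| #|T|; clear; lia.
Qed.

Lemma card_single_pairs V P x : cpart V P -> [set x] \in P ->
  {in P, forall A, A != [set x] -> #|A| = 2} -> #|V|.+1 = #|P|.*2.
Proof.
move=> cP xP P2; have xV := cpart_mem cP xP (set11 x).
have M2 : {in P :\ [set x], forall A, #|A| = 2}.
  by move=> A /setD1P[Ax AP]; exact: P2.
have := card_pairs (cpartD1 cP xP) M2.
have := cardsD1 x V; have := cardsD1 [set x] P; rewrite xP xV => -> ->.
by move: #|_ :\ _| #|_ :\ _|; clear; lia.
Qed.

(* Grow X from {y} by alternating between parts of P and of Q, as in the search
   for an augmenting path.  The pairs M covering X minus a point show that a part
   of Q that is entered at the next step must have two elements. *)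
Lemma grow V P Q y : cpart V P -> opt V Q -> [set y] \in Q ->
  exists X, [/\ y \in X, X \subset V, saturated P X, saturated Q X &
    {in Q, forall A, A \subset X -> A != [set y] -> #|A| = 2}].
Proof.
move=> cP oQ yQ; have [cQ mQ] := oQ; have [covP subP disjP clP] := cP.
have [covQ subQ disjQ clQ] := cQ.
(* By the last clause every [x] in [X] shares its part of [P] with some [z] in [X] that can replace
   [y] as the exposed point, the rest of [X] being split into pairs. *)
pose inv X := [/\ y \in X, X \subset V, saturated Q X,
    {in Q, forall A, A \subset X -> A != [set y] -> #|A| = 2} &
    {in X, forall x, exists z M, [/\ z \in X, exists2 A, A \in P & (x \in A) && (z \in A),
       cpart (X :\ z) M & {in M, forall A, #|A| = 2}]}].
have yV := cpart_mem cQ yQ (set11 y).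
have inv1 : inv [set y].
  split; rewrite ?set11 ?sub1set //.
  - by move=> A AQ u v uA vA /set1P uy; subst u; rewrite -(disjQ _ _ AQ yQ y uA (set11 y)).
  - move=> A AQ Ay; case/eqP; apply/eqP; rewrite eqEsubset Ay sub1set.
    have [u uA] := cpart_inh cQ AQ; by have := subsetP Ay _ uA; rewrite inE => /eqP <-.
  - move=> x /set1P->; exists y, set0; rewrite set11; split=> //.
    + by have [A AP yA] := covP _ yV; exists A => //; rewrite yA.
    + by rewrite setDv; exact: cpart0.
    + by move=> A; rewrite inE.
suff: forall k X, #|V| - #|X| < k -> inv X ->
    exists X, [/\ y \in X, X \subset V, saturated P X, saturated Q X &
      {in Q, forall A, A \subset X -> A != [set y] -> #|A| = 2}].
  by move=> /(_ _ _ (ltnSn _) inv1).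
elim=> // k IH X leX iX; have [yX XV sX bX eX] := iX.
have [sPX|] := pselect (saturated P X); first by exists X.
move=> /existsNP[A /not_implyP[AP /existsNP[x /existsNP[x' /not_implyP[xA]]]]].
move=> /not_implyP[x'A /not_implyP[xX /negP x'X]].
have [z [M [zX [A' A'P /andP[xA' zA']] cM M2]]] := eX _ xX.
have EA := disjP _ _ A'P AP x xA' xA; subst A'.
have x'V := cpart_mem cP AP x'A.
have zx' : z != x' by apply: contraNneq x'X => <-.
have hz : h z x' by exact: clP AP _ _ zA' x'A zx'.
have VX : V :&: X = X by apply/setIidPr.
have cX : cpart X (Q ::&: X) by have := cpart_restr cQ sX; rewrite VX.
have bX' : {in Q ::&: X, forall A, A != [set y] -> #|A| = 2}.
  by move=> B; rewrite inE => /andP[BQ BX]; exact: bX.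
have yQX : [set y] \in Q ::&: X by rewrite inE yQ sub1set.
have wX := weight_single_pairs cX yQX bX'.
have cz : cpart [set z] [set [set z]] by apply: cpart1; [exact: neq_set1|exact: clique1].
have dz : [disjoint X :\ z & [set z]].
  by rewrite -setI_eq0; apply/eqP/setP => u; rewrite !inE; case: (u == z); rewrite ?andbF.
have Ez : (X :\ z) :|: [set z] = X by rewrite setUC setD1K.
have cR := cpartU dz cM cz; have wR := weightU dz cM cz.
rewrite Ez in cR.
(* Both partitions of [X] consist of one singleton and of pairs. So exposing [z] instead of [y]
   preserves optimality, and [opt_single_adj] applies to [z] and its h-neighbour [x'] outside
   [X]. *)
have wRX : weight (M :|: [set [set z]]) = weight (Q ::&: X).
  rewrite wR weight_set1 cards1; apply: double_inj; rewrite wX doubleD (weight_pairs cM M2).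
  have := cardsD1 z X; rewrite zX eqxx => ->.
  by move: #|_ :\ _| #|T|; clear; lia.
have cR' : cpart (V :&: X) (M :|: [set [set z]]) by rewrite VX.
have oR := opt_swap oQ sX cR' wRX.
have [B BQ x'B] := covQ _ x'V.
have BXd u : u \in B -> u \notin X.
  by move=> uB; apply: contraNN x'X => uX; exact: sX uB x'B uX.
have zR : [set z] \in M :|: [set [set z]] :|: (Q ::&: ~: X) by rewrite !inE eqxx orbT.
have BR : B \in M :|: [set [set z]] :|: (Q ::&: ~: X).
  by rewrite !inE BQ; apply/orP; right; apply/subsetP => u uB; rewrite inE BXd.
have B2 := opt_single_adj oR zR hz BR x'B.
have [x'' EB] : exists x'', B = [set x'; x''].
  move: (B2); rewrite (cardsD1 x') x'B => -[] /eqP/cards1P[x'' E]; exists x''.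
  by rewrite -(setD1K x'B) E.
have x'x'' : x' != x'' by move: B2; rewrite EB cards2; case: (x' =P x'').
have x''B : x'' \in B by rewrite EB !inE eqxx orbT.
have djB : [disjoint X & B].
  rewrite -setI_eq0; apply/eqP/setP => u; rewrite !inE; apply/negP => /andP[uX uB].
  by move: (BXd _ uB); rewrite uX.
have cB : cpart B [set B] by apply: cpart1; [by have [] := subQ _ BQ|exact: clQ].
have leB : #|V| - #|X :|: B| < k.
  rewrite cardsU (_ : X :&: B = set0); last by apply/eqP; rewrite setI_eq0.
  rewrite cards0 B2.
  have : #|X :|: B| <= #|V|.
    apply: subset_leq_card; apply/subsetP => u /setUP[/(subsetP XV)//|uB].
    exact: cpart_mem cQ BQ uB.
  rewrite cardsU (_ : X :&: B = set0); last by apply/eqP; rewrite setI_eq0.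
  by rewrite cards0 B2; move: leX; clear; lia.
apply: (IH (X :|: B)) => //; split.
- by rewrite inE yX.
- by rewrite subUset XV; have [] := subQ _ BQ.
- move=> C CQ u v uC vC /setUP[uX|uB]; rewrite inE.
    by rewrite (sX _ CQ _ _ uC vC uX).
  by rewrite -(disjQ _ _ CQ BQ u uC uB) vC orbT.
- move=> C CQ CXB Cy; have [u uC] := cpart_inh cQ CQ.
  have := subsetP CXB _ uC => /setUP[uX|uB]; last by rewrite (disjQ _ _ CQ BQ u uC uB).
  by apply: bX => //; apply/subsetP => v vC; exact: sX uC vC uX.
- move=> u /setUP[uX|].
    have [z0 [M0 [z0X [C CP /andP[uC z0C]] cM0 M02]]] := eX _ uX.
    have z0B : z0 \notin B by apply: contraTN z0X => /BXd.
    exists z0, (M0 :|: [set B]); split.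
    + by rewrite inE z0X.
    + by exists C => //; rewrite uC.
    + rewrite (_ : (X :|: B) :\ z0 = (X :\ z0) :|: B); last first.
        apply/setP => v; rewrite !inE; case: (v =P z0) => [->|] //=.
        by rewrite (negbTE z0B).
      apply: cpartU => //; apply: disjointWl djB; exact: subsetDl.
    + by move=> D /setUP[/M02|/set1P->].
  have zB : z \notin B by apply: contraTN zX => /BXd.
  (* The two new points need different witnesses. For [x'] it is [z], which lies in the same part
     [A] and stays exposed. For [x''] it is [x''] itself, and [z] gets paired with [x']. *)
  rewrite {1}EB => /set2P[]->.
    exists z, (M :|: [set B]); split.
    + by rewrite inE zX.
    + by exists A => //; rewrite zA' x'A.
    + rewrite (_ : (X :|: B) :\ z = (X :\ z) :|: B); last first.
        by apply/setP => v; rewrite !inE; case: (v =P z) => [->|] //=; rewrite (negbTE zB).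
      apply: cpartU => //; apply: disjointWl djB; exact: subsetDl.
    + by move=> D /setUP[/M2|/set1P->].
  exists x'', (M :|: [set [set z; x']]); split.
  + by rewrite inE x''B orbT.
  + have x''V := cpart_mem cQ BQ x''B.
    by have [C CP x''C] := covP _ x''V; exists C => //; rewrite x''C.
  + have x''X := BXd _ x''B.
    have zx'' : z != x'' by apply: contraNneq x''X => <-.
    rewrite (_ : (X :|: B) :\ x'' = (X :\ z) :|: [set z; x']); last first.
      apply/setP => v; rewrite !inE EB !inE.
      have [->|] /= := eqVneq v x''; last first.
        by have [->|] //= := eqVneq v z; rewrite ?zX // orbF.
      by rewrite (negbTE x''X) andbF /= !(eq_sym x'') (negbTE zx'') (negbTE x'x'').
    apply: cpartU => //.
      rewrite -setI_eq0; apply/eqP/setP => v; rewrite !inE.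
      apply/negP => /andP[/andP[vz vX] /orP[/eqP vE|/eqP vE]].
        by rewrite vE eqxx in vz.
      by rewrite -vE vX in x'X.
    by apply: cpart1; [by apply/set0Pn; exists z; rewrite !inE eqxx|exact: clique2].
  + by move=> D /setUP[/M2|/set1P->] //; rewrite cards2 zx'.
Qed.

Lemma opt_restr_weight V P Q X : opt V P -> opt V Q -> saturated P X -> saturated Q X ->
  weight (P ::&: X) = weight (Q ::&: X).
Proof.
move=> oP oQ sP sQ; have [cP _] := oP; have [cQ _] := oQ; apply/eqP.
by rewrite eqn_leq (opt_swap_le oP sP (cpart_restr cQ sQ)) (opt_swap_le oQ sQ (cpart_restr cP sP)).
Qed.

Lemma restr_single P X x : [set x] \in P -> x \in X -> [set x] \in P ::&: X.
Proof. by move=> xP xX; rewrite inE xP sub1set. Qed.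

(* Gallai: if two singletons of an optimal partition were connected in h, the
   singleton at one end could be moved along the connecting path. *)
Definition cosingle V x y := exists P, [/\ opt V P, [set x] \in P, [set y] \in P & x != y].

(** Let [X] be grown from [t]. If it misses [x] or [y], then [Q] inside [X] and [P] outside form an
    optimal partition with both singletons. It cannot contain both: on [X] the partition [Q] has one
    singleton, and [P], of the same weight, would have two. *)
Lemma sing_swap V P Q x y t : opt V P -> opt V Q -> [set x] \in P -> [set y] \in P -> x != y ->
  [set t] \in Q -> cosingle V t x \/ cosingle V t y.
Proof.
move=> oP oQ xP yP xy tQ; have [cP _] := oP; have [cQ _] := oQ.
have [X [tX XV sP sQ bX]] := grow cP oQ tQ.
have VX : V :&: X = X by apply/setIidPr.
have wE := opt_restr_weight oP oQ sP sQ.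
have sub z : [set z] \in P -> z \notin X -> cosingle V t z.
  move=> zP zX; exists ((Q ::&: X) :|: (P ::&: ~: X)); split.
  - by apply: opt_swap (esym wE) => //; exact: cpart_restr.
  - by rewrite !inE tQ sub1set tX.
  - by rewrite !inE zP !sub1set inE zX orbT.
  - by apply: contraNneq zX => <-.
have [xX|xX] := boolP (x \in X); last by left; exact: sub.
have [yX|yX] := boolP (y \in X); last by right; exact: sub.
have cPX := cpart_restr cP sP; have cQX := cpart_restr cQ sQ; rewrite VX in cPX cQX.
have tQX := restr_single tQ tX.
have bX' : {in Q ::&: X, forall A, A != [set t] -> #|A| = 2}.
  by move=> A; rewrite inE => /andP[AQ AX]; exact: bX.
have cE := card_single_pairs cQX tQX bX'.
have wQ := weight_single_pairs cQX tQX bX'.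
have fE : #|P ::&: X| = #|Q ::&: X|.
  by apply/eqP; rewrite eqn_leq (weight_le_card cPX cQX) ?wE // (weight_le_card cQX cPX) ?wE.
have s2 : 1 < #|[set A in P ::&: X | #|A| == 1]|.
  apply: (@leq_trans #|[set [set x]; [set y]]|).
    by rewrite cards2 (inj_eq (@set1_inj T)) xy.
  apply: subset_leq_card; apply/subsetP => A; rewrite !inE => /orP[]/eqP->.
    by rewrite xP sub1set xX cards1.
  by rewrite yP sub1set yX cards1.
move: wQ; rewrite -wE weightE fE cE; move: s2; clear.
by move: #|[set A in _ | _]| #|_ ::&: _| #|T|; lia.
Qed.

Lemma cpart_merge V P x y : cpart V P -> [set x] \in P -> [set y] \in P -> h x y ->
  exists2 Q, cpart V Q & #|Q| < #|P|.
Proof.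
move=> cP xP yP hxy; have xy : x != y by apply: contraTneq hxy => ->; rewrite h_irr.
have xV := cpart_mem cP xP (set11 x); have yV := cpart_mem cP yP (set11 y).
have yP' : [set y] \in P :\ [set x] by rewrite !inE (inj_eq (@set1_inj T)) eq_sym xy.
have c1 := cpartD1 (cpartD1 cP xP) yP'.
have c2 : cpart [set x; y] [set [set x; y]].
  by apply: cpart1; [apply/set0Pn; exists x; rewrite !inE eqxx|exact: clique2].
have dj : [disjoint (V :\ x) :\ y & [set x; y]].
  rewrite -setI_eq0; apply/eqP/setP => u; rewrite !inE.
  by case: (u == y) => //; case: (u == x) => //; rewrite andbF.
exists (((P :\ [set x]) :\ [set y]) :|: [set [set x; y]]).
  have := cpartU dj c1 c2; congr cpart; apply/setP => u; rewrite !inE.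
  have [->|_] := eqVneq u y; first by rewrite yV orbT.
  by have [->|_] := eqVneq u x; rewrite /= ?xV // orbF.
rewrite (cardU_cpart dj c1 c2) cards1.
have := cardsD1 [set x] P; have := cardsD1 [set y] (P :\ [set x]); rewrite xP yP' => E1 E2.
by rewrite E2 E1; move: #|_ :\ [set y]|; clear; lia.
Qed.

Definition vertex_critical V := forall P a, opt V P -> a \in V ->
  exists2 Q, cpart (V :\ a) Q & #|Q| < #|P|.

(** Adding the singleton [a] to an optimal partition of [V :\ a] gives a partition [P2] with as few
    parts as [P], but perhaps too many singletons. Using [P2] only on the set [X] grown from [x],
    and [P] elsewhere, repairs this. *)
Lemma adj_single V P x a : vertex_critical V -> opt V P -> [set x] \in P -> a \in V -> h x a ->
  exists2 P', opt V P' & [set a] \in P'.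
Proof.
move=> vc oP xP aV hxa; have [cP mP] := oP; have [covP subP disjP clP] := cP.
have [Q0 cQ0 ltQ0] := vc _ _ oP aV.
have [C oC] := opt_exists (V :\ a); have [cC mC] := oC.
have ltC : #|C| < #|P| by apply: leq_ltn_trans ltQ0; exact: opt_card oC cQ0.
have ca : cpart [set a] [set [set a]] by apply: cpart1; [exact: neq_set1|exact: clique1].
have da : [disjoint V :\ a & [set a]].
  by rewrite -setI_eq0; apply/eqP/setP => u; rewrite !inE; case: (u == a); rewrite ?andbF.
have Ea : (V :\ a) :|: [set a] = V by rewrite setUC setD1K.
pose P2 := C :|: [set [set a]].
have cP2 : cpart V P2 by rewrite -Ea; exact: cpartU.
have kP2 : #|P2| = #|P|.
  apply/eqP; rewrite eqn_leq (opt_card oP cP2) andbT.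
  by rewrite (cardU_cpart da cC ca) cards1 addn1.
have aP2 : [set a] \in P2 by rewrite !inE eqxx orbT.
have aC A : A \in C -> a \notin A.
  by move=> Ac; apply/negP => /(cpart_mem cC Ac); rewrite !inE eqxx.
have le Z : saturated P Z -> saturated P2 Z -> #|P ::&: Z| <= #|P2 ::&: Z|.
  move=> sP sP2; have c2 := cpart_restr cP2 sP2; have c1 := cpart_restr cP sP.
  exact: weight_le_card c1 c2 (opt_swap_le oP sP c2).
(* Neither [Z] nor its complement can carry fewer parts of [P2] than of [P], and the totals
   agree. *)
have eqc Z : saturated P Z -> saturated P2 Z -> #|P ::&: Z| = #|P2 ::&: Z|.
  move=> sP sP2; have := le _ sP sP2; have := le _ (saturatedC sP) (saturatedC sP2).
  have := card_split cP sP; have := card_split cP2 sP2; rewrite kP2; clear; lia.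
(* Otherwise [P2] on [Z] and [P] outside have the minimal number of parts and contain the adjacent
   singletons [a] and [x], which could be merged. *)
have key Z : saturated P Z -> saturated P2 Z -> a \in Z -> x \in Z.
  move=> sP sP2 aZ; apply: contraT => xZ.
  have [cS [_ kS]] := cpart_swap cP sP (cpart_restr cP2 sP2).
  have [] := @cpart_merge _ _ x a cS _ _ hxa.
  - by rewrite !inE xP !sub1set inE xZ orbT.
  - by rewrite !inE eqxx sub1set aZ orbT.
  - move=> S cS'; rewrite kS -(eqc _ sP sP2) -(card_split cP sP).
    by have := opt_card oP cS'; clear; lia.
have [X [xX XV sP2 sP bX]] := grow cP2 oP xP.
have aX : a \in X.
  apply: contraT => aX; have := key _ (saturatedC sP) (saturatedC sP2).
  by rewrite !inE aX xX => /(_ isT).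
have [B BP aB] := covP _ aV.
have B2 := opt_single_adj oP xP hxa BP aB.
have [b EB] : exists b, B = [set a; b].
  move: (B2); rewrite (cardsD1 a) aB => -[] /eqP/cards1P[b E]; exists b.
  by rewrite -(setD1K aB) E.
have ab : a != b by move: B2; rewrite EB cards2; case: (a =P b).
have bB : b \in B by rewrite EB !inE eqxx orbT.
have bV := cpart_mem cP BP bB.
have xa : x != a by apply: contraTneq hxa => ->; rewrite h_irr.
have sing (Z : {set T}) : x \in Z -> Z \subset X -> saturated P Z -> #|Z|.+1 = #|P ::&: Z|.*2.
  move=> xZ ZX sZ; have VZ : V :&: Z = Z by apply/setIidPr; exact: subset_trans ZX XV.
  have cZ := cpart_restr cP sZ; rewrite VZ in cZ.
  apply: (card_single_pairs cZ (restr_single xP xZ)) => A; rewrite inE => /andP[AP AZ].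
  by apply: bX => //; exact: subset_trans AZ ZX.
(* A second singleton [y] of [P2] in [X] is refuted by parity. For this a set [Y] is grown from [y]
   in [V :\ a], comparing [C] with [P] after removal of [a]. *)
have only y : [set y] \in P2 -> y \in X -> y = a.
  move=> yP2 yX; apply/eqP; apply: contraT => ya.
  have yC : [set y] \in C by move: yP2; rewrite !inE (inj_eq (@set1_inj T)) (negbTE ya) orbF.
  pose P1 := (P :\ B) :|: [set [set b]].
  have cP1 : cpart (V :\ a) P1.
    have cb : cpart [set b] [set [set b]] by apply: cpart1; [exact: neq_set1|exact: clique1].
    have db : [disjoint V :\: B & [set b]].
      rewrite -setI_eq0; apply/eqP/setP => u; rewrite !inE; apply/negP.
      by move=> /andP[/andP[uB _] /eqP ub]; rewrite ub bB in uB.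
    have := cpartU db (cpartD1 cP BP) cb; congr cpart.
    apply/setP => u; rewrite EB !inE.
    have [->|ub] := eqVneq u b; first by rewrite bV orbT andbT eq_sym ab.
    by rewrite !orbF.
  have [Y [yY YV sP1 sC bY]] := grow cP1 oC yC.
  have aY : a \notin Y by apply/negP => /(subsetP YV); rewrite !inE eqxx.
  have sP1' A u v : A \in P -> A != B -> u \in A -> v \in A -> u \in Y -> v \in Y.
    by move=> AP AB uA vA; apply: (sP1 A _ u v uA vA); rewrite !inE AB AP.
  have sC2 : saturated P2 Y.
    by move=> A /setUP[Ac|/set1P->] u v; [exact: sC|move=> /set1P-> /set1P->].
  have PBdec A : A \in P -> A = B \/ (A != B /\ a \notin A).
    move=> AP; have [->|AB] := eqVneq A B; [by left|right; split=> //].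
    by apply: contra AB => aA; apply/eqP; exact: disjP aA aB.
  (* [Y] respects all parts of [P] except possibly [B], which [P1] cuts down to [b]. If [b] is in
     [Y], adding [a] repairs this; then on [Z] there are equally many parts, but [P] has one
     singleton and pairs whereas [P2] has the two singletons [a] and [y] and pairs. *)
  have [bYY|bY'] := boolP (b \in Y).
    pose Y' := a |: Y.
    have sY' : saturated P Y'.
      move=> A AP u v uA vA; have [EA|[AB aA]] := PBdec _ AP.
        by move: vA; rewrite EA EB !inE => /orP[]/eqP->; rewrite ?eqxx ?bYY ?orbT.
      rewrite !inE => /orP[/eqP ua|uY]; first by rewrite -ua uA in aA.
      by rewrite (sP1' _ _ _ AP AB uA vA uY) orbT.
    have sY2 : saturated P2 Y'.
      move=> A /setUP[Ac|/set1P->] u v uA vA; last first.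
        by move: uA vA => /set1P-> /set1P->.
      rewrite !inE => /orP[/eqP ua|uY]; first by have := aC _ Ac; rewrite -ua uA.
      by rewrite (sC _ Ac _ _ uA vA uY) orbT.
    pose Z := X :&: Y'.
    have sPZ : saturated P Z := saturatedI sP sY'.
    have sP2Z : saturated P2 Z := saturatedI sP2 sY2.
    have aZ : a \in Z by rewrite !inE aX eqxx.
    have xZ := key _ sPZ sP2Z aZ.
    have e1 := sing _ xZ (subsetIl _ _) sPZ.
    have VZ : V :&: Z = Z by apply/setIidPr; apply: subset_trans XV; exact: subsetIl.
    have cZ := cpart_restr cP2 sP2Z; rewrite VZ in cZ.
    have aPZ := restr_single aP2 aZ.
    have cZ' := cpartD1 cZ aPZ.
    have yZ : y \in Z by rewrite !inE yX yY orbT.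
    have yPZ : [set y] \in (P2 ::&: Z) :\ [set a].
      by rewrite in_setD1 (inj_eq (@set1_inj T)) ya restr_single.
    have e2 : #|Z :\ a|.+1 = #|(P2 ::&: Z) :\ [set a]|.*2.
      apply: (card_single_pairs cZ' yPZ) => A; rewrite !inE => /andP[Aa /andP[AP2 AZ]].
      rewrite (negbTE Aa) orbF in AP2; apply: bY => //.
      apply/subsetP => u uA; have := subsetP AZ _ uA; rewrite !inE => /andP[_ /orP[/eqP ua|//]].
      by have := aC _ AP2; rewrite -ua uA.
    move: e1 e2; have := cardsD1 a Z; have := cardsD1 [set a] (P2 ::&: Z).
    by rewrite aZ aPZ (eqc _ sPZ sP2Z); clear; lia.
  have sY : saturated P Y.
    move=> A AP u v uA vA; have [EA|[AB aA]] := PBdec _ AP; last exact: sP1' AP AB uA vA.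
    move: uA; rewrite EA EB => /set2P[]->; first by rewrite (negbTE aY).
    by rewrite (negbTE bY').
  have xY : x \notin Y.
    have : x \in X :&: ~: Y.
      apply: key; [exact: saturatedI sP (saturatedC sY)|exact: saturatedI sP2 (saturatedC sC2)|].
      by rewrite !inE aX aY.
    by rewrite !inE xX.
  (* Now [Z] contains neither [a] nor [x]: here [P] consists of pairs, [P2] of pairs and the
     singleton [y], again with equally many parts. *)
  pose Z := X :&: Y.
  have sPZ : saturated P Z := saturatedI sP sY.
  have sP2Z : saturated P2 Z := saturatedI sP2 sC2.
  have VZ : V :&: Z = Z by apply/setIidPr; apply: subset_trans XV; exact: subsetIl.
  have cZ := cpart_restr cP2 sP2Z; have cZ1 := cpart_restr cP sPZ; rewrite VZ in cZ cZ1.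
  have e1 : #|Z| = #|P ::&: Z|.*2.
    apply: (card_pairs cZ1) => A; rewrite inE => /andP[AP AZ].
    apply: bX => //; first by apply: subset_trans AZ _; exact: subsetIl.
    apply: contraNneq xY => EA; have : x \in A by rewrite EA set11.
    by move=> /(subsetP AZ); rewrite inE => /andP[].
  have yZ : y \in Z by rewrite !inE yX.
  have e2 : #|Z|.+1 = #|P2 ::&: Z|.*2.
    apply: (card_single_pairs cZ (restr_single yP2 yZ)) => A; rewrite inE => /andP[AP2 AZ] Ay.
    apply: bY => //; last by apply: subset_trans AZ _; exact: subsetIr.
    move: AP2 => /setUP[//|/set1P EA]; move: AZ; rewrite EA sub1set inE.
    by rewrite (negbTE aY) andbF.
  by move: e1 e2; rewrite (eqc _ sPZ sP2Z); clear; lia.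
have VX : V :&: X = X by apply/setIidPr.
have cPX := cpart_restr cP sP; have cP2X := cpart_restr cP2 sP2.
exists ((P2 ::&: X) :|: (P ::&: ~: X)); last by rewrite !inE eqxx sub1set aX orbT.
apply: opt_swap => //; apply/eqP; rewrite eqn_leq (opt_swap_le oP sP cP2X) andbT.
(* With equal numbers of parts only singletons matter: on [X] there is only [a] in [P2], and at
   least [x] in [P]. *)
rewrite !weightE (eqc _ sP sP2) leq_add2l.
apply: (@leq_trans 1).
  apply: (@leq_trans #|[set [set a]]|); last by rewrite cards1.
  apply: subset_leq_card; apply/subsetP => A.
  rewrite inE => /andP[]; rewrite inE => /andP[AP2 AX] /cards1P[y EA].
  by rewrite inE EA (only y) -?EA // (subsetP AX) // EA set11.
by rewrite card_gt0; apply/set0Pn; exists [set x]; rewrite !inE xP sub1set xX cards1.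
Qed.

Lemma opt_single_notin V P x y : opt V P -> [set x] \in P -> [set y] \in P -> h x y -> False.
Proof.
move=> oP xP yP hxy; have := opt_single_adj oP xP hxy yP (set11 y).
by rewrite cards1.
Qed.

Lemma gallai V P x y : vertex_critical V -> (forall u v, h u v -> v \in V) ->
  opt V P -> [set x] \in P -> [set y] \in P -> x != y -> ~~ connect h x y.
Proof.
move=> vc hV oP xP yP xy; apply/connectP => -[p hp yE].
have : cosingle V x y by exists P.
elim: p x hp yE {xP yP xy} => [x _ ->|t p IH x /= /andP[hxt hp] yE] [Q [oQ xQ yQ xy]].
  by rewrite eqxx in xy.
have tV := hV _ _ hxt.
have [Q' oQ' tQ'] := adj_single vc oQ xQ tV hxt.
(* Adjacency of [x] and [t] excludes that both are singletons, so the pair of singletons moves on to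
   [t] and [y]. *)
have [[S [oS tS xS _]]|] := sing_swap oQ oQ' xQ yQ xy tQ'; last exact: IH.
by case: (opt_single_notin oS xS tS hxt).
Qed.

End CliquePartitions.

(** * A transversal of the colour classes and its size in the components of h *)

Section Transversal.
Import mathcomp.boot.finset mathcomp.boot.fintype.
Local Open Scope nat_scope.
Variables (T : finType) (h : rel T) (V : {set T}).
Hypothesis h_sym : symmetric h.
Hypothesis h_irr : irreflexive h.
Hypothesis h_V : forall x y, h x y -> y \in V.
Hypothesis vc : vertex_critical h V.
Variable P : {set {set T}}.
Hypothesis oP : opt h V P.
Implicit Types (x y z u v w : T) (X : {set T}).

Let cP : cpart h V P. Proof. by case: oP. Qed.
Let partP : partition P V := cpart_partition cP.
Let tiP : trivIset P. Proof. by case/and3P: partP. Qed.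
Let covP : cover P = V. Proof. exact: cover_partition partP. Qed.

Let S := transversal P V.
Let trS : is_transversal S P V := transversalP partP.
Let W := V :\: S.
Let U := [set x in V | [forall y, ~~ h x y]].
Let K x := [set y in V | connect h x y].

Let inW z : (z \in W) = (z \notin S) && (z \in V). Proof. by rewrite inE. Qed.
Let inK x y : (y \in K x) = (y \in V) && connect h x y. Proof. by rewrite inE. Qed.
Let inX := (in_setI, in_setD, in_setD1, inW, inK).

Let SV : S \subset V. Proof. exact: transversal_sub trS. Qed.
Let cardS : #|S| = #|P|. Proof. exact: card_transversal trS. Qed.

Let csym : connect_sym h. Proof. exact: sym_connect_sym. Qed.

Let blk x : x \in V -> pblock P x \in P /\ x \in pblock P x.
Proof. by move=> xV; rewrite mem_pblock covP xV pblock_mem ?covP. Qed.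

Let blk_connect A x y : A \in P -> x \in A -> y \in A -> connect h x y.
Proof.
move=> AP xA yA; have [->|xy] := eqVneq x y; first exact: connect0.
by have [_ _ _ cl] := cP; apply: connect1; exact: (cl _ AP).
Qed.

Let sat_K x : saturated P (K x).
Proof.
move=> A AP u v uA vA; rewrite !inE => /andP[_ xu].
by rewrite (cpart_mem cP AP vA) (connect_trans xu) // (blk_connect AP).
Qed.

Let S_inj A x y : A \in P -> x \in A -> y \in A -> x \in S -> y \in S -> x = y.
Proof.
move=> AP xA yA xS yS; apply: (pblock_inj trS) => //.
by rewrite (def_pblock tiP AP xA) (def_pblock tiP AP yA).
Qed.

(** For the representative of a part with several elements this is a vertex of [W]; the default
    occurs only for singletons. *)
Let g x := odflt x [pick y in pblock P x :\ x].

Let gP x : x \in V -> [set x] \notin P -> [/\ g x \in pblock P x, g x != x & connect h x (g x)].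
Proof.
move=> xV xP; have [BP xB] := blk xV; rewrite /g; case: pickP => [y|no] /=.
  by rewrite !inE => /andP[yx yB]; rewrite yB yx (blk_connect BP xB yB).
case/negP: xP; rewrite (_ : [set x] = pblock P x) //.
apply/setP => z; rewrite inE; apply/eqP/idP => [->//|zB].
by have := no z; rewrite !inE zB andbT => /negbFE/eqP.
Qed.

Let gW x : x \in S -> [set x] \notin P -> [/\ g x \in W, g x \in pblock P x & connect h x (g x)].
Proof.
move=> xS xP; have xV := subsetP SV _ xS; have [gB gx gc] := gP xV xP.
have [BP xB] := blk xV; split=> //; rewrite inE (cpart_mem cP BP gB) andbT.
by apply: contra gx => gS; apply/eqP; apply: S_inj BP gB xB gS xS.
Qed.

Let g_inj : {in [set x in S | [set x] \notin P] &, injective g}.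
Proof.
move=> x y; rewrite !inE => /andP[xS xP] /andP[yS yP] gE.
have [_ gx _] := gW xS xP; have [_ gy _] := gW yS yP.
have xV := subsetP SV _ xS; have yV := subsetP SV _ yS.
have [Bx xB] := blk xV; have [By yB] := blk yV.
rewrite gE in gx; have E : pblock P x = pblock P y.
  by rewrite -(def_pblock tiP Bx gx) (def_pblock tiP By gy).
by apply: (S_inj Bx xB _ xS yS); rewrite E.
Qed.

Let single_connect x y : [set x] \in P -> [set y] \in P -> connect h x y -> x = y.
Proof.
move=> xP yP xy; apply/eqP; apply: contraTT xy => xy.
exact: (gallai h_sym h_irr vc h_V oP xP yP xy).
Qed.

Let g2 x := odflt x [pick y in W :&: K x].

(** Of two h-neighbours at most one is a singleton class, by Gallai; hence if both are in [S], the
    part of one of them contributes a vertex of [W] to the component. *)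
Let g2P x : x \in S -> x \notin U -> g2 x \in W /\ connect h x (g2 x).
Proof.
move=> xS xU; rewrite /g2; case: pickP => [y|no] /=.
  by rewrite in_setI inK => /andP[yW /andP[_ ->]].
have xV := subsetP SV _ xS.
have [y hxy] : exists y, h x y.
  move: xU; rewrite inE xV /= negb_forall => /existsP[y]; rewrite negbK.
  by exists y.
have yV := h_V hxy.
have out z : z \in W -> connect h x z -> False.
  move=> zW xz; have := no z; rewrite /= in_setI zW inK xz.
  by move: zW; rewrite inW => /andP[_ ->].
have [yS|yS] := boolP (y \in S); last first.
  by case: (out y); [rewrite inE yS|exact: connect1].
have [yP|yP] := boolP ([set y] \in P); last first.
  have [gyW _ gyc] := gW yS yP; case: (out (g y)) => //.
  exact: connect_trans (connect1 hxy) gyc.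
have [xP|xP] := boolP ([set x] \in P); last first.
  by have [gyW _ gyc] := gW xS xP; case: (out (g x)).
have := single_connect xP yP (connect1 hxy) => E.
by move: hxy; rewrite E h_irr.
Qed.

(** Representatives of larger parts inject into [W] by [g]; by Gallai the component has at most one
    singleton part. *)
Let SKle x : #|S :&: K x| <= #|W :&: K x|.+1.
Proof.
pose A := [set y in S :&: K x | [set y] \in P].
rewrite -(cardsID A) addnC -addn1; apply: leq_add.
  rewrite -(card_in_imset (f := g) (D := (S :&: K x) :\: A)); last first.
    apply: sub_in2 g_inj => y; rewrite !(inX, in_set) => /andP[+ /andP[yS yK]].
    by rewrite yS yK.
  apply: subset_leq_card; apply/subsetP => _ /imsetP[y + ->].
  rewrite !(inX, in_set) => /andP[+ /and3P[yS yV xy]]; rewrite yS yV xy /= => yP.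
  have [+ _ yg] := gW yS yP; rewrite inW => /andP[-> ->].
  by rewrite (connect_trans xy).
apply: leq_trans (subset_leq_card (subsetIr _ _)) _.
apply/card_le1_eqP => y z; rewrite !(inX, in_set).
move=> /andP[/and3P[_ _ xy] yP] /andP[/and3P[_ _ xz] zP].
by apply: single_connect => //; apply: connect_trans xy; rewrite csym.
Qed.

(** Larger parts are again counted by [g]. The singleton parts outside [U] lie in different
    components, each of which meets [W], so [g2] injects them into [W] as well. *)
Let SXle X : (forall u v, u \in X -> v \in V -> connect h u v -> v \in X) ->
  #|(S :&: X) :\: U| <= #|W :&: X|.*2.
Proof.
move=> cX; pose A := [set y in S | [set y] \in P].
rewrite -(cardsID A) -addnn; apply: leq_add.
  rewrite -(card_in_imset (f := g2)); last first.
    move=> y z /setIP[/setDP[/setIP[yS yX] yU]]; rewrite in_set => /andP[_ yP].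
    move=> /setIP[/setDP[/setIP[zS zX] zU]]; rewrite in_set => /andP[_ zP].
    have [_ yg] := g2P yS yU; have [_ zg] := g2P zS zU => gE.
    by apply: single_connect => //; apply: connect_trans yg _; rewrite gE csym.
  apply: subset_leq_card; apply/subsetP => _ /imsetP[y + ->].
  move=> /setIP[/setDP[/setIP[yS yX] yU]]; rewrite in_set => /andP[_ yP].
  have [gwW yg] := g2P yS yU; rewrite in_setI gwW /=.
  move: gwW; rewrite inW => /andP[_ gV].
  exact: cX yX gV yg.
rewrite -(card_in_imset (f := g) (D := ((S :&: X) :\: U) :\: A)); last first.
  apply: sub_in2 g_inj => y; rewrite 2!in_setD in_setI !in_set => /andP[+ /and3P[_ yS _]].
  by rewrite yS.
apply: subset_leq_card; apply/subsetP => _ /imsetP[y + ->].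
rewrite 2!in_setD in_setI in_set => /andP[+ /and3P[_ yS yX]]; rewrite yS /= => yP.
have [gwW _ yg] := gW yS yP; rewrite in_setI gwW /=; move: gwW; rewrite inW => /andP[_ gV].
exact: cX yX gV yg.
Qed.

Let cardPK x : #|P ::&: K x| = #|S :&: K x|.
Proof.
have -> : P ::&: K x = pblock P @: (S :&: K x).
  apply/setP => A; rewrite inE; apply/andP/imsetP => [[AP AK]|[y]].
    have : A \in pblock P @: S by rewrite (pblock_transversal trS).
    move=> /imsetP[y yS AE]; exists y => //; rewrite inE yS (subsetP AK) // AE.
    by have [_] := blk (subsetP SV _ yS).
  rewrite inE => /andP[yS yK] ->; have [BP yB] := blk (subsetP SV _ yS); split=> //.
  by apply/subsetP => z zB; apply: (sat_K BP yB zB yK).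
rewrite card_in_imset //; apply: sub_in2 (pblock_inj trS) => y.
by rewrite inE => /andP[].
Qed.

(** Criticality partitions [V :\ u] into a set [Q] of fewer cliques than [P] has. No part of [Q]
    consists of h-neighbours of [u], as [u] could join it; so the non-neighbours of [u] in its
    component are at least as many as the parts of [Q] there, which is at least [#|S :&: K u| - 1].
    The degree is what remains of the component. *)
Let degle u : u \in V -> #|[set v | h u v]| <= #|W :&: K u|.
Proof.
move=> uV; have [Q cQ ltQ] := vc oP uV; have [cov sub disj cl] := cQ.
have [Pm mP] := oP.
have uK : u \in K u by rewrite inE uV connect0.
have memK A y z : A \in Q -> y \in A -> z \in A -> connect h y z.
  move=> AQ yA zA; have [->|yz] := eqVneq y z; first exact: connect0.
  by apply: connect1; exact: (cl _ AQ).
have satQ : saturated Q (K u).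
  move=> A AQ y z yA zA; rewrite !inE => /andP[_ uy].
  have := cpart_mem cQ AQ zA; rewrite inE => /andP[_ ->].
  exact: connect_trans uy (memK _ _ _ AQ yA zA).
pose N := (K u :\ u) :\: [set v | h u v].
have exN A : A \in Q ::&: K u -> exists2 y, y \in A & ~~ h u y.
  rewrite inE => /andP[AQ AK]; apply/exists_inP; apply: contraLR ltQ.
  rewrite negb_exists -leqNgt => /forallP allA.
  have uA : u \notin A by apply/negP => /(cpart_mem cQ AQ); rewrite !inE eqxx.
  have cA : cpart h (u |: A) [set u |: A].
    apply: cpart1; first by apply/set0Pn; exists u; rewrite setU11.
    have ha y : y \in A -> h u y by move=> yA; have := allA y; rewrite yA negbK.
    move=> y z /setU1P[->|yA] /setU1P[->|zA]; rewrite ?eqxx //.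
    - by move=> _; exact: ha.
    - by move=> _; rewrite h_sym ha.
    - exact: (cl _ AQ).
  have cD := cpartD1 cQ AQ.
  have dj : [disjoint (V :\ u) :\: A & u |: A].
    by rewrite -setI_eq0; apply/eqP/setP => y; rewrite !inE; case: (y == u); case: (y \in A); rewrite ?andbF.
  have EV : ((V :\ u) :\: A) :|: (u |: A) = V.
    apply/setP => y; rewrite !inE; have [->|yu] /= := eqVneq y u; first by rewrite uV orbT.
    have [yA|yA] := boolP (y \in A); last by rewrite orbF.
    by have := cpart_mem cQ AQ yA; rewrite in_setD1 => /andP[_ ->].
  have cV := cpartU dj cD cA; rewrite EV in cV.
  have := opt_card oP cV; rewrite (cardU_cpart dj cD cA) cards1.
  by rewrite (cardsD1 A Q) AQ addnC.
have leN : #|Q ::&: K u| <= #|N|.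
  pose p (A : {set T}) := odflt u [pick y in A | ~~ h u y].
  have pP (A : {set T}) : A \in Q ::&: K u -> p A \in A /\ ~~ h u (p A).
    move=> AQK; rewrite /p; case: pickP => [y /andP[]//|no].
    by have [y yA hy] := exN _ AQK; have := no y; rewrite /= yA hy.
  rewrite -(card_in_imset (f := p) (D := Q ::&: K u)); last first.
    move=> A B AQ BQ pE; have [pA _] := pP _ AQ; have [pB _] := pP _ BQ.
    move: AQ BQ; rewrite !inE => /andP[AQ _] /andP[BQ _].
    by apply: (disj _ _ AQ BQ (p A)); rewrite // pE.
  apply: subset_leq_card; apply/subsetP => _ /imsetP[A AQ ->].
  have [pA hp] := pP _ AQ; move: AQ; rewrite inE => /andP[AQ AK].
  rewrite !inE hp; have := cpart_mem cQ AQ pA; rewrite !inE => /andP[-> _].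
  by have := subsetP AK _ pA; rewrite !inE.
have leQ : #|S :&: K u| <= #|Q ::&: K u|.+1.
  have cQK := cpart_restr cQ satQ.
  have cu : cpart h [set u] [set [set u]] by apply: cpart1; [exact: neq_set1|exact: clique1].
  have dj : [disjoint (V :\ u) :&: K u & [set u]].
    rewrite -setI_eq0; apply/eqP/setP => y; rewrite !inE.
    by case: (y == u); rewrite ?andbF.
  have E : ((V :\ u) :&: K u) :|: [set u] = V :&: K u.
    apply/setP => y; rewrite !inE; have [->|_] := eqVneq y u; last by rewrite /= orbF.
    by rewrite uV connect0 orbT.
  have := cpartU dj cQK cu; rewrite E => cR.
  have := weight_le_card (cpart_restr cP (@sat_K u)) cR (opt_swap_le oP (@sat_K u) cR).
  by rewrite cardPK (cardU_cpart dj cQK cu) cards1 addn1.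
have KE : #|K u| = #|S :&: K u| + #|W :&: K u|.
  rewrite -(cardsID S) setIC; congr (_ + _); apply: eq_card => y; rewrite !inE.
  by case: (y \in V); rewrite ?andbF ?andbT.
have : #|K u| = 1 + (#|[set v | h u v]| + #|N|).
  rewrite (cardsD1 u) uK; congr (_ + _); rewrite -(cardsID [set v | h u v] (K u :\ u)).
  congr (_ + _); apply: eq_card => y; rewrite !inE; apply: andb_idl => huy.
  by rewrite (h_V huy) (connect1 huy) !andbT; apply: contraTneq huy => ->; rewrite h_irr.
by rewrite KE; move: leQ leN; clear; lia.
Qed.

Lemma gallai_transversal : exists S0 : {set T},
  [/\ S0 \subset V /\ #|S0| = #|P|,
      [set x in V | [forall y, ~~ h x y]] \subset S0,
      forall x, #|S0 :&: K x| <= #|(V :\: S0) :&: K x|.+1,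
      forall X, (forall u v, u \in X -> v \in V -> connect h u v -> v \in X) ->
        #|(S0 :&: X) :\: [set x in V | [forall y, ~~ h x y]]| <= #|(V :\: S0) :&: X|.*2 &
      forall u, u \in V -> #|[set v | h u v]| <= #|(V :\: S0) :&: K u|].
Proof.
exists S; split; [by []| |by []|by []|by []].
apply/subsetP => x; rewrite inE => /andP[xV /forallP hx].
apply: contraT => xS; have [BP xB] := blk xV; have [y yS yE] : exists2 y, y \in S & pblock P x = pblock P y.
  have : pblock P x \in pblock P @: S by rewrite (pblock_transversal trS).
  by move=> /imsetP[y]; exists y.
have [_ yB] := blk (subsetP SV _ yS); rewrite -yE in yB.
have xy : x != y by apply: contraNneq xS => ->.
by have [_ _ _ cl] := cP; have := cl _ BP _ _ xB yB xy; rewrite (negbTE (hx y)).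
Qed.

End Transversal.

(** * Greedy colouring of a conflict graph, and injections between finite sets *)

Section Greedy.
Import mathcomp.boot.finset mathcomp.boot.fintype.
Local Open Scope nat_scope.

Lemma greedy_coloring (X C : finType) (c0 : C) (conf : rel X) (F : {set X}) (B : {set C}) :
  symmetric conf ->
  {in F, forall f, #|[set g in F | conf f g && (g != f)]| < #|B|} ->
  exists zeta : X -> C, {in F, forall f, zeta f \in B} /\
    {in F &, forall f g, conf f g -> f != g -> zeta f != zeta g}.
Proof.
move=> cs; have [k] := ubnP #|F|; elim: k F => // k IH F leF bF.
have [F0|/set0Pn[f fF]] := eqVneq F set0.
  by exists (fun=> c0); split=> [f|f g]; rewrite F0 inE.
have [||z [zB zF]] := IH (F :\ f).
- by move: leF; rewrite (cardsD1 f) fF.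
- move=> g /setD1P[gf gF]; apply: leq_ltn_trans (bF _ gF); apply: subset_leq_card.
  by apply/subsetP => x; rewrite !inE => /and3P[/andP[_ ->] -> ->].
pose N := [set g in F | conf f g && (g != f)].
have [b bB bN] : exists2 b, b \in B & b \notin z @: N.
  have : 0 < #|B :\: z @: N|.
    rewrite cardsD subn_gt0; apply: leq_ltn_trans (bF _ fF).
    apply: leq_trans (leq_imset_card z N); apply: subset_leq_card; exact: subsetIr.
  by rewrite card_gt0 => /set0Pn[b /setDP[bB bN]]; exists b.
exists (fun g => if g == f then b else z g); split=> [g gF|g1 g2 g1F g2F cf ne].
  by case: eqVneq => // gf; apply: zB; rewrite !inE gf.
have zN g : g \in F -> conf f g -> g != f -> b != z g.
  by move=> gF fg gf; apply: contraNneq bN => ->; apply/imsetP; exists g; rewrite // !inE gF fg.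
have [E1|n1] := eqVneq g1 f.
  by subst g1; rewrite [g2 == f]eq_sym (negbTE ne) zN // eq_sym.
have [E2|n2] := eqVneq g2 f; first by subst g2; rewrite eq_sym zN // cs.
by apply: zF => //; rewrite !inE ?n1 ?n2.
Qed.

(* Injects A into B when #|A| <= #|B|. *)
Definition emb (T : finType) (A B : {set T}) x := nth x (enum B) (index x (enum A)).

Lemma emb_mem (T : finType) (A B : {set T}) x : #|A| <= #|B| -> x \in A -> emb A B x \in B.
Proof.
move=> AB xA; rewrite -mem_enum mem_nth // -cardE; apply: leq_trans AB.
by rewrite cardE index_mem mem_enum.
Qed.

Lemma emb_inj (T : finType) (A B : {set T}) : #|A| <= #|B| -> {in A &, injective (emb A B)}.
Proof.
move=> AB x y xA yA; rewrite /emb.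
have lt z : z \in A -> index z (enum A) < size (enum B).
  by move=> zA; rewrite -cardE; apply: leq_trans AB; rewrite cardE index_mem mem_enum.
rewrite (set_nth_default y) ?lt // => /eqP; rewrite nth_uniq ?lt ?enum_uniq // => /eqP E.
by have := congr1 (nth x (enum A)) E; rewrite !nth_index ?mem_enum.
Qed.

End Greedy.

(** * Edge-disjoint paths of length at most 4 for the non-adjacent pairs of [S] *)

Section Routing.
Import mathcomp.boot.finset mathcomp.boot.fintype.
Local Open Scope nat_scope.

Definition path_edges (T : finType) (p : seq T) : seq {set T} :=
  [seq [set ab.1; ab.2] | ab <- zip p (behead p)].

Variables (T : finType) (h : rel T) (V S : {set T}).
Hypothesis h_sym : symmetric h.
Hypothesis h_irr : irreflexive h.
Hypothesis h_V : forall x y, h x y -> y \in V.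
Let W := V :\: S.
Let U := [set x in V | [forall y, ~~ h x y]].
Let K x := [set y in V | connect h x y].
Hypothesis SV : S \subset V.
Hypothesis US : U \subset S.
Hypothesis SK : forall x, #|S :&: K x| <= #|W :&: K x|.+1.
Hypothesis SX : forall X : {set T},
  (forall u v, u \in X -> v \in V -> connect h u v -> v \in X) ->
  #|(S :&: X) :\: U| <= #|W :&: X|.*2.
Hypothesis degh : forall u, u \in V -> #|[set v | h u v]| <= #|W :&: K u|.
Implicit Types (x y z u v w : T) (f g : {set T}).

Let inW z : (z \in W) = (z \notin S) && (z \in V). Proof. by rewrite in_setD. Qed.
Let inK x y : (y \in K x) = (y \in V) && connect h x y. Proof. by rewrite in_set. Qed.
Let csym : connect_sym h. Proof. exact: sym_connect_sym. Qed.

Let N u := [set v in S | h u v].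
Let D u := (W :&: K u) :\: [set v | h u v].
(** The path for the pair of [u] and [v] continues from [u] to [phi u v], a vertex of [W] adjacent
    to [u] in G, and arrives at [v] from [phi v u]. Injectivity in [v] keeps these first edges
    distinct. *)
Let phi u := emb (N u) (D u).

(** Obtained from [degh] by removing the h-neighbours of [u] in [W] from both sides. *)
Let ND u : u \in S -> #|N u| <= #|D u|.
Proof.
move=> uS; have := degh (subsetP SV _ uS).
rewrite -(cardsID S) -(cardsID [set v | h u v] (W :&: K u)).
rewrite (_ : [set v | h u v] :&: S = N u); last by apply/setP => v; rewrite !inE andbC.
rewrite (_ : (W :&: K u) :&: [set v | h u v] = [set v | h u v] :\: S).
  by rewrite addnC leq_add2l.
apply/setP => v; rewrite in_setI in_setI inW inK in_setD !in_set.
have [huv|_] := boolP (h u v); last by rewrite !andbF.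
by rewrite (h_V huv) (connect1 huv) !andbT.
Qed.

Let phiP u v : u \in S -> v \in S -> h u v ->
  [/\ phi u v \in W, connect h u (phi u v) & ~~ h u (phi u v)].
Proof.
move=> uS vS huv; have : phi u v \in D u by apply: emb_mem; rewrite ?ND // inE vS.
by rewrite in_setD in_setI inK in_set => /and3P[hn pW /andP[_ ->]].
Qed.

Let phi_inj u v v' : u \in S -> v \in S -> v' \in S -> h u v -> h u v' ->
  phi u v = phi u v' -> v = v'.
Proof.
by move=> uS vS v'S huv huv'; apply: emb_inj; rewrite ?ND // inE ?vS ?v'S.
Qed.

Let F := [set f : {set T} | [exists u, exists v,
  [&& u \in S, v \in S, h u v & f == [set u; v]]]].
Let FP f : reflect (exists u v, [/\ u \in S, v \in S, h u v & f = [set u; v]]) (f \in F).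
Proof.
rewrite inE; apply: (iffP existsP) => [[u /existsP[v /and4P[uS vS huv /eqP E]]]|].
  by exists u, v.
by move=> [u [v [uS vS huv E]]]; exists u; apply/existsP; exists v; rewrite uS vS huv E eqxx.
Qed.

Let ends f := [set w | [exists u, exists v,
  [&& u \in S, v \in S, h u v, f == [set u; v] & w == phi u v]]].
Let endsP f w : reflect (exists u v, [/\ u \in S, v \in S, h u v, f = [set u; v] & w = phi u v])
  (w \in ends f).
Proof.
rewrite inE; apply: (iffP existsP) => [[u /existsP[v /and5P[uS vS huv /eqP E /eqP wE]]]|].
  by exists u, v.
move=> [u [v [uS vS huv E wE]]]; exists u; apply/existsP; exists v.
by rewrite uS vS huv E wE !eqxx.
Qed.

Let set2_inj (u v u' v' : T) : [set u; v] = [set u'; v'] -> (u = u' /\ v = v') \/ (u = v' /\ v = u').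
Proof.
move=> E; have : u \in [set u'; v'] by rewrite -E !inE eqxx.
have : v \in [set u'; v'] by rewrite -E !inE eqxx orbT.
have : u' \in [set u; v] by rewrite E !inE eqxx.
have : v' \in [set u; v] by rewrite E !inE eqxx orbT.
by rewrite !inE => /orP[]/eqP e1 /orP[]/eqP e2 /orP[]/eqP e3 /orP[]/eqP e4; subst; auto.
Qed.

Let ends2 u v w : u \in S -> v \in S -> h u v -> w \in ends [set u; v] ->
  w = phi u v \/ w = phi v u.
Proof.
move=> uS vS huv /endsP[u' [v' [_ _ _ E ->]]].
by have [[-> ->]|[-> ->]] := set2_inj E; [left|right].
Qed.

Let M w := [set f in F | w \in ends f].

(** A pair that uses [w] is determined by the end [u] from which it reaches [w], and [u] lies in the
    component of [w]. *)
Let cardM w : #|M w| <= #|S :&: K w|.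
Proof.
pose psi u := odflt u [pick v in N u | phi u v == w].
apply: leq_trans (leq_imset_card (fun u => [set u; psi u]) _).
apply: subset_leq_card; apply/subsetP => f; rewrite in_set => /andP[fF].
move=> /endsP[u [v [uS vS huv fE wE]]]; apply/imsetP; exists u.
  rewrite in_setI uS inK (subsetP SV _ uS) csym /=.
  by have [_ + _] := phiP uS vS huv; rewrite wE.
rewrite fE /psi; case: pickP => [v' /andP[]|no] /=.
  rewrite inE => /andP[v'S huv'] /eqP pE; congr [set u; _].
  by apply: phi_inj huv huv' _; rewrite // pE.
by have := no v; rewrite /= inE vS huv wE eqxx.
Qed.

Let cardKK u w : connect h u w -> #|S :&: K w| = #|S :&: K u|.
Proof.
move=> uw; congr #|pred_of_set _|; apply/setP => x; rewrite !in_setI !inK.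
by rewrite (same_connect csym uw).
Qed.

(** Every pair uses a vertex [w] of [W], and [w] is used by at most [#|S :&: K w| <= #|W|.+1]
    pairs. *)
Let cardF : #|F| <= #|W| * #|W|.+1.
Proof.
have sub : F \subset \bigcup_(w in W) M w.
  apply/subsetP => f fF; have /FP[u [v [uS vS huv fE]]] := fF.
  have [pW _ _] := phiP uS vS huv; apply/bigcupP; exists (phi u v) => //.
  by rewrite in_set fF; apply/endsP; exists u, v.
apply: leq_trans (subset_leq_card sub) _.
have bc (A : {set T}) : #|\bigcup_(w in A) M w| <= \sum_(w in A) #|M w|.
  have [k] := ubnP #|A|; elim: k A => // k IH A leA.
  have [->|/set0Pn[a aA]] := eqVneq A set0; first by rewrite big_set0 cards0.
  rewrite (big_setD1 a aA) [X in _ <= X](big_setD1 a aA) /=.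
  apply: leq_trans (leq_card_setU _ _) _; rewrite leq_add2l; apply: IH.
  by move: leA; rewrite (cardsD1 a) aA.
apply: leq_trans (bc _) _; rewrite -sum_nat_const; apply: leq_sum => w wW.
apply: leq_trans (cardM w) _; apply: leq_trans (SK w) _; rewrite ltnS.
by apply: subset_leq_card; exact: subsetIl.
Qed.

Variable m : nat.
Hypothesis m_le : m + 3 * #|W| + 4 <= #|S|.

(** Outside [K u] all but [2 * #|W :\: K u|] vertices of [S] are universal, by [SX]; inside there
    are at most [#|W :&: K u| + 1], which are paid for three times. This makes at most
    [3 * #|W| + 3], and one more for the strict inequality. *)
Let cardU u : #|S :&: K u|.*2 + m <= #|U| /\ 0 < #|U| - m.
Proof.
have cX : forall a b, a \in ~: K u -> b \in V -> connect h a b -> b \in ~: K u.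
  move=> a b; rewrite !in_setC !inK => aK bV ab; rewrite bV /=; apply: contra aK => ub.
  rewrite (connect_trans ub) ?andbT; last by rewrite csym.
  have [<-|ba] := eqVneq b a => //.
  move/connectP: ab => [[|c p] /= pp E]; first by rewrite E eqxx in ba.
  by move: pp; rewrite h_sym => /andP[/h_V].
have := SX cX; have := SK u.
have := cardsID (K u) S; have := cardsID (K u) W.
have := cardsID U (S :&: ~: K u).
have : #|(S :&: ~: K u) :&: U| <= #|U| by apply: subset_leq_card; exact: subsetIr.
rewrite -!setDE; move: m_le; clear.
move: #|U| #|W| #|S| #|_ :&: U| #|_ :\: U| #|_ :\: K u| #|_ :\: K u| #|_ :&: K u| #|_ :&: K u|.
by lia.
Qed.

Definition free_adj x y := [&& x \in V, y \in V, x != y & ~~ h x y].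

(** The path is [u], [phi u v], [zeta f], [phi v u], [v], without the detour through the universal
    vertex [zeta f] if the two vertices of [W] coincide. Pairs sharing a vertex of [W] conflict and
    receive different values of [zeta]. All edges of these paths join [W] to [S] outside [U2], so
    they avoid both the edges inside [S] and those between [W] and [U2]. *)
Lemma routing : exists (U2 : {set T}) (F0 : {set {set T}}) (rt : {set T} -> seq T),
  [/\ U2 \subset S /\ #|U2| = m,
      forall w z, w \in W -> z \in U2 -> ~~ h w z,
      #|F0| <= #|W| * #|W|.+1,
      forall f, f \subset S -> #|f| = 2 -> exists x p,
        [/\ rt f = x :: p, f = [set x; last x p] /\ uniq (x :: p), size p <= 4,
            path free_adj x p & f \notin F0 -> size p = 1] &
      (forall f g e, f \subset S -> g \subset S -> #|f| = 2 -> #|g| = 2 -> f != g ->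
        e \in path_edges (rt f) -> e \in path_edges (rt g) -> False) /\
      (forall f e w z, f \subset S -> #|f| = 2 -> e \in path_edges (rt f) ->
        w \in W -> z \in U2 -> e <> [set w; z])].
Proof.
have [u0 u0S] : exists u, u \in S.
  by apply/set0Pn; rewrite -card_gt0; move: m_le; clear; lia.
pose U2 := [set x in take m (enum U)]; pose U1 := U :\: U2.
have U2U : U2 \subset U.
  by apply/subsetP => x; rewrite in_set => /mem_take; rewrite mem_enum.
have cU2 : #|U2| = m.
  have [_ lt] := cardU u0.
  rewrite cardsE; have /card_uniqP-> : uniq (take m (enum U)) by rewrite take_uniq ?enum_uniq.
  by rewrite size_take -cardE -subn_gt0 lt.
have cU1 u : #|S :&: K u|.*2 <= #|U1|.
  by have [le _] := cardU u; rewrite cardsD (setIidPr U2U) cU2; move: le; clear; lia.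
have cU10 : 0 < #|U1| by rewrite cardsD (setIidPr U2U) cU2; have [] := cardU u0.
pose conf f g := ends f :&: ends g != set0.
have conf_sym : symmetric conf by move=> f g; rewrite /conf setIC.
have bconf : {in F, forall f, #|[set g in F | conf f g && (g != f)]| < #|U1|}.
  move=> f fF; have /FP[u [v [uS vS huv fE]]] := fF.
  have [_ uw _] := phiP uS vS huv; have hvu : h v u by rewrite h_sym.
  have [_ vw _] := phiP vS uS hvu.
  (* The inequality is strict because [f] belongs to this union but is not counted among its own
     conflicts. *)
  apply: (@leq_trans #|M (phi u v) :|: M (phi v u)|).
    apply: proper_card; apply/properP; split.
      apply/subsetP => g; rewrite in_set => /and3P[gF /set0Pn[w /setIP[wf wg]] _].
      have gM : g \in M w by rewrite in_set gF.
      by rewrite fE in wf; have [<-|<-] := ends2 uS vS huv wf; rewrite in_setU gM ?orbT.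
    exists f; last by rewrite in_set eqxx !andbF.
    by rewrite in_setU in_set fF /=; apply/orP; left; apply/endsP; exists u, v.
  apply: leq_trans (leq_card_setU _ _) _; apply: leq_trans (cU1 u).
  rewrite -addnn; apply: leq_add; apply: leq_trans (cardM _) _; rewrite leq_eqVlt.
    by rewrite (cardKK uw) eqxx.
  by rewrite (cardKK (connect_trans (connect1 huv) vw)) eqxx.
have [zeta [zU1 zne]] := greedy_coloring u0 conf_sym bconf.
pose rep f := odflt (u0, u0) [pick ab : T * T |
  [&& ab.1 \in S, ab.2 \in S, h ab.1 ab.2 & f == [set ab.1; ab.2]]].
have repP f : f \in F -> [/\ (rep f).1 \in S, (rep f).2 \in S, h (rep f).1 (rep f).2 &
    f = [set (rep f).1; (rep f).2]].
  move=> /FP[u [v [uS vS huv fE]]]; rewrite /rep; case: pickP => [ab /and4P[? ? ? /eqP ?]//|no].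
  by have := no (u, v); rewrite /= uS vS huv fE eqxx.
pose rep0 f := odflt (u0, u0) [pick ab : T * T | (ab.1 != ab.2) && (f == [set ab.1; ab.2])].
have rep0P f : #|f| = 2 -> (rep0 f).1 != (rep0 f).2 /\ f = [set (rep0 f).1; (rep0 f).2].
  move=> /eqP/cards2P[u [v [uv fE]]]; rewrite /rep0; case: pickP => [ab /andP[? /eqP ?]//|no].
  by have := no (u, v); rewrite /= uv fE eqxx.
pose rt f := if f \in F then
    let u := (rep f).1 in let v := (rep f).2 in
    if phi u v == phi v u then [:: u; phi u v; v] else [:: u; phi u v; zeta f; phi v u; v]
  else [:: (rep0 f).1; (rep0 f).2].
have Uadj z x : z \in U -> ~~ h z x by rewrite in_set => /andP[_ /forallP].
have edgeF f e : f \in F -> e \in path_edges (rt f) -> exists s w,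
    [/\ e = [set s; w], s \in S, w \in W, s \notin U2 &
     (exists v, [/\ v \in S, h s v, f = [set s; v] & w = phi s v]) \/
     (s = zeta f /\ w \in ends f)].
  move=> fF; have [uS vS huv fE] := repP _ fF; rewrite /rt fF.
  set u := (rep f).1 in uS huv fE *; set v := (rep f).2 in vS huv fE *.
  have hvu : h v u by rewrite h_sym.
  have [w1W _ _] := phiP uS vS huv; have [w2W _ _] := phiP vS uS hvu.
  have uU : u \notin U2 by apply/negP => /(subsetP U2U)/(Uadj _ v); rewrite huv.
  have vU : v \notin U2 by apply/negP => /(subsetP U2U)/(Uadj _ u); rewrite hvu.
  have e1 : exists s w, [/\ [set u; phi u v] = [set s; w], s \in S, w \in W, s \notin U2 &
     (exists v, [/\ v \in S, h s v, f = [set s; v] & w = phi s v]) \/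
     (s = zeta f /\ w \in ends f)].
    by exists u, (phi u v); split=> //; left; exists v.
  have e2 : exists s w, [/\ [set phi v u; v] = [set s; w], s \in S, w \in W, s \notin U2 &
     (exists v, [/\ v \in S, h s v, f = [set s; v] & w = phi s v]) \/
     (s = zeta f /\ w \in ends f)].
    exists v, (phi v u); split=> //; first by rewrite setUC.
    by left; exists u; split=> //; rewrite fE setUC.
  have /setDP[zU zU2] := zU1 _ fF; have zS := subsetP US _ zU.
  case: eqP => [pE|_] /=.
    rewrite /path_edges /= !in_cons in_nil orbF => /orP[]/eqP-> //.
    by rewrite pE.
  rewrite /path_edges /= !in_cons in_nil orbF => /or4P[]/eqP-> //.
    exists (zeta f), (phi u v); split=> //; first by rewrite setUC.
    by right; split=> //; apply/endsP; exists u, v.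
  exists (zeta f), (phi v u); split=> //.
  by right; split=> //; apply/endsP; exists v, u; split=> //; rewrite fE setUC.
have edge0 f e : f \notin F -> #|f| = 2 -> e \in path_edges (rt f) -> e = f.
  move=> fF f2; rewrite /rt (negbTE fF) /path_edges /= in_cons in_nil orbF => /eqP->.
  by have [_ /esym] := rep0P _ f2.
have WS w : w \in W -> w \notin S by rewrite inW => /andP[].
have sw_inj s w s' w' : s \in S -> s' \in S -> w \in W -> w' \in W ->
    [set s; w] = [set s'; w'] -> s = s' /\ w = w'.
  move=> sS s'S wW w'W /set2_inj[//|[E _]].
  by have := WS _ w'W; rewrite -E sS.
exists U2, F, rt; split.
- by split=> //; exact: subset_trans US.
- by move=> w z _ /(subsetP U2U)/(Uadj _ w); rewrite h_sym.
- exact: cardF.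
- move=> f fS f2; rewrite /rt; case: ifP => [fF|/negbT fF].
    have [uS vS huv fE] := repP _ fF.
    set u := (rep f).1 in uS huv fE *; set v := (rep f).2 in vS huv fE *.
    have hvu : h v u by rewrite h_sym.
    have [w1W _ n1] := phiP uS vS huv; have [w2W _ n2] := phiP vS uS hvu.
    have [n1' n2'] : ~~ h (phi u v) u /\ ~~ h (phi v u) v by rewrite !(h_sym (phi _ _)).
    have /setDP[zU zU2] := zU1 _ fF; have zS := subsetP US _ zU.
    have uU : u \notin U by apply/negP => /(Uadj _ v); rewrite huv.
    have vU : v \notin U by apply/negP => /(Uadj _ u); rewrite hvu.
    have ne s w : s \in S -> w \in W -> (s != w) && (w != s).
      by move=> sS wW; rewrite eq_sym andbb; apply: contraNneq (WS _ wW) => ->.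
    have nz s : s \notin U -> (s != zeta f) && (zeta f != s).
      by move=> sU; rewrite eq_sym andbb; apply: contraNneq sU => <-.
    have uv : u != v by apply: contraTneq huv => ->; rewrite h_irr.
    have WV w : w \in W -> w \in V by rewrite inW => /andP[].
    have [/andP[a1 a2] /andP[a3 a4]] := (ne _ _ uS w1W, ne _ _ vS w1W).
    have [/andP[b1 b2] /andP[b3 b4]] := (ne _ _ uS w2W, ne _ _ vS w2W).
    have [/andP[c1 c2] /andP[c3 c4]] := (ne _ _ zS w1W, ne _ _ zS w2W).
    have [/andP[d1 d2] /andP[d3 d4]] := (nz _ uU, nz _ vU).
    have [[uV vV] zV] := (subsetP SV _ uS, subsetP SV _ vS, subsetP SV _ zS).
    have [w1V w2V] := (WV _ w1W, WV _ w2W).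
    case: eqP => [pE|/eqP pE].
      exists u, [:: phi u v; v]; split=> //.
        by split=> //=; rewrite !inE !negb_or a1 uv a4.
      by rewrite /= /free_adj uV w1V vV a1 a4 n1 pE n2'.
    exists u, [:: phi u v; zeta f; phi v u; v]; split=> //.
      by split=> //=; rewrite !inE !negb_or a1 d1 b1 uv c2 pE a4 c3 d4 b4.
    rewrite /= /free_adj uV w1V vV w2V zV a1 n1 c2 c3 b4 n2' (Uadj _ _ zU) // !andbT /=.
    by rewrite h_sym (Uadj _ _ zU).
  have [uv fE] := rep0P _ f2; set u := (rep0 f).1 in uv fE *; set v := (rep0 f).2 in uv fE *.
  have uS : u \in S by apply: (subsetP fS); rewrite fE !inE eqxx.
  have vS : v \in S by apply: (subsetP fS); rewrite fE !inE eqxx orbT.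
  exists u, [:: v]; split=> //.
    by split=> //=; rewrite inE uv.
  rewrite /= /free_adj (subsetP SV _ uS) (subsetP SV _ vS) uv andbT /=.
  by apply: contra fF => huv; apply/FP; exists u, v.
- split.
    move=> f g e fS gS f2 g2 fg.
    have [fF|fF] := boolP (f \in F); have [gF|gF] := boolP (g \in F).
    + move=> /(edgeF _ _ fF)[s [w [-> sS wW _ cf]]] /(edgeF _ _ gF)[s' [w' [E s'S w'W _ cg]]].
      have [? ?] := sw_inj _ _ _ _ sS s'S wW w'W E; subst s' w'.
      (* Separates the two kinds of edges: the end [s] in [S] of a common edge cannot have an
         h-neighbour for one path and be universal for the other. *)
      have Unh k x : k \in F -> h (zeta k) x -> False.
        by move=> kF hx; have /setDP[/(Uadj _ x) + _] := zU1 _ kF; rewrite hx.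
      case: cf cg => [[v [vS hsv fE wE]]|[sE wf]] [[v' [v'S hsv' gE wE']]|[sE' wg]].
      * move/eqP: fg; apply; rewrite fE gE; congr [set _; _].
        by apply: phi_inj hsv hsv' _; rewrite // -wE.
      * by apply: (Unh g v) => //; rewrite -sE'.
      * by apply: (Unh f v') => //; rewrite -sE.
      * have H := zne _ _ fF gF; rewrite -sE -sE' eqxx in H.
        have cfg : conf f g by apply/set0Pn; exists w; rewrite in_setI wf wg.
        by have := H cfg fg.
    + move=> /(edgeF _ _ fF)[s [w [-> sS wW _ _]]] /(edge0 _ _ gF g2) E.
      by have := WS _ wW; rewrite (subsetP gS) // -E !inE eqxx orbT.
    + move=> /(edge0 _ _ fF f2)-> /(edgeF _ _ gF)[s [w [E sS wW _ _]]].
      by have := WS _ wW; rewrite (subsetP fS) // E !inE eqxx orbT.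
    + by move=> /(edge0 _ _ fF f2)-> /(edge0 _ _ gF g2) E; rewrite E eqxx in fg.
  move=> f e w z fS f2 + wW zU2.
  have zS : z \in S by apply: (subsetP US); exact: (subsetP U2U).
  have [fF|fF] := boolP (f \in F).
    move=> /(edgeF _ _ fF)[s [w' [-> sS w'W sU _]]] /set2_inj[[sw _]|[sz _]].
      by have := WS _ wW; rewrite -sw sS.
    by rewrite sz zU2 in sU.
  move=> /(edge0 _ _ fF f2)-> E.
  by have := WS _ wW; rewrite (subsetP fS) // E !inE eqxx.
Qed.

End Routing.

(** * Crossings of a ray by a segment, counted modulo 2 *)

Section Hop.
Variable R : realFieldType.
Implicit Types (z w u : R * R).

Definition dot z w : R := z.1 * w.1 + z.2 * w.2.
Definition cross z w : R := z.1 * w.2 - z.2 * w.1.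
(** The half-plane is half-open so that it contains exactly one of [z] and [- z] for every nonzero
    [z]. *)
Definition upper z : bool := (0 < z.2) || ((z.2 == 0) && (0 < z.1)).

(* For z and w in a common open half-plane bounded by a line through 0, the
   segment from z to w avoids 0 and hop records the parity of its crossings with
   the positive first axis. *)
Definition hop z w : bool :=
  (upper z (+) upper w) && (0 < (if upper w then cross z w else cross w z)).

Lemma upperP z : reflect (0 < z.2 \/ z.2 = 0 /\ 0 < z.1) (upper z).
Proof.
apply: (iffP orP) => -[H|]; [by left|move=> /andP[/eqP]; by right|by left|].
by move=> [-> H]; right; rewrite eqxx.
Qed.

Lemma upperPn z : ~~ upper z -> z.2 < 0 \/ z.2 = 0 /\ z.1 <= 0.
Proof.
rewrite /upper negb_or -leNgt => /andP[]; rewrite le_eqVlt => /orP[/eqP->|]; last by left.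
by rewrite eqxx /= -leNgt; right.
Qed.

Lemma upper_opp z : z != 0 -> upper (- z) = ~~ upper z.
Proof.
case: z => a b; rewrite /upper /= -[0]/(0, 0) xpair_eqE negb_and oppr_gt0 oppr_eq0 oppr_gt0.
by case: (ltgtP b 0) => [||b0] //=; rewrite orbF; case: (ltgtP a 0).
Qed.

Lemma cross_right u z w : 0 <= u.1 -> 0 < dot u z -> 0 < dot u w ->
  ~~ upper z -> upper w -> 0 < cross z w.
Proof.
case: u z w => [u1 u2] [z1 z2] [w1 w2]; rewrite /dot /cross /= => u0 uz uw.
move=> /upperPn /= hz /upperP /= hw.
(* Expresses the cross product through the heights [z2 <= 0 <= w2] and the positive scalar products
   with [u]. *)
have E : u1 * (z1 * w2 - z2 * w1) = w2 * (u1 * z1 + u2 * z2) - z2 * (u1 * w1 + u2 * w2) by ring.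
suff : 0 < u1 * (z1 * w2 - z2 * w1).
  rewrite pmulr_rgt0 // lt_neqAle u0 andbT; apply/eqP => u00; subst u1.
  by case: hz hw => [hz|[hz hz']] [hw|[hw hw']]; nra.
by rewrite E; case: hz hw => [hz|[hz hz']] [hw|[hw hw']]; nra.
Qed.

Lemma cross_left u z w : u.1 <= 0 -> 0 < dot u z -> 0 < dot u w ->
  ~~ upper z -> upper w -> cross z w <= 0.
Proof.
case: u z w => [u1 u2] [z1 z2] [w1 w2]; rewrite /dot /cross /= => u0 uz uw.
move=> /upperPn /= hz /upperP /= hw.
have E : u1 * (z1 * w2 - z2 * w1) = w2 * (u1 * z1 + u2 * z2) - z2 * (u1 * w1 + u2 * w2) by ring.
rewrite leNgt; apply/negP => c0.
have : u1 * (z1 * w2 - z2 * w1) <= 0 by rewrite mulr_le0_ge0 // ltW.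
by rewrite E; case: hz hw => [hz|[hz hz']] [hw|[hw hw']]; nra.
Qed.

(** The half-plane given by [u] misses the negative first axis, so a change of side is a crossing of
    the positive one. In [hop_left] it misses the positive axis instead. *)
Lemma hop_right u z w : 0 <= u.1 -> 0 < dot u z -> 0 < dot u w ->
  hop z w = upper z (+) upper w.
Proof.
move=> u0 uz uw; rewrite /hop; apply: andb_idr.
by case: ifPn => hw; case: (boolP (upper z)) => //= hz _;
  [exact: cross_right uz uw hz hw|exact: cross_right uw uz hw hz].
Qed.

Lemma hop_left u z w : u.1 <= 0 -> 0 < dot u z -> 0 < dot u w -> hop z w = false.
Proof.
move=> u0 uz uw; apply/negbTE; rewrite /hop negb_and -leNgt.
case: ifPn => hw; case: (boolP (upper z)) => //= hz.
  exact: cross_left uz uw hz hw.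
exact: cross_left uw uz hw hz.
Qed.

(** Within a half-plane [hop] is either the coboundary of [upper] or zero, so it sums to zero around
    a quadrilateral. *)
Lemma hop_cycle u z1 z2 z3 z4 : 0 < dot u z1 -> 0 < dot u z2 -> 0 < dot u z3 -> 0 < dot u z4 ->
  hop z1 z2 (+) hop z2 z3 = hop z1 z4 (+) hop z4 z3.
Proof.
move=> u1 u2 u3 u4; have [u0|/ltW u0] := leP 0 u.1.
  by rewrite !(hop_right u0) //; do 4!case: (upper _).
by rewrite !(hop_left u0).
Qed.

Lemma dot_neq0 u z : 0 < dot u z -> z != 0.
Proof. by apply: contraTneq => ->; rewrite /dot !mulr0 addr0 ltxx. Qed.

(** The left side counts crossings of the negative axis, and crossings of the whole axis are changes
    of [upper]. *)
Lemma hop_opp u z w : 0 < dot u z -> 0 < dot u w ->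
  hop (- z) (- w) = hop z w (+) (upper z (+) upper w).
Proof.
move=> uz uw; have z0 := dot_neq0 uz; have w0 := dot_neq0 uw.
have uz' : 0 < dot (- u) (- z) by rewrite /dot /= !mulrNN.
have uw' : 0 < dot (- u) (- w) by rewrite /dot /= !mulrNN.
have [u0|/ltW u0] := leP 0 u.1.
  by rewrite (hop_right u0 uz uw) (hop_left _ uz' uw') ?oppr_le0 ?addbb.
by rewrite (hop_left u0 uz uw) (hop_right _ uz' uw') ?oppr_ge0 // !upper_opp // addbN addNb negbK.
Qed.

End Hop.

(** * Cancellation of [hop] over a grid *)

Section Grid.
Variables (R : realFieldType) (phi : nat -> nat -> R * R).

Lemma hop_strip N : (forall i, (i < N)%N -> exists u : R * R,
    [/\ 0 < dot u (phi i 0), 0 < dot u (phi i.+1 0), 0 < dot u (phi i 1) & 0 < dot u (phi i.+1 1)]) ->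
  \big[addb/false]_(i < N) hop (phi i 0) (phi i.+1 0) (+)
  \big[addb/false]_(i < N) hop (phi i 1) (phi i.+1 1) =
  hop (phi 0 0) (phi 0 1) (+) hop (phi N 0) (phi N 1).
Proof.
elim: N => [|N IH] cell; first by rewrite !big_ord0 !addbb.
have [|u [u00 u10 u01 u11]] := cell N; first by [].
rewrite !big_ord_recr /= addbACA IH; last by move=> i iN; apply: cell; exact: ltnW.
have := hop_cycle u00 u10 u11 u01.
by case: (hop (phi 0 0) _); case: (hop (phi N 0) (phi N 1)); case: (hop (phi N 0) _);
  case: (hop (phi N.+1 0) _); case: (hop (phi N 1) _).
Qed.
End Grid.

(** A discrete Stokes theorem: each cell contributes zero by [hop_cycle], and inner sides cancel. *)
Lemma hop_grid (R : realFieldType) (phi : nat -> nat -> R * R) N M :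
  (forall i j, (i < N)%N -> (j < M)%N -> exists u : R * R,
    [/\ 0 < dot u (phi i j), 0 < dot u (phi i.+1 j), 0 < dot u (phi i j.+1) &
        0 < dot u (phi i.+1 j.+1)]) ->
  \big[addb/false]_(i < N) hop (phi i 0%N) (phi i.+1 0%N) (+)
  \big[addb/false]_(i < N) hop (phi i M) (phi i.+1 M) =
  \big[addb/false]_(j < M) hop (phi 0%N j) (phi 0%N j.+1) (+)
  \big[addb/false]_(j < M) hop (phi N j) (phi N j.+1).
Proof.
elim: M => [|M IH] cell; first by rewrite !big_ord0 addbb.
rewrite !big_ord_recr /= addbACA -IH; last by move=> i j iN jM; apply: cell => //; exact: ltnW.
have := @hop_strip R (fun i j => phi i (j + M)%N) N; rewrite add0n add1n => <-.
  by rewrite -addbA addKb.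
by move=> i iN; exact: cell.
Qed.

(** * A parity proof that K_{3,3} is not planar, for continuous curves *)

Section Planarity.
Local Open Scope classical_set_scope.
Variable R : realType.
Implicit Types (e f : R -> R * R) (p q : R * R).

Definition knot (N i : nat) : R := i%:R / N%:R.
(* Parity of the crossings of the curve e with the horizontal ray to the right of
   p, for e subdivided into N steps. *)
Definition wind e p N : bool :=
  \big[addb/false]_(i < N) hop (e (knot N i) - p) (e (knot N i.+1) - p).

(** At [s' = s] and [t' = t] the product is the squared length of a nonzero vector; compactness of
    the unit square makes the continuity uniform. A grid of mesh below [eta] then has each cell in
    one half-plane. *)
Lemma near_dot e f : continuous e -> continuous f ->
  (forall s t : R, s \in `[0, 1]%R -> t \in `[0, 1]%R -> e s != f t) ->
  exists2 eta : R, 0 < eta & forall s t s' t' : R, s \in `[0, 1]%R -> t \in `[0, 1]%R ->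
    `|s - s'| < eta -> `|t - t'| < eta -> 0 < dot (e s - f t) (e s' - f t').
Proof.
move=> ce cf dis.
pose F (p : (R * R) * (R * R)) := dot (e p.1.1 - f p.1.2) (e p.2.1 - f p.2.2).
have cF : continuous F.
  move=> p; rewrite /F /dot.
  have c1 (g : R -> R * R) (k : (R * R) * (R * R) -> R) : continuous g -> continuous k ->
      continuous (fun x => (g (k x)).1).
    move=> cg ck x; apply: (@continuous_comp _ _ _ (fun x => g (k x)) fst).
      by apply: continuous_comp; [exact: ck|exact: cg].
    exact: cvg_fst.
  have c2 (g : R -> R * R) (k : (R * R) * (R * R) -> R) : continuous g -> continuous k ->
      continuous (fun x => (g (k x)).2).
    move=> cg ck x; apply: (@continuous_comp _ _ _ (fun x => g (k x)) snd).
      by apply: continuous_comp; [exact: ck|exact: cg].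
    exact: cvg_snd.
  have k11 : continuous (fun x : (R * R) * (R * R) => x.1.1).
    by move=> x; apply: (@continuous_comp _ _ _ fst fst); exact: cvg_fst.
  have k12 : continuous (fun x : (R * R) * (R * R) => x.1.2).
    by move=> x; apply: (@continuous_comp _ _ _ fst snd); [exact: cvg_fst|exact: cvg_snd].
  have k21 : continuous (fun x : (R * R) * (R * R) => x.2.1).
    by move=> x; apply: (@continuous_comp _ _ _ snd fst); [exact: cvg_snd|exact: cvg_fst].
  have k22 : continuous (fun x : (R * R) * (R * R) => x.2.2).
    by move=> x; apply: (@continuous_comp _ _ _ snd snd); exact: cvg_snd.
  apply: cvgD; apply: cvgM; apply: cvgB; by [apply: c1|apply: c2].
have cK := compact_setX (@segment_compact R 0 1) (@segment_compact R 0 1).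
have H : forall x : R * R, (`[0, 1] `*` `[0, 1]) x -> \forall x' \near x & eta \near (0 : R)^'+,
    forall y : R * R, `|x'.1 - y.1| < eta -> `|x'.2 - y.2| < eta -> 0 < F (x', y).
  move=> [s t] /= [sI tI]; have F0 : 0 < F ((s, t), (s, t)).
    have := dis _ _ sI tI; rewrite /F /dot /=; case: (e s) (f t) => [a b] [c d] /=.
    rewrite xpair_eqE negb_and -(subr_eq0 a) -(subr_eq0 b).
    move: (a - c) (b - d) => x y; rewrite -(sqrf_eq0 x) -(sqrf_eq0 y) -!expr2 => h0.
    by rewrite lt_neqAle addr_ge0 ?sqr_ge0 // andbT eq_sym paddr_eq0 ?sqr_ge0 // negb_and.
  have /nbhs_ballP[d /= d0 dF] : \forall z \near ((s, t), (s, t)), 0 < F z.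
    exact: (cvgr_gt _ (cF ((s, t), (s, t))) _ F0).
  have d20 : 0 < d / 2 by rewrite divr_gt0.
  (* Half of the radius is for moving the base point, the other half for the step away from it. *)
  exists (ball (s, t) (d / 2), [set eta | eta < d / 2]) => /=.
    by split; [exact: nbhsx_ballx|exact: nbhs_right_lt].
  move=> [[s' t'] eta] /= [[/= bs bt] etad] [s2 t2] /= sl tl.
  have tri (a b c : R) : ball a (d / 2) b -> `|b - c| < eta -> ball a d c.
    rewrite /ball /= => ab bc; rewrite -(subrKA b); apply: le_lt_trans (ler_normD _ _) _.
    by rewrite [d]splitr ltrD // (lt_trans bc).
  have wd (a b : R) : ball a (d / 2) b -> ball a d b.
    by apply: le_ball; lra.
  by apply: dF; split; split; [exact: wd|exact: wd|exact: tri bs sl|exact: tri bt tl].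
have near1 : \forall eta \near (0 : R)^'+, `[0, 1] `*` `[0, 1] `<=`
    fun x => forall y : R * R, `|x.1 - y.1| < eta -> `|x.2 - y.2| < eta -> 0 < F (x, y).
  exact: (iffLR (compact_near_coveringP _) cK _ _ _ _ H).
have [eta [eta0 etaP]] : exists eta : R, 0 < eta /\ (`[0, 1] `*` `[0, 1] `<=`
    fun x => forall y : R * R, `|x.1 - y.1| < eta -> `|x.2 - y.2| < eta -> 0 < F (x, y)).
  by have [eta [h1 h2]] := filter_ex (filterI near1 (nbhs_right_gt (0 : R))); exists eta.
exists eta => // s t s' t' sI tI ss tt.
exact: (etaP (s, t) (conj sI tI) (s', t') ss tt).
Qed.

Lemma knot_itv N i : (0 < N)%N -> (i <= N)%N -> knot N i \in `[0, 1]%R.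
Proof.
move=> N0 iN; rewrite in_itv /= divr_ge0 ?ler0n //=.
by rewrite ler_pdivrMr ?ltr0n // mul1r ler_nat.
Qed.

Lemma knot0 N : knot N 0 = 0. Proof. by rewrite /knot mul0r. Qed.
Lemma knotN N : (0 < N)%N -> knot N N = 1.
Proof. by move=> N0; rewrite /knot divff // pnatr_eq0 -lt0n. Qed.

Lemma knot_step N i : knot N i.+1 - knot N i = N%:R^-1.
Proof. by rewrite /knot -mulrBl -addn1 natrD addrC addKr mul1r. Qed.

Lemma big_addb_telescope (g : nat -> bool) N :
  \big[addb/false]_(j < N) (g j (+) g j.+1) = g 0%N (+) g N.
Proof.
elim: N => [|N IH]; first by rewrite big_ord0 addbb.
by rewrite big_ord_recr /= IH -addbA addKb.
Qed.

Lemma wind_swap e f p N : (forall j, (j < N)%N -> exists u : R * R,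
    0 < dot u (p - f (knot N j)) /\ 0 < dot u (p - f (knot N j.+1))) ->
  \big[addb/false]_(j < N) hop (p - f (knot N j)) (p - f (knot N j.+1)) =
  wind f p N (+) (upper (p - f (knot N 0)) (+) upper (p - f (knot N N))).
Proof.
move=> cell; rewrite -(@big_addb_telescope (fun j => upper (p - f (knot N j)))) /wind -big_split /=.
apply: eq_bigr => -[j jN] _ /=; have [u [u1 u2]] := cell _ jN.
rewrite -(opprB p) -(opprB p (f (knot N j.+1))) (hop_opp u1 u2).
by case: hop; case: upper; case: upper.
Qed.

(** [hop_grid] for the values [e s - f t]. Two sides of the square are winds of [e]; on the other
    two [f] enters with a minus sign, and reversing it by [hop_opp] leaves the telescoped [upper]
    terms at the corners. *)
Lemma wind_parity e f : continuous e -> continuous f ->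
  (forall s t : R, s \in `[0, 1]%R -> t \in `[0, 1]%R -> e s != f t) ->
  \forall N \near \oo,
  wind e (f 0) N (+) wind e (f 1) N (+) wind f (e 0) N (+) wind f (e 1) N =
  upper (e 0 - f 0) (+) upper (e 0 - f 1) (+) upper (e 1 - f 0) (+) upper (e 1 - f 1).
Proof.
move=> ce cf dis; have [eta eta0 H] := near_dot ce cf dis.
have near1 : \forall N \near \oo, (0 < N)%N /\ N%:R^-1 < eta.
  near=> N.
    have N0 : (0 < N)%N by near: N; exact: nbhs_infty_gt.
    split=> //; rewrite invf_plt ?posrE ?ltr0n //.
    by near: N; exact: nbhs_infty_gtr.
apply: filterS near1 => N [N0 Neta].
have cell i j : (i < N)%N -> (j < N)%N -> exists u : R * R,
    [/\ 0 < dot u (e (knot N i) - f (knot N j)), 0 < dot u (e (knot N i.+1) - f (knot N j)),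
        0 < dot u (e (knot N i) - f (knot N j.+1)) &
        0 < dot u (e (knot N i.+1) - f (knot N j.+1))].
  move=> iN jN; exists (e (knot N i) - f (knot N j)).
  have iI := knot_itv N0 (ltnW iN); have jI := knot_itv N0 (ltnW jN).
  have st k : `|knot N k - knot N k.+1| < eta.
    by rewrite distrC knot_step ger0_norm ?invr_ge0.
  have st0 k : `|knot N k - knot N k| < eta by rewrite subrr normr0.
  by split; apply: H.
have := hop_grid cell.
have -> : \big[addb/false]_(j < N) hop (e (knot N 0) - f (knot N j)) (e (knot N 0) - f (knot N j.+1)) =
    wind f (e 0) N (+) (upper (e 0 - f 0) (+) upper (e 0 - f 1)).
  rewrite knot0 wind_swap ?knot0 ?knotN // => j jN; have [u [u1 _ u2 _]] := cell _ _ N0 jN.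
  by rewrite knot0 in u1 u2; exists u.
have -> : \big[addb/false]_(j < N) hop (e (knot N N) - f (knot N j)) (e (knot N N) - f (knot N j.+1)) =
    wind f (e 1) N (+) (upper (e 1 - f 0) (+) upper (e 1 - f 1)).
  rewrite knotN // wind_swap ?knot0 ?knotN // => j jN.
  have N1 : (N.-1 < N)%N by rewrite prednK.
  have [u [_ u1 _ u2]] := cell _ _ N1 jN; rewrite prednK // in u1 u2.
  by rewrite knotN // in u1 u2; exists u.
rewrite /wind knot0 knotN //.
do 2!move: (bigop _ _ _); clear; do 2!move: (bigop _ _ _).
by move: (upper _) (upper _) (upper _) (upper _); do 8!case.
Unshelve. all: by end_near. Qed.

(** Passing from parities to natural numbers lets linear arithmetic add up the eighteen
    relations. *)
Lemma addb_natP (a b c d x y z t : bool) : a (+) b (+) c (+) d = x (+) y (+) z (+) t ->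
  exists n : nat, (a + b + c + d + x + y + z + t = n.*2)%N.
Proof.
move=> E; exists (a + b + c + d + x + y + z + t)%N./2; apply/esym/even_halfK.
by rewrite !oddD !oddb E; case: x y z t {E} => [] [] [] [].
Qed.

(* For disjoint edges e and f, e(s) - f(t) does not vanish on the unit square, so
   its parity along the boundary is even.  In the sum of these relations over all
   pairs of disjoint edges of K_{3,3} every wind term occurs twice, as the vertex
   p disjoint from e lies on two edges disjoint from e; the remaining terms have
   an odd sum. *)
Lemma K33_crossing (a b : nat -> R * R) (g : nat -> nat -> R -> R * R) :
  (forall i j, (i < 3)%N -> (j < 3)%N -> [/\ continuous (g i j), g i j 0 = a i & g i j 1 = b j]) ->
  exists i j k l, [/\ (i < k < 3)%N, (j < 3)%N, (l < 3)%N, j != l &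
    exists s t : R, [/\ s \in `[0, 1]%R, t \in `[0, 1]%R & g i j s = g k l t]].
Proof.
move=> gP; apply: contrapT => no.
have dis i j k l : (i < k < 3)%N -> (j < 3)%N -> (l < 3)%N -> j != l ->
    forall s t : R, s \in `[0, 1]%R -> t \in `[0, 1]%R -> g i j s != g k l t.
  move=> ik j3 l3 jl s t sI tI; apply/eqP => E; apply: no.
  by exists i, j, k, l; split=> //; exists s, t.
have I0 : (0 : R) \in `[0, 1]%R by rewrite in_itv /= lexx ler01.
have I1 : (1 : R) \in `[0, 1]%R by rewrite in_itv /= lexx ler01.
have par : \forall N \near \oo, forall x : ('I_3 * 'I_3) * ('I_3 * 'I_3),
    let: ((i, j), (k, l)) := x in (i < k)%N -> j != l ->
    wind (g i j) (a k) N (+) wind (g i j) (b l) N (+) wind (g k l) (a i) N (+) wind (g k l) (b j) N =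
    upper (a i - a k) (+) upper (a i - b l) (+) upper (b j - a k) (+) upper (b j - b l).
  apply: filter_forall => -[[[i i3] [j j3]] [[k k3] [l l3]]] /=.
  have [/andP[ik jl]|nn] := boolP ((i < k)%N && (j != l)); last first.
    by near=> N => ik jl; rewrite ik /= in nn; case/negP: nn.
  have [c1 e0 e1] := gP _ _ i3 j3; have [c2 f0 f1] := gP _ _ k3 l3.
  have ik3 : (i < k < 3)%N by rewrite ik.
  have := wind_parity c1 c2 (dis _ _ _ _ ik3 j3 l3 jl).
  by rewrite e0 e1 f0 f1; apply: filterS => N ->.
have [N {}par] := filter_ex par.
pose A i j k := wind (g i j) (a k) N; pose B i j l := wind (g i j) (b l) N.
pose x i k := upper (a i - a k); pose y i l := upper (a i - b l); pose z j l := upper (b j - b l).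
have E i j k l : (i < 3)%N -> (j < 3)%N -> (k < 3)%N -> (l < 3)%N -> (i < k)%N -> j != l ->
    exists n : nat, (A i j k + B i j l + A k l i + B k l j + x i k + y i l + ~~ y k j + z j l = n.*2)%N.
  move=> i3 j3 k3 l3 ik jl; apply: addb_natP.
  have := par ((Ordinal i3, Ordinal j3), (Ordinal k3, Ordinal l3)) ik jl.
  rewrite /= -[b j - a k]opprB upper_opp // subr_eq0.
  (* The edge from [a k] to [b m] is disjoint from that from [a i] to [b j], which shows that [b j]
     and [a k] differ and their difference can be reversed. *)
  have [m [mj [m3 mk]]] : exists m, m != j /\ (m < 3)%N /\ m != l.
    case: j l j3 l3 jl {par} => [|[|[|//]]] [|[|[|//]]] // _ _ _;
    by [exists 0%N|exists 1%N|exists 2%N].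
  have [_ ek _] := gP _ _ k3 m3; have [_ _ ej] := gP _ _ i3 j3.
  have ik3 : (i < k < 3)%N by rewrite ik.
  by have := dis i j k m ik3 j3 m3; rewrite eq_sym => /(_ mj 1 0 I1 I0); rewrite ek ej eq_sym.
have zE j l : (j < 3)%N -> (l < 3)%N -> j != l -> (z j l + z l j = 1)%N.
  move=> j3 l3 jl; rewrite /z -[b l - b j]opprB upper_opp; first by case: upper.
  have [_ _ ej] := gP 0%N j erefl j3; have [_ _ el] := gP 1%N l erefl l3.
  by rewrite subr_eq0 -ej -el; exact: (dis 0%N j 1%N l).
have [n1 F1] := E 0%N 0%N 1%N 1%N erefl erefl erefl erefl erefl erefl.
have [n2 F2] := E 0%N 0%N 1%N 2%N erefl erefl erefl erefl erefl erefl.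
have [n3 F3] := E 0%N 1%N 1%N 0%N erefl erefl erefl erefl erefl erefl.
have [n4 F4] := E 0%N 1%N 1%N 2%N erefl erefl erefl erefl erefl erefl.
have [n5 F5] := E 0%N 2%N 1%N 0%N erefl erefl erefl erefl erefl erefl.
have [n6 F6] := E 0%N 2%N 1%N 1%N erefl erefl erefl erefl erefl erefl.
have [n7 F7] := E 0%N 0%N 2%N 1%N erefl erefl erefl erefl erefl erefl.
have [n8 F8] := E 0%N 0%N 2%N 2%N erefl erefl erefl erefl erefl erefl.
have [n9 F9] := E 0%N 1%N 2%N 0%N erefl erefl erefl erefl erefl erefl.
have [n10 F10] := E 0%N 1%N 2%N 2%N erefl erefl erefl erefl erefl erefl.
have [n11 F11] := E 0%N 2%N 2%N 0%N erefl erefl erefl erefl erefl erefl.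
have [n12 F12] := E 0%N 2%N 2%N 1%N erefl erefl erefl erefl erefl erefl.
have [n13 F13] := E 1%N 0%N 2%N 1%N erefl erefl erefl erefl erefl erefl.
have [n14 F14] := E 1%N 0%N 2%N 2%N erefl erefl erefl erefl erefl erefl.
have [n15 F15] := E 1%N 1%N 2%N 0%N erefl erefl erefl erefl erefl erefl.
have [n16 F16] := E 1%N 1%N 2%N 2%N erefl erefl erefl erefl erefl erefl.
have [n17 F17] := E 1%N 2%N 2%N 0%N erefl erefl erefl erefl erefl erefl.
have [n18 F18] := E 1%N 2%N 2%N 1%N erefl erefl erefl erefl erefl erefl.
have Z1 := zE 0%N 1%N erefl erefl erefl; have Z2 := zE 0%N 2%N erefl erefl erefl.
have Z3 := zE 1%N 2%N erefl erefl erefl.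
(* Every [x] occurs six times, every [y] or its negation an even number of times. Each pair of
   indices [j], [l] contributes [3 * (z j l + z l j) = 3], and there are three such pairs, so the
   remaining total is odd. *)
have S := congr2 addn F1 (congr2 addn F2 (congr2 addn F3 (congr2 addn F4 (congr2 addn F5 (congr2 addn F6 (congr2 addn F7 (congr2 addn F8 (congr2 addn F9 (congr2 addn F10 (congr2 addn F11 (congr2 addn F12 (congr2 addn F13 (congr2 addn F14 (congr2 addn F15 (congr2 addn F16 (congr2 addn F17 (F18))))))))))))))))).
move: S Z1 Z2 Z3; clear.
do ?[match goal with |- context [nat_of_bool ?b] => move: (nat_of_bool b) => ? end].
by lia.
Unshelve. all: by end_near. Qed.

End Planarity.

(** * Simple arcs: subarcs, trimming, concatenation and connectedness *)

Section Arcs.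
Local Open Scope classical_set_scope.
Variable R : realType.
Implicit Types (p q c d : R * R) (X Y : set (R * R)) (g : R -> R * R).

(** Parametrizations are continuous on the whole line, so that they compose without subspace
    topologies; [clamp] extends those of a drawing. *)
Definition is_arc p q X := exists g : R -> R * R,
  [/\ continuous g, {in `[0, 1]%R &, injective g}, g 0 = p, g 1 = q & g @` `[0, 1] = X].

(** The retraction of the line onto the unit interval, in a closed form whose continuity is
    immediate. *)
Definition clamp (t : R) : R := (`|t| - `|t - 1| + 1) / 2.

Lemma clamp_id t : t \in `[0, 1]%R -> clamp t = t.
Proof.
by rewrite in_itv /= /clamp => /andP[t0 t1]; rewrite ger0_norm // ler0_norm ?subr_le0 //; lra.
Qed.

Lemma clamp_le t : t <= 0 -> clamp t = 0.
Proof. by move=> t0; rewrite /clamp !ler0_norm //; lra. Qed.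

Lemma clamp_ge t : 1 <= t -> clamp t = 1.
Proof. by move=> t1; rewrite /clamp !ger0_norm //; lra. Qed.

Lemma clamp_itv t : clamp t \in `[0, 1]%R.
Proof.
have [t0|t0] := leP t 0; first by rewrite clamp_le // in_itv /= lexx ler01.
have [t1|t1] := leP 1 t; first by rewrite clamp_ge // in_itv /= lexx ler01.
by rewrite clamp_id in_itv /= ?ltW.
Qed.

Lemma clamp_continuous : continuous clamp.
Proof.
move=> t; apply: cvgM; last exact: cvg_cst.
apply: cvgD; last exact: cvg_cst.
apply: cvgB; first by apply: cvg_norm; exact: cvg_id.
by apply: cvg_norm; apply: cvgB; [exact: cvg_id|exact: cvg_cst].
Qed.

Lemma within_clamp g : {within `[0, 1], continuous g} -> continuous (g \o clamp).
Proof.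
move=> /subspace_continuousP cg t.
have tI : `[0, 1]%classic (clamp t) by exact: clamp_itv.
have h : clamp u @[u --> t] --> within `[0, 1] (nbhs (clamp t)).
  move=> U; rewrite /within /= => H; have := @clamp_continuous t _ H.
  exact: (@filterS _ (nbhs t) _ _ _ (fun u Hu => Hu (clamp_itv u))).
exact: cvg_comp h (cg _ tI).
Qed.

Lemma affine_continuous (a b : R) : continuous (fun t : R => a + t * b).
Proof.
by move=> t; apply: cvgD; [exact: cvg_cst|apply: cvgM; [exact: cvg_id|exact: cvg_cst]].
Qed.

Lemma arc_points p q X : is_arc p q X -> [/\ X p, X q & p <> q].
Proof.
move=> [g [_ gi <- <- <-]]; split.
- by exists 0 => //=; rewrite in_itv /= lexx ler01.
- by exists 1 => //=; rewrite in_itv /= lexx ler01.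
- move=> /gi; rewrite !in_itv /= !lexx ler01 => /(_ isT isT) /eqP.
  by rewrite eq_sym oner_eq0.
Qed.

Lemma arc_closed p q X : is_arc p q X -> closed X.
Proof.
move=> [g [cg _ _ _ <-]]; apply: compact_closed; first exact: norm_hausdorff.
apply: continuous_compact; last exact: segment_compact.
exact: continuous_subspaceT.
Qed.

Lemma arc_sub_times g (s t : R) : continuous g -> {in `[0, 1]%R &, injective g} ->
  s \in `[0, 1]%R -> t \in `[0, 1]%R -> s != t ->
  is_arc (g s) (g t) ((fun u => g (s + u * (t - s))) @` `[0, 1]).
Proof.
move=> cg gi sI tI st; exists (fun u => g (s + u * (t - s))).
have inI u : u \in `[0, 1]%R -> s + u * (t - s) \in `[0, 1]%R.
  by move: sI tI; rewrite !in_itv /= => /andP[? ?] /andP[? ?] /andP[? ?]; apply/andP; split; nra.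
split=> //.
- by move=> u; apply: continuous_comp; [exact: affine_continuous|exact: cg].
- move=> u v uI vI /gi; rewrite !inI // => /(_ isT isT) /addrI /mulIf; apply.
  by rewrite subr_eq0 eq_sym.
- by rewrite mul0r addr0.
- by rewrite mul1r addrC subrK.
Qed.

Lemma arc_sub p q X c d : is_arc p q X -> X c -> X d -> c <> d ->
  exists2 Y, is_arc c d Y & Y `<=` X.
Proof.
move=> [g [cg gi _ _ <-]] [s /= sI <-] [t /= tI <-] st.
exists ((fun u => g (s + u * (t - s))) @` `[0, 1]).
  by apply: arc_sub_times => //; apply: contra_notN st => /eqP->.
move=> _ [u /= uI <-]; exists (s + u * (t - s)) => //=.
move: sI tI uI; rewrite !in_itv /= => /andP[? ?] /andP[? ?] /andP[? ?]; apply/andP; split; nra.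
Qed.

Lemma arc_rev p q X : is_arc p q X -> is_arc q p X.
Proof.
move=> [g [cg gi <- <- <-]].
have I0 : (0 : R) \in `[0, 1]%R by rewrite in_itv /= lexx ler01.
have I1 : (1 : R) \in `[0, 1]%R by rewrite in_itv /= lexx ler01.
have := arc_sub_times cg gi I1 I0 (oner_neq0 _); congr is_arc.
apply/seteqP; split=> _ [u /= uI <-]; exists (1 - u) => /=.
- by move: uI; rewrite !in_itv /= => /andP[? ?]; apply/andP; split; lra.
- by congr g; ring.
- by move: uI; rewrite !in_itv /= => /andP[? ?]; apply/andP; split; lra.
- by congr g; ring.
Qed.

Lemma closed_time_min g (K : set (R * R)) (a : R) : continuous g -> closed K ->
  a \in `[0, 1]%R -> K (g a) -> exists t, [/\ t \in `[0, a]%R, K (g t) &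
    forall s, s \in `[0, t]%R -> K (g s) -> s = t].
Proof.
move=> cg cK aI Ka.
pose A := `[0, a] `&` (g @^-1` K).
have cA : compact A.
  apply: compact_closedI; first exact: segment_compact.
  exact: closed_comp.
have A0 : A !=set0 by exists a; split=> //=; move: aI; rewrite !in_itv /= lexx => /andP[->].
have cid : continuous (@id R) by move=> x; exact: cvg_id.
have [t] := compact_EVT_min A0 cA (continuous_subspaceT cid).
rewrite inE => -[/= tI Kt] tmin; exists t; split=> // s sI Ks.
have := tmin s; rewrite inE => /(_ _) ts; apply/le_anti; move: (sI); rewrite in_itv /= => /andP[s0 st].
rewrite st ts //; split=> //=; move: tI; rewrite !in_itv /= s0 => /andP[_ ta].
exact: le_trans ta.
Qed.

(** The arc is stopped at its first visit to [K2] and started at the last visit to [K1] before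
    that. *)
Lemma arc_trim p q X (K1 K2 : set (R * R)) : is_arc p q X -> closed K1 -> closed K2 ->
  K1 p -> K2 q -> (forall x, K1 x -> K2 x -> False) ->
  exists a b Y, [/\ is_arc a b Y, Y `<=` X, Y `&` K1 = [set a] & Y `&` K2 = [set b]].
Proof.
move=> [g [cg gi <- <- <-]] c1 c2 k1 k2 dis.
have I0 : (0 : R) \in `[0, 1]%R by rewrite in_itv /= lexx ler01.
have I1 : (1 : R) \in `[0, 1]%R by rewrite in_itv /= lexx ler01.
have [t [tI Kt tmin]] := closed_time_min cg c2 I1 k2.
(* Reversing time turns the last visit to [K1] before [t] into a first visit. *)
pose g' u := g (t * (1 - u)).
have cg' : continuous g'.
  move=> u; apply: continuous_comp; last exact: cg.
  apply: cvgM; first exact: cvg_cst.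
  by apply: cvgB; [exact: cvg_cst|exact: cvg_id].
have [s' [s'I Ks' smin]] : exists s, [/\ s \in `[0, 1]%R, K1 (g' s) &
    forall u, u \in `[0, s]%R -> K1 (g' u) -> u = s].
  by apply: (closed_time_min cg' c1 I1); rewrite /g' subrr mulr0.
pose s := t * (1 - s').
have Ks : K1 (g s) by [].
have sI : s \in `[0, 1]%R.
  by move: s'I tI; rewrite /s !in_itv /= => /andP[? ?] /andP[? ?]; apply/andP; split; nra.
have st : s <= t by move: s'I tI; rewrite /s !in_itv /= => /andP[? ?] /andP[? ?]; nra.
have nst : s != t by apply/eqP => E; apply: (dis (g t)) => //; rewrite -E.
have tIs u : u \in `[0, 1]%R -> s + u * (t - s) \in `[0, t]%R.
  move: sI; rewrite !in_itv /= => /andP[? ?] /andP[? ?]; apply/andP; split; nra.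
have h := arc_sub_times cg gi sI tI nst.
have [hs ht _] := arc_points h.
exists (g s), (g t), ((fun u => g (s + u * (t - s))) @` `[0, 1]); split=> //.
- move=> _ [u /= uI <-]; exists (s + u * (t - s)) => //=.
  move: (tIs _ uI) tI; rewrite !in_itv /= => /andP[-> h1] /andP[_ h2].
  exact: le_trans h2.
- apply/seteqP; split=> [_ [[u /= uI <-] Ku]|_ ->//].
  have t0 : 0 < t.
    have {nst}slt : s < t by rewrite lt_neqAle nst.
    by move: sI; rewrite in_itv /= => /andP[s0 _]; exact: le_lt_trans slt.
  pose v := 1 - (s + u * (t - s)) / t.
  have gv : g' v = g (s + u * (t - s)).
    by rewrite /g' /v opprB addrCA subrr addr0 mulrCA divff ?mulr1 // gt_eqF.
  rewrite -gv in Ku *; rewrite (smin v) //.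
  have := tIs _ uI; rewrite !in_itv /= => /andP[_ h1]; apply/andP; split.
    by rewrite subr_ge0 ler_pdivrMr // mul1r.
  rewrite lerBlDr -lerBlDl ler_pdivlMr // mulrC -/s.
  have : 0 <= u * (t - s) by rewrite mulr_ge0 ?subr_ge0 //; move: uI; rewrite in_itv /= => /andP[].
  by move=> h2; rewrite lerDl.
- apply/seteqP; split=> [_ [[u /= uI <-] Ku]|_ ->//].
  by rewrite (tmin _ (tIs _ uI) Ku).
Qed.

Lemma arc_concat p m q X Y : is_arc p m X -> is_arc m q Y -> X `&` Y = [set m] ->
  is_arc p q (X `|` Y).
Proof.
move=> [a [ca ai ap am aX]] [b [cb bi bm bq bY]] XY.
(* On each half of the interval one of the two summands is constantly [m], so the sum is the
   concatenation and is continuous without a gluing argument. *)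
pose g (t : R) := a (clamp (t * 2)) + b (clamp (t * 2 - 1)) - m.
have I0 : (0 : R) \in `[0, 1]%R by rewrite in_itv /= lexx ler01.
have I1 : (1 : R) \in `[0, 1]%R by rewrite in_itv /= lexx ler01.
have gl t : t <= 1 / 2 -> g t = a (clamp (t * 2)).
  by move=> t1; rewrite /g (clamp_le (t := t * 2 - 1)) ?bm ?addrK //; lra.
have gr t : 1 / 2 <= t -> g t = b (clamp (t * 2 - 1)).
  by move=> t1; rewrite /g (clamp_ge (t := t * 2)) ?am 1?addrAC ?subrr ?add0r //; lra.
have cg : continuous g.
  move=> t; apply: cvgB; last exact: cvg_cst.
  apply: cvgD.
    apply: continuous_comp; last exact: ca.
    apply: continuous_comp; last exact: clamp_continuous.
    by apply: cvgM; [exact: cvg_id|exact: cvg_cst].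
  apply: continuous_comp; last exact: cb.
  apply: continuous_comp; last exact: clamp_continuous.
  by apply: cvgB; [apply: cvgM; [exact: cvg_id|exact: cvg_cst]|exact: cvg_cst].
have inX t : t \in `[0, 1]%R -> X (a t) by move=> tI; rewrite -aX; exists t.
have inY t : t \in `[0, 1]%R -> Y (b t) by move=> tI; rewrite -bY; exists t.
have cut s t : s \in `[0, 1]%R -> t \in `[0, 1]%R -> a s = b t -> s = 1 /\ t = 0.
  move=> sI tI E; have Em : a s = m.
    by have : (X `&` Y) (a s); [split; [exact: inX|rewrite E; exact: inY]|rewrite XY].
  by split; [apply: ai => //; rewrite Em|apply: bi => //; rewrite -E Em].
exists g; split=> //.
- move=> s t; rewrite !in_itv /= => /andP[s0 s1] /andP[t0 t1].
  have hl (u : R) : 0 <= u -> u <= 1 / 2 -> u * 2 \in `[0, 1]%R.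
    by move=> ? ?; rewrite in_itv /=; apply/andP; split; lra.
  have hr (u : R) : u <= 1 -> 1 / 2 <= u -> u * 2 - 1 \in `[0, 1]%R.
    by move=> ? ?; rewrite in_itv /=; apply/andP; split; lra.
  have [sh|/ltW sh] := leP s (1 / 2); have [th|/ltW th] := leP t (1 / 2).
  + rewrite !gl // !clamp_id ?hl // => /ai; rewrite !hl // => /(_ isT isT).
    lra.
  + rewrite gl // gr // !clamp_id ?hl ?hr // => /cut; rewrite hl // hr // => /(_ isT isT)[].
    lra.
  + rewrite gr // gl // !clamp_id ?hl ?hr // => /esym /cut; rewrite hl // hr // => /(_ isT isT)[].
    lra.
  + rewrite !gr // !clamp_id ?hr // => /bi; rewrite !hr // => /(_ isT isT).
    lra.
- by rewrite gl ?mul0r ?clamp_id // divr_ge0.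
- by rewrite gr; [rewrite (_ : 1 * 2 - 1 = 1) ?clamp_id //; lra|lra].
- apply/seteqP; split=> [_ [t /= tI <-]|x [|]].
  + have [th|/ltW th] := leP t (1 / 2).
      by rewrite gl //; left; apply: inX; exact: clamp_itv.
    by rewrite gr //; right; apply: inY; exact: clamp_itv.
  + rewrite -aX => -[t /= tI <-]; exists (t / 2) => /=.
      by move: tI; rewrite !in_itv /= => /andP[? ?]; apply/andP; split; lra.
    rewrite gl; first by rewrite mulfVK ?clamp_id.
    by move: tI; rewrite !in_itv /= => /andP[? ?]; lra.
  + rewrite -bY => -[t /= tI <-]; exists ((t + 1) / 2) => /=.
      by move: tI; rewrite !in_itv /= => /andP[? ?]; apply/andP; split; lra.
    rewrite gr; first by rewrite mulfVK ?addrK ?clamp_id.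
    by move: tI; rewrite !in_itv /= => /andP[? ?]; lra.
Qed.

Definition joined X p q := p = q \/ exists2 Y, is_arc p q Y & Y `<=` X.

Lemma joined_sym X p q : joined X p q -> joined X q p.
Proof. by move=> [->|[Y aY YX]]; [left|right; exists Y => //; exact: arc_rev]. Qed.

Lemma joined_sub X X' p q : X `<=` X' -> joined X p q -> joined X' p q.
Proof. by move=> XX [->|[Y aY YX]]; [left|right; exists Y => //; exact: subset_trans XX]. Qed.

(** The two arcs may meet before [m], so the first is followed only up to its first point on the
    second. *)
Lemma joined_trans X p m q : joined X p m -> joined X m q -> joined X p q.
Proof.
move=> [->//|[Y aY YX]] [<-|[Z aZ ZX]]; first by right; exists Y.
have [->|/eqP pq] := eqVneq p q; [by left|right].
have [Zp|Zp] := pselect (Z p).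
  have [_ Zq _] := arc_points aZ.
  have [Z' aZ' ZZ] := arc_sub aZ Zp Zq pq; exists Z' => //; exact: subset_trans ZX.
have [Zm Zq _] := arc_points aZ.
have [] := @arc_trim _ _ _ [set p] Z aY (compact_closed (@norm_hausdorff _ _) (@compact_set1 _ p)) (arc_closed aZ) erefl Zm.
  by move=> x ->.
move=> a [b [Y' [aY' Y'Y Ya Yb]]].
have Ea : a = p by have : (Y' `&` [set p]) a by [rewrite Ya]; case.
subst a; have Zb : Z b by have : (Y' `&` Z) b by [rewrite Yb]; case.
have Y'X : Y' `<=` X by exact: subset_trans YX.
have [bq|/eqP bq] := eqVneq b q; first by subst b; exists Y'.
have [Z' aZ' ZZ] := arc_sub aZ Zb Zq bq.
exists (Y' `|` Z'); last by rewrite subUset; split=> //; exact: subset_trans ZX.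
apply: (arc_concat aY' aZ'); apply/seteqP; split=> [x [Y'x Z'x]|_ ->].
  by rewrite -Yb; split=> //; exact: ZZ.
by have [_ ? _] := arc_points aY'; have [? _ _] := arc_points aZ'.
Qed.

End Arcs.

(** * Segments, circles and points in general position *)

Section Discs.
Local Open Scope classical_set_scope.
Variable R : realType.
Implicit Types (a b c d p q x y z : R * R) (s t : R).

(** Squared Euclidean distance keeps the computations polynomial. *)
Definition sqd p q : R := (p.1 - q.1) ^+ 2 + (p.2 - q.2) ^+ 2.
Definition lerp p q t : R * R := (p.1 + t * (q.1 - p.1), p.2 + t * (q.2 - p.2)).
Definition seg p q : set (R * R) := lerp p q @` `[0, 1].
(** Twice the signed area of the triangle [a], [b], [p]; for distinct [a] and [b] its zeros form the
    line through them. *)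
Definition side a b p : R := (b.1 - a.1) * (p.2 - a.2) - (b.2 - a.2) * (p.1 - a.1).
Definition disc c s : set (R * R) := [set p | sqd p c <= s].

Lemma sqd_ge0 p q : 0 <= sqd p q.
Proof. by rewrite addr_ge0 ?sqr_ge0. Qed.

Lemma sqd_eq0 p q : sqd p q = 0 -> p = q.
Proof.
case: p q => [p1 p2] [q1 q2]; rewrite /sqd /= => /eqP.
by rewrite paddr_eq0 ?sqr_ge0 // !sqrf_eq0 !subr_eq0 => /andP[/eqP-> /eqP->].
Qed.

Lemma sqd_gt0 p q : p != q -> 0 < sqd p q.
Proof.
move=> pq; rewrite lt_neqAle sqd_ge0 andbT eq_sym; apply: contraNneq pq.
by move/sqd_eq0->.
Qed.

(** Stewart's theorem. *)
Lemma sqd_lerp p q c t :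
  sqd (lerp p q t) c = (1 - t) * sqd p c + t * sqd q c - t * (1 - t) * sqd p q.
Proof. by rewrite /sqd /lerp /=; ring. Qed.

Lemma side_lerp a b c d t : side a b (lerp c d t) = (1 - t) * side a b c + t * side a b d.
Proof. by rewrite /side /lerp /=; ring. Qed.

Lemma side_cycle a b c : side a b c = side b c a.
Proof. by rewrite /side; ring. Qed.

Lemma side_ab a b : side a b a = 0 /\ side a b b = 0.
Proof. by split; rewrite /side; ring. Qed.

Lemma seg_side a b p : seg a b p -> side a b p = 0.
Proof. by move=> [t _ <-]; have [h1 h2] := side_ab a b; rewrite side_lerp h1 h2 !mulr0 addr0. Qed.

Lemma seg_ends p q : seg p q p /\ seg p q q.
Proof.
split; [exists 0|exists 1]; rewrite /= ?in_itv /= ?lexx ?ler01 // /lerp.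
  by rewrite !mul0r !addr0 -surjective_pairing.
by rewrite !mul1r ![_ + (_ - _)]addrC !subrK -surjective_pairing.
Qed.

Lemma seg_arc p q : p != q -> is_arc p q (seg p q).
Proof.
move=> pq; exists (lerp p q); split=> //.
- move=> t; exact: (cvg_pair (@affine_continuous R p.1 (q.1 - p.1) t)
    (@affine_continuous R p.2 (q.2 - p.2) t)).
- move=> t u _ _ [/addrI h1 /addrI h2].
  have [E|n] := eqVneq p.1 q.1; last by apply: mulIf h1; rewrite subr_eq0 eq_sym.
  apply: mulIf h2; rewrite subr_eq0 eq_sym; apply: contraNneq pq => E2.
  by rewrite [p]surjective_pairing E E2 -surjective_pairing.
- by rewrite /lerp !mul0r !addr0 -surjective_pairing.
- by rewrite /lerp !mul1r ![_ + (_ - _)]addrC !subrK -surjective_pairing.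
Qed.

Lemma seg_disc c s p q : disc c s p -> disc c s q -> seg p q `<=` disc c s.
Proof.
rewrite /disc /= => hp hq _ [t + <-]; rewrite /= in_itv /= => /andP[t0 t1].
rewrite sqd_lerp; have := sqd_ge0 p q; move: (sqd p q) => d d0.
have : 0 <= t * (1 - t) * d by rewrite !mulr_ge0 // subr_ge0.
nra.
Qed.

Lemma chord_circle c s a b p : sqd a c = s -> sqd b c = s -> a != b ->
  seg a b p -> sqd p c = s -> p = a \/ p = b.
Proof.
move=> ha hb ab [t _ <-]; rewrite sqd_lerp ha hb => E.
have : t * (1 - t) * sqd a b = 0 by lra.
move/eqP; rewrite mulf_eq0 (gt_eqF (sqd_gt0 ab)) orbF mulf_eq0 subr_eq0 => /orP[]/eqP E'.
  by left; rewrite E' /lerp !mul0r !addr0 -surjective_pairing.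
by right; rewrite -E' /lerp !mul1r ![_ + (_ - _)]addrC !subrK -surjective_pairing.
Qed.

Lemma radius_circle c s z a p : sqd z c < s -> sqd a c = s -> seg z a p -> sqd p c = s -> p = a.
Proof.
move=> hz ha [t + <-]; rewrite /= in_itv /= => /andP[t0 t1]; rewrite sqd_lerp ha => E.
have [t1'|t1'] := eqVneq t 1.
  by rewrite t1' /lerp !mul1r ![_ + (_ - _)]addrC !subrK -surjective_pairing.
have t1'' : t < 1 by rewrite lt_neqAle t1'.
have : 0 <= t * (1 - t) * sqd z a by rewrite !mulr_ge0 ?sqd_ge0 // subr_ge0.
have : (1 - t) * (s - sqd z c) > 0 by rewrite mulr_gt0 // subr_gt0.
move=> h1 h2; exfalso; move: E h1 h2; clear; move: (t * (1 - t) * _) => v; nra.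
Qed.

Lemma line_circle c s a b p : sqd a c = s -> sqd b c = s -> a != b ->
  side a b p = 0 -> sqd p c = s -> p = a \/ p = b.
Proof.
move=> ha hb ab sp hp.
(* The parameter of the orthogonal projection of [p] to the line through [a] and [b]. *)
pose t := ((p.1 - a.1) * (b.1 - a.1) + (p.2 - a.2) * (b.2 - a.2)) / sqd a b.
have d0 := gt_eqF (sqd_gt0 ab).
have tE : t * sqd a b = (p.1 - a.1) * (b.1 - a.1) + (p.2 - a.2) * (b.2 - a.2).
  by rewrite /t mulfVK ?d0.
have pE : p = lerp a b t.
  rewrite [LHS]surjective_pairing /lerp; congr pair; apply: (mulIf (negbT d0)).
    rewrite mulrDl mulrAC tE; move: sp; rewrite /side /sqd => sp.
    apply/eqP; rewrite -subr_eq0; apply/eqP.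
    transitivity (- (b.2 - a.2) * ((b.1 - a.1) * (p.2 - a.2) - (b.2 - a.2) * (p.1 - a.1))); first by ring.
    by rewrite sp mulr0.
  rewrite mulrDl mulrAC tE; move: sp; rewrite /side /sqd => sp.
  apply/eqP; rewrite -subr_eq0; apply/eqP.
  transitivity ((b.1 - a.1) * ((b.1 - a.1) * (p.2 - a.2) - (b.2 - a.2) * (p.1 - a.1))); first by ring.
  by rewrite sp mulr0.
have E : t * (1 - t) * sqd a b = 0 by move: hp; rewrite pE sqd_lerp ha hb; lra.
move/eqP: E; rewrite mulf_eq0 d0 orbF mulf_eq0 subr_eq0 pE => /orP[]/eqP E'.
  by left; rewrite E' /lerp !mul0r !addr0 -surjective_pairing.
by right; rewrite -E' /lerp !mul1r ![_ + (_ - _)]addrC !subrK -surjective_pairing.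
Qed.

(** [side a b] is affine along the second segment, so with two zeros it vanishes there
    identically. *)
Lemma two_common a b c d x y : seg a b x -> seg a b y -> seg c d x -> seg c d y -> x != y ->
  side a b c = 0 /\ side a b d = 0.
Proof.
move=> /seg_side ax /seg_side ay [t _ tx] [u _ uy] xy.
have tu : t != u by apply: contraNneq xy => E; rewrite -tx -uy E.
rewrite -tx side_lerp in ax; rewrite -uy side_lerp in ay.
move: (side a b c) (side a b d) ax ay => A B ax ay.
have : (t - u) * (B - A) = 0 by lra.
move/eqP; rewrite mulf_eq0 subr_eq0 (negbTE tu) /= subr_eq0 => /eqP BA; subst B.
by split; lra.
Qed.

Lemma disc_sep p x y s : disc x s p -> disc y s p -> sqd x y <= 4 * s.
Proof.
rewrite /disc /sqd /=; case: p x y => [p1 p2] [x1 x2] [y1 y2] /= h1 h2.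
have : 0 <= (p1 - x1 + (p1 - y1)) ^+ 2 by exact: sqr_ge0.
have : 0 <= (p2 - x2 + (p2 - y2)) ^+ 2 by exact: sqr_ge0.
nra.
Qed.

Lemma sqd_continuous c : continuous (fun p => sqd p c).
Proof.
have c1 : continuous (fun p : R * R => p.1 - c.1).
  by move=> p; apply: cvgB; [exact: cvg_fst|exact: cvg_cst].
have c2 : continuous (fun p : R * R => p.2 - c.2).
  by move=> p; apply: cvgB; [exact: cvg_snd|exact: cvg_cst].
move=> p; rewrite /sqd; apply: cvgD; under eq_fun do rewrite expr2; rewrite expr2.
  by apply: cvgM; exact: c1.
by apply: cvgM; exact: c2.
Qed.

Lemma disc_closed c s : closed (disc c s).
Proof.
rewrite (_ : disc c s = (fun p => sqd p c) @^-1` [set t | t <= s]) //.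
apply: closed_comp; last exact: closed_le.
by move=> p _; exact: sqd_continuous.
Qed.

Lemma near_disc_disjoint (F : set (R * R)) c : closed F -> ~ F c ->
  \forall s \near (0 : R)^'+, forall p, disc c s p -> ~ F p.
Proof.
move=> cF Fc; have /nbhs_ballP[e /= e0 eF] : nbhs c (~` F) by apply: open_nbhs_nbhs; split=> //; exact: closed_openC.
have e20 : 0 < e ^+ 2 by rewrite exprn_gt0.
have := nbhs_right_lt e20; apply: filterS => s se p pc; apply: eF.
have lt (u : R) : u ^+ 2 <= s -> `|u| < e.
  move=> us; rewrite ltNge; apply/negP => eu.
  have : e ^+ 2 <= `|u| ^+ 2 by rewrite ler_pXn2r ?nnegrE // ltW.
  by rewrite real_normK ?num_real // leNgt (le_lt_trans us se).
move: pc; rewrite /disc /sqd /= => pc.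
by split; rewrite /ball /= distrC; apply: lt; apply: le_trans pc; rewrite ?lerDl ?lerDr sqr_ge0.
Qed.

(** A parabola with vertex [c] meets each of the finitely many lines in finitely many points, so
    some point of it near [c] is on none of them. *)
Lemma generic_point c s (L : seq ((R * R) * (R * R))) : 0 < s ->
  (forall l, l \in L -> l.1 != l.2) ->
  exists2 z, sqd z c < s & forall l, l \in L -> side l.1 l.2 z != 0.
Proof.
move=> s0 Lne.
pose lp (l : (R * R) * (R * R)) : {poly R} :=
  (l.2.1 - l.1.1)%:P * ('X^2 + (c.2 - l.1.2)%:P) - (l.2.2 - l.1.2)%:P * ('X + (c.1 - l.1.1)%:P).
pose z t := (c.1 + t, c.2 + t ^+ 2).
have lpE l t : (lp l).[t] = side l.1 l.2 (z t).
  by rewrite /lp !hornerE /side /z /=; ring.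
(* No line contains the three points of the parabola with parameters 0, 1 and -1. *)
have lp0 l : l.1 != l.2 -> lp l != 0.
  move=> ne; apply/eqP => E0.
  have h0 : side l.1 l.2 (z 0) = 0 by rewrite -lpE E0 horner0.
  have h1 : side l.1 l.2 (z 1) = 0 by rewrite -lpE E0 horner0.
  have h2 : side l.1 l.2 (z (-1)) = 0 by rewrite -lpE E0 horner0.
  case/eqP: ne; rewrite [l.1]surjective_pairing [l.2]surjective_pairing.
  move: h0 h1 h2; rewrite /side /z /=; move=> h0 h1 h2; congr pair; lra.
pose p := \prod_(l <- L) lp l.
have p0 : p != 0.
  by rewrite /p prodf_seq_neq0; apply/allP => l lL /=; exact/lp0/Lne.
(* For [0 < t < e] this gives [t ^+ 4 <= t ^+ 2 <= t < s / 2], hence a point inside the disc. *)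
pose e := Num.min 1 (s / 2).
have e0 : 0 < e by rewrite lt_min ltr01 divr_gt0.
(* These are [size p] distinct numbers below [e], more than [p] has roots. *)
pose rs := [seq e / (k.+2)%:R | k <- iota 0 (size p)].
have rs_uniq : uniq rs.
  rewrite map_inj_uniq ?iota_uniq // => i j /(mulfI (negbT (gt_eqF e0))) /invr_inj /eqP.
  by rewrite eqr_nat => /eqP [].
have [t trs pt] : exists2 t, t \in rs & ~~ root p t.
  apply/allPn; apply/negP => /(max_poly_roots p0)/(_ rs_uniq).
  by rewrite size_map size_iota ltnn.
have [t0 te] : 0 < t /\ t < e.
  move/mapP: trs => [k _ ->]; split; first by rewrite divr_gt0.
  by rewrite ltr_pdivrMr // ltr_pMr // ltr1n.
exists (z t).
  have [t1 ts] : t < 1 /\ t < s / 2 by move: te; rewrite lt_min => /andP.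
  have -> : sqd (z t) c = t ^+ 2 + (t ^+ 2) ^+ 2 by rewrite /sqd /z /=; ring.
  have t2 : t ^+ 2 <= t by rewrite expr2 ler_piMl // ltW.
  have t4 : (t ^+ 2) ^+ 2 <= t ^+ 2.
    by rewrite [X in X <= _]expr2 ler_piMl ?sqr_ge0 // (le_trans t2) // ltW.
  lra.
move=> l lL; rewrite -lpE; apply: contra pt => /eqP lt.
by rewrite /root /p horner_prod prodf_seq_eq0; apply/hasP; exists l => //=; rewrite lt.
Qed.

(** The start [p] is in the disc, hence the only common point; by the intermediate value theorem the
    arc also meets the circle. *)
Lemma arc_exit p q c s Y a : is_arc p q Y -> disc c s p -> ~ disc c s q ->
  Y `&` disc c s = [set a] -> p = a /\ sqd a c = s.
Proof.
move=> [g [cg gi <- <- <-]] hp hq Ya.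
have I0 : (0 : R) \in `[0, 1]%R by rewrite in_itv /= lexx ler01.
have pa : g 0 = a.
  by have : (g @` `[0, 1] `&` disc c s) (g 0); [split=> //; exists 0|rewrite Ya].
split=> //; move/negP: hq; rewrite -ltNge => hq.
have cf : {within `[0, 1], continuous (fun t => sqd (g t) c)}.
  apply: continuous_subspaceT => t.
  by apply: (@continuous_comp _ _ _ g (fun p => sqd p c)); [exact: cg|exact: sqd_continuous].
have [] := @IVT R (fun t => sqd (g t) c) 0 1 s ler01 cf.
  by rewrite ge_min le_max (ltW hq) orbT andbT; apply/orP; left.
move=> t tI gts; have : (g @` `[0, 1] `&` disc c s) (g t).
  by split; [exists t|rewrite /disc /= gts].
by rewrite Ya /= => <-.
Qed.

End Discs.

(** * Cutting a drawing along small discs around its vertices *)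

Section Stars.
Local Notation arc := Defs.arc.
Local Notation pos := Defs.pos.
Local Open Scope classical_set_scope.
Variables (R : realType) (T : finType) (G : graph T) (D : drawing R G).
Hypothesis fin : finite_set (crossings D).
Implicit Types (e f : {set T}) (x y z : T) (p q : R * R).

Let V := vset G.
Let E := eset G.

Definition edge_image e : set (R * R) := arc D e @` `[0, 1].

Let I0 : (0 : R) \in `[0, 1]%R. Proof. by rewrite in_itv /= lexx ler01. Qed.
Let I1 : (1 : R) \in `[0, 1]%R. Proof. by rewrite in_itv /= lexx ler01. Qed.

Lemma edge_ends e : e \in E -> exists x y, [/\ e = [set x; y]%SET, x != y, x \in V & y \in V].
Proof.
move=> /esetP/andP[eV /cards2P[x [y [xy eE]]]]; exists x, y; split=> //; apply: (fintype.subsetP eV).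
  by rewrite eE finset.in_set2 eqxx.
by rewrite eE finset.in_set2 eqxx orbT.
Qed.

Lemma edge_mem e x : e \in E -> x \in e -> x \in V.
Proof. by move=> /esetP/andP[/fintype.subsetP + _]; apply. Qed.

Lemma edge_is_arc e x y : e \in E -> e = [set x; y]%SET -> x != y ->
  is_arc (pos D x) (pos D y) (edge_image e).
Proof.
move=> eE exy xy.
have ar : is_arc (arc D e 0) (arc D e 1) (edge_image e).
  exists (arc D e \o @clamp R); split.
  - by apply: within_clamp; exact: arc_continuous.
  - by move=> s t sI tI /=; rewrite !clamp_id //; exact: (arc_inj eE).
  - by rewrite /= clamp_id.
  - by rewrite /= clamp_id.
  - by apply: eq_imagel => t tI /=; rewrite clamp_id.
have [_ _ n01] := arc_points ar.
have ends := arc_ends D eE.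
have h0 : arc D e 0 = pos D x \/ arc D e 0 = pos D y.
  have : [set arc D e 0; arc D e 1] (arc D e 0) by left.
  by rewrite ends => -[z /=]; rewrite exy finset.in_set2 => /orP[]/eqP-> <-; [left|right].
have h1 : arc D e 1 = pos D x \/ arc D e 1 = pos D y.
  have : [set arc D e 0; arc D e 1] (arc D e 1) by right.
  by rewrite ends => -[z /=]; rewrite exy finset.in_set2 => /orP[]/eqP-> <-; [left|right].
case: h0 h1 => [a0|a0] [a1|a1]; rewrite ?a0 ?a1 // in ar n01.
exact: arc_rev.
Qed.

Lemma edge_image_cases e p : e \in E -> edge_image e p ->
  arc_interior D e p \/ exists2 x, x \in e & p = pos D x.
Proof.
move=> eE [t /= tI tp].
have [t0|t0] := eqVneq t 0.
  right; have : [set arc D e 0; arc D e 1] p by left; rewrite -tp t0.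
  by rewrite (arc_ends D eE) => -[x /= xe <-]; exists x.
have [t1|t1] := eqVneq t 1.
  right; have : [set arc D e 0; arc D e 1] p by right; rewrite -tp t1.
  by rewrite (arc_ends D eE) => -[x /= xe <-]; exists x.
left; exists t => //=; move: tI; rewrite !in_itv /= => /andP[? ?].
by rewrite !lt_neqAle t1 eq_sym t0; apply/andP; split.
Qed.

Lemma edge_image_vertex e z : e \in E -> z \in V -> edge_image e (pos D z) -> z \in e.
Proof.
move=> eE zV /(edge_image_cases eE)[[t tI tz]|[x xe xz]].
  by case: (arc_avoids eE tI zV tz).
by rewrite (pos_inj zV (edge_mem eE xe) xz).
Qed.

Lemma edge_crossing e f p : e \in E -> f \in E -> e != f -> edge_image e p -> edge_image f p ->
  (forall z, z \in V -> p <> pos D z) -> crossings D ([set e; f]%SET, p).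
Proof.
move=> eE fE ef ep fp np; split=> /=.
- by apply/fintype.subsetP => g; rewrite finset.in_set2 => /orP[]/eqP->.
- by rewrite cards2 ef.
- move=> g; rewrite finset.in_set2 => /orP[]/eqP->.
    have [//|[x xe px]] := edge_image_cases eE ep.
    by case: (np x (edge_mem eE xe) px).
  have [//|[x xe px]] := edge_image_cases fE fp.
  by case: (np x (edge_mem fE xe) px).
Qed.

Lemma edge_image_closed e : e \in E -> closed (edge_image e).
Proof.
by move=> eE; have [x [y [exy xy _ _]]] := edge_ends eE; exact: arc_closed (edge_is_arc eE exy xy).
Qed.

Lemma good_radius : exists2 s : R, 0 < s & [/\
  forall x y p, x \in V -> y \in V -> disc (pos D x) s p -> disc (pos D y) s p -> x = y,
  forall e x p, e \in E -> x \in V -> edge_image e p -> disc (pos D x) s p -> x \in e &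
  forall e f x p, e \in E -> f \in E -> e != f -> x \in V -> edge_image e p -> edge_image f p ->
    disc (pos D x) s p -> p = pos D x].
Proof.
have n1 : \forall s \near (0 : R)^'+, forall xy : T * T, xy.1 \in V -> xy.2 \in V ->
    xy.1 != xy.2 -> 4 * s < sqd (pos D xy.1) (pos D xy.2).
  apply: filter_forall => -[x y] /=.
  have [/and3P[xV yV xy]|no] := boolP [&& x \in V, y \in V & x != y]; last first.
    by near=> s => xV yV xy; rewrite xV yV xy in no.
  have d0 : 0 < sqd (pos D x) (pos D y) / 4.
    rewrite divr_gt0 //; apply: sqd_gt0; apply: contraNneq xy => /(pos_inj xV yV) ->//.
  have := nbhs_right_lt d0; apply: filterS => s; rewrite ltr_pdivlMr // mulrC.
  by move=> h _ _ _.
have n2 : \forall s \near (0 : R)^'+, forall ex : {set T} * T, ex.1 \in E -> ex.2 \in V ->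
    ex.2 \notin ex.1 -> forall p, disc (pos D ex.2) s p -> ~ edge_image ex.1 p.
  apply: filter_forall => -[e x] /=.
  have [/and3P[eE xV xe]|no] := boolP [&& e \in E, x \in V & x \notin e]; last first.
    by near=> s => eE xV xe; rewrite eE xV xe in no.
  have nx : ~ edge_image e (pos D x) by move=> /(edge_image_vertex eE xV); rewrite (negbTE xe).
  by apply: filterS (near_disc_disjoint (edge_image_closed eE) nx) => s h _ _ _.
(* The crossing points form a finite, hence closed set without vertices. *)
pose F : set (R * R) := snd @` crossings D.
have cF : closed F.
  apply: (iffLR accessible_finite_set_closed); last exact: finite_image.
  exact/hausdorff_accessible/norm_hausdorff.
have n3 : \forall s \near (0 : R)^'+, forall x : T, x \in V ->
    forall p, disc (pos D x) s p -> ~ F p.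
  apply: filter_forall => x.
  have [xV|no] := boolP (x \in V); last by near=> s.
  have nx : ~ F (pos D x).
    move=> [[P q] /= [PE P2 Pint] qx].
    have [e eP] : exists e, e \in P by apply/set0Pn; rewrite -card_gt0 P2.
    have [t tI tq] := Pint _ eP; have eE : e \in E := fintype.subsetP PE _ eP.
    by case: (arc_avoids eE tI xV (etrans tq qx)).
  by apply: filterS (near_disc_disjoint cF nx) => s h _.
have [s [[s0 h1] [h2 h3]]] := filter_ex (filterI (filterI (nbhs_right_gt (0 : R)) n1) (filterI n2 n3)).
have d1 x y p : x \in V -> y \in V -> disc (pos D x) s p -> disc (pos D y) s p -> x = y.
  move=> xV yV px py; apply/eqP; apply: contraT => xy.
  by have := h1 (x, y) xV yV xy; rewrite ltNge (disc_sep px py).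
exists s => //; split=> //.
  move=> e x p eE xV ep px; apply: contraT => xe.
  by case: (h2 (e, x) eE xV xe p px ep).
move=> e f x p eE fE ef xV ep fp px; apply: contrapT => npx.
apply: (h3 x xV p px); exists ([set e; f]%SET, p) => //.
apply: edge_crossing => // z zV pz; apply: npx.
rewrite pz; congr (pos D _); apply: (d1 z x p zV xV _ px).
by rewrite pz /disc /sqd /= !subrr expr0n addr0 ltW.
Unshelve. all: by end_near. Qed.

(* The discs of squared radius s around the vertices are pairwise disjoint, Y e is
   the part of e between its two discs, ex e x is the point at which it reaches
   the disc of x, and nz x is a generic point of that disc, which becomes the
   vertex x of the new drawing. *)
Definition star_data (s : R) (Y : {set T} -> set (R * R)) (ex : {set T} -> T -> R * R)
    (nz : T -> R * R) : Prop :=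
  [/\ forall x y p, x \in V -> y \in V -> disc (pos D x) s p -> disc (pos D y) s p -> x = y,
      forall e x p, e \in E -> x \in V -> Y e p -> disc (pos D x) s p -> x \in e /\ p = ex e x,
      forall e x, e \in E -> x \in e -> sqd (ex e x) (pos D x) = s,
      forall e f x, e \in E -> f \in E -> e != f -> x \in e -> x \in f -> ex e x <> ex f x &
  [/\ forall e x y, e \in E -> x \in e -> y \in e -> joined (Y e) (ex e x) (ex e y),
      forall e f p, e \in E -> f \in E -> e != f -> Y e p -> Y f p ->
        crossings D ([set e; f]%SET, p),
      forall x, x \in V -> sqd (nz x) (pos D x) < s &
      forall e f x, e \in E -> f \in E -> e != f -> x \in e -> x \in f ->
        side (ex e x) (ex f x) (nz x) != 0]].

Lemma star_exists : exists s Y ex nz, star_data s Y ex nz.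
Proof.
have [s s0 [sep inc iso]] := good_radius.
have pd x : disc (pos D x) s (pos D x) by rewrite /disc /sqd /= !subrr expr0n addr0 ltW.
have trim e : exists YX : set (R * R) * (T -> R * R), e \in E ->
    [/\ YX.1 `<=` edge_image e,
        forall x, x \in e -> YX.1 `&` disc (pos D x) s = [set YX.2 x],
        forall x, x \in e -> sqd (YX.2 x) (pos D x) = s &
        forall x y, x \in e -> y \in e -> joined YX.1 (YX.2 x) (YX.2 y)].
  have [eE|eE] := boolP (e \in E); last by exists (set0, fun=> 0).
  have [x [y [exy xy xV yV]]] := edge_ends eE.
  have ax := edge_is_arc eE exy xy.
  have [] := arc_trim ax (@disc_closed R (pos D x) s) (@disc_closed R (pos D y) s) (pd x) (pd y).
    by move=> p px py; move: xy; rewrite (sep x y p xV yV px py) eqxx.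
  move=> a [b [Y0 [aY YX Ya Yb]]].
  have [Y0a Y0b _] := arc_points aY.
  have da : disc (pos D x) s a by have : (Y0 `&` disc (pos D x) s) a by [rewrite Ya]; case.
  have db : disc (pos D y) s b by have : (Y0 `&` disc (pos D y) s) b by [rewrite Yb]; case.
  have nb : ~ disc (pos D x) s b.
    by move=> dxb; move: xy; rewrite (sep x y b xV yV dxb db) eqxx.
  have na : ~ disc (pos D y) s a.
    by move=> dya; move: xy; rewrite (sep x y a xV yV da dya) eqxx.
  have [_ sa] := arc_exit aY da nb Ya; have [_ sb] := arc_exit (arc_rev aY) db na Yb.
  have jab : joined Y0 a b by right; exists Y0.
  exists (Y0, fun z => if z == x then a else b) => _; split=> //=.
  - move=> z; rewrite exy finset.in_set2 => /orP[]/eqP->; first by rewrite eqxx.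
    by rewrite eq_sym (negbTE xy).
  - move=> z; rewrite exy finset.in_set2 => /orP[]/eqP->; first by rewrite eqxx.
    by rewrite eq_sym (negbTE xy).
  - move=> z w; rewrite exy !finset.in_set2 => /orP[]/eqP-> /orP[]/eqP->;
      rewrite ?eqxx ?(eq_sym y) ?(negbTE xy); try by left.
      exact: jab.
    exact: joined_sym.
have [YX YXP] := choice trim.
pose Y e := (YX e).1; pose ex e := (YX e).2.
have exY e x : e \in E -> x \in e -> Y e (ex e x) /\ disc (pos D x) s (ex e x).
  move=> eE xe; have [_ h _ _] := YXP _ eE.
  by have : ((YX e).1 `&` disc (pos D x) s) (ex e x) by [rewrite h]; case.
(* Equal exits would be a common point of two edges in the disc, hence its centre, while exits lie
   on the circle. *)
have ne e f x : e \in E -> f \in E -> e != f -> x \in e -> x \in f -> ex e x <> ex f x.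
  move=> eE fE ef xe xf E1; have [h1 d1] := exY _ _ eE xe; have [h2 d2] := exY _ _ fE xf.
  have [s1 _ c1 _] := YXP _ eE; have [s2 _ _ _] := YXP _ fE.
  have xV := edge_mem eE xe.
  have pE : ex e x = pos D x.
    by apply: (iso e f x) => //; [exact: s1|rewrite E1; exact: s2].
  by have := c1 _ xe; rewrite -/(ex e) pE /sqd !subrr expr0n addr0 => /esym/eqP; rewrite gt_eqF.
(* The new vertex must avoid every line through two exits, so that segments from it to distinct
   exits meet only there and no chord passes through it. *)
have gen x : exists z : R * R, x \in V -> sqd z (pos D x) < s /\
    forall e f, e \in E -> f \in E -> e != f -> x \in e -> x \in f ->
      side (ex e x) (ex f x) z != 0.
  pose L := [seq (ex ef.1 x, ex ef.2 x) | ef <- enum {: {set T} * {set T}} &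
    [&& ef.1 \in E, ef.2 \in E, ef.1 != ef.2, x \in ef.1 & x \in ef.2]].
  have [|z zs zL] := @generic_point R (pos D x) s L s0.
    move=> l /mapP[[e f]]; rewrite mem_filter => /andP[/and5P[/= eE fE ef xe xf] _] -> /=.
    by apply/eqP; exact: ne.
  exists z => _; split=> // e f eE fE ef xe xf.
  apply: (zL (ex e x, ex f x)); apply/mapP; exists (e, f) => //.
  by rewrite mem_filter /= eE fE ef xe xf mem_enum.
have [nz nzP] := choice gen.
have P2 e x p : e \in E -> x \in V -> Y e p -> disc (pos D x) s p -> x \in e /\ p = ex e x.
  move=> eE xV Yp px; have [s1 h _ _] := YXP _ eE.
  have xe : x \in e := inc _ _ _ eE xV (s1 _ Yp) px; split=> //.
  by have : ((YX e).1 `&` disc (pos D x) s) p by []; rewrite h.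
exists s, Y, ex, nz; split=> //.
- by move=> e x eE xe; have [_ _ h _] := YXP _ eE; exact: h.
- split.
  + by move=> e x y eE xe ye; have [_ _ _ h] := YXP _ eE; exact: h.
  + move=> e f p eE fE ef Yp Yfp; have [s1 _ c1 _] := YXP _ eE; have [s2 _ _ _] := YXP _ fE.
    apply: edge_crossing => //; [exact: s1|exact: s2|].
    move=> z zV pz; rewrite pz in Yp; have [ze zE] := P2 _ _ _ eE zV Yp (pd z).
    by have := c1 _ ze; rewrite -/(ex e) -zE /sqd !subrr expr0n addr0 => /esym/eqP; rewrite gt_eqF.
  + by move=> x xV; have [] := nzP _ xV.
  + by move=> e f x eE fE ef xe xf; have [_] := nzP _ (edge_mem eE xe); apply.
Qed.

End Stars.

(** * The drawing of the complete graph along edge-disjoint paths *)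

Section Redraw.
Local Open Scope classical_set_scope.
Local Notation arc := Defs.arc.
Local Notation pos := Defs.pos.
Variables (R : realType) (T : finType) (G : graph T) (D : drawing R G).
Variables (s : R) (Y : {set T} -> set (R * R)) (ex : {set T} -> T -> R * R) (nz : T -> R * R).
Hypothesis star : star_data D s Y ex nz.
Implicit Types (e f : {set T}) (u v x y z : T) (p : R * R) (q : seq T).

Let V := vset G.
Let E := eset G.

(* The path q crosses the disc of its vertex v along a chord; at its first and last
   vertices this is a segment from nz v to the circle. *)
Definition local_piece q v : set (R * R) :=
  let k := index v q in
  let prv := [set nth v q k.-1; v]%SET in
  let nxt := [set v; nth v q k.+1]%SET in
  if k == 0%N then seg (nz v) (ex nxt v)
  else if k.+1 == size q then seg (nz v) (ex prv v)
  else seg (ex prv v) (ex nxt v).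

Definition region q : set (R * R) :=
  [set p | (exists2 e, e \in path_edges q & Y e p) \/ (exists2 v, v \in q & local_piece q v p)].

Definition is_end q v := (index v q == 0%N) || ((index v q).+1 == size q).

Definition valid q := [/\ uniq q, (1 < size q)%N & forall e, e \in path_edges q -> e \in E].

Lemma path_edges_nth q x k : (k.+1 < size q)%N ->
  [set nth x q k; nth x q k.+1]%SET \in path_edges q.
Proof.
move=> kq; rewrite /path_edges; apply/mapP; exists (nth x q k, nth x q k.+1) => //.
have -> : (nth x q k, nth x q k.+1) = nth (x, x) (zip q (behead q)) k.
  by rewrite nth_zip_cond size_zip size_behead ltn_min (ltnW kq) -ltnS prednK ?kq ?nth_behead //; case: q kq.
by apply: mem_nth; rewrite size_zip size_behead ltn_min (ltnW kq) -ltnS prednK ?kq //; case: q kq.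
Qed.

Lemma index_edges q v : valid q -> v \in q ->
  ((0 < index v q)%N -> [set nth v q (index v q).-1; v]%SET \in path_edges q) /\
  ((index v q).+1 != size q -> [set v; nth v q (index v q).+1]%SET \in path_edges q).
Proof.
move=> [uq sq _] vq; have kq : (index v q < size q)%N by rewrite index_mem.
split=> [k0|kn].
  have := @path_edges_nth q v (index v q).-1; rewrite prednK // nth_index // => /(_ kq).
  by [].
have := @path_edges_nth q v (index v q); rewrite nth_index //; apply.
by rewrite ltn_neqAle kn.
Qed.

Lemma local_cases q v : valid q -> v \in q ->
  (is_end q v /\ exists e, [/\ e \in path_edges q, v \in e & local_piece q v = seg (nz v) (ex e v)]) \/
  (~~ is_end q v /\ exists e f, [/\ e \in path_edges q /\ f \in path_edges q, e != f,
    v \in e, v \in f & local_piece q v = seg (ex e v) (ex f v)]).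
Proof.
move=> vq vin; have [i1 i2] := index_edges vq vin; have [uq sq _] := vq.
have kq : (index v q < size q)%N by rewrite index_mem.
rewrite /local_piece /is_end; case: eqP => [k0|/eqP k0] /=.
  left; split=> //; exists [set v; nth v q (index v q).+1]%SET; rewrite finset.in_set2 eqxx; split=> //.
  by apply: i2; rewrite k0 neq_ltn sq.
case: eqP => [kn|/eqP kn].
  left; split=> //; exists [set nth v q (index v q).-1; v]%SET; rewrite finset.in_set2 eqxx orbT; split=> //.
  by apply: i1; rewrite lt0n.
right; split=> //; exists [set nth v q (index v q).-1; v]%SET, [set v; nth v q (index v q).+1]%SET.
rewrite !finset.in_set2 eqxx orbT; split=> //.
  by split; [apply: i1; rewrite lt0n|exact: i2].
have k1q : ((index v q).+1 < size q)%N by rewrite ltn_neqAle kn.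
apply/eqP => /setP/(_ (nth v q (index v q).-1)); rewrite !finset.in_set2 eqxx /=.
have kE : v = nth v q (index v q) by rewrite nth_index.
rewrite [in X in _ = (_ == X) || _]kE !nth_uniq //; last by apply: leq_ltn_trans (leq_pred _) kq.
  by case: (index v q) k0 => // k _; rewrite /= => /esym/orP[]/eqP; lia.
by apply: leq_ltn_trans (leq_pred _) kq.
Qed.

Lemma valid_V q v : valid q -> v \in q -> v \in V.
Proof.
move=> vq vin; have [_ _ qE] := vq.
by have [[_ [e [eq ve _]]]|[_ [e [f [[eq _] _ ve _ _]]]]] := local_cases vq vin;
  exact: edge_mem (qE _ eq) ve.
Qed.

Let ex_disc e v : e \in E -> v \in e -> disc (pos D v) s (ex e v).
Proof. by move=> eE ve; have [_ _ h _ _] := star; rewrite /disc /= h. Qed.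

Let nz_disc v : v \in V -> disc (pos D v) s (nz v).
Proof. by move=> vV; have [_ _ _ _ [_ _ h _]] := star; rewrite /disc /= ltW // h. Qed.

Lemma local_disc q v p : valid q -> v \in q -> local_piece q v p -> disc (pos D v) s p.
Proof.
move=> vq vin; have vV := valid_V vq vin; have [_ _ qE] := vq.
have [[_ [e [eq ve ->]]]|[_ [e [f [[eq fq] _ ve vf ->]]]]] := local_cases vq vin.
  by apply: seg_disc; [exact: nz_disc|exact: ex_disc (qE _ eq) ve].
by apply: seg_disc; [exact: ex_disc (qE _ eq) ve|exact: ex_disc (qE _ fq) vf].
Qed.

Lemma local_circle q v p : valid q -> v \in q -> local_piece q v p -> sqd p (pos D v) = s ->
  exists e, [/\ e \in path_edges q, v \in e & p = ex e v].
Proof.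
move=> vq vin; have vV := valid_V vq vin; have [_ _ qE] := vq.
have [_ _ sx ne [_ _ nzs _]] := star.
have [[_ [e [eq ve ->]]]|[_ [e [f [[eq fq] ef ve vf ->]]]]] := local_cases vq vin => pp ps.
  by exists e; split=> //; apply: radius_circle (nzs _ vV) (sx _ _ (qE _ eq) ve) pp ps.
have exf : ex e v != ex f v by apply/eqP; apply: ne => //; exact: qE.
have [->|->] := chord_circle (sx _ _ (qE _ eq) ve) (sx _ _ (qE _ fq) vf) exf pp ps.
  by exists e.
by exists f.
Qed.

Lemma joined_seg (X : set (R * R)) (a b : R * R) : seg a b `<=` X -> joined X a b.
Proof.
move=> sX; have [->|ab] := eqVneq a b; [by left|right; exists (seg a b) => //].
exact: seg_arc.
Qed.

(** Consecutive pieces share end points. The pieces may also meet elsewhere, and [joined] extracts a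
    simple arc from their union. *)
Lemma region_joined x (l : seq T) : valid (x :: l) -> joined (region (x :: l)) (nz x) (nz (last x l)).
Proof.
move=> vq; set q := x :: l in vq *; have [uq sq qE] := vq.
pose vk k := nth x q k; pose ek k := [set vk k; vk k.+1]%SET.
have [_ _ _ _ [jY _ _ _]] := star.
have ekq k : (k.+1 < size q)%N -> ek k \in path_edges q by exact: path_edges_nth.
have stepY k : (k.+1 < size q)%N -> joined (region q) (ex (ek k) (vk k)) (ex (ek k) (vk k.+1)).
  move=> kq; have := jY (ek k) (vk k) (vk k.+1) (qE _ (ekq _ kq)).
  rewrite !finset.in_set2 !eqxx orbT => /(_ isT isT); apply: joined_sub => p Yp.
  by left; exists (ek k) => //; exact: ekq.
have idx k : (k < size q)%N -> index (vk k) q = k by move=> kq; rewrite /vk index_uniq.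
have loc k : (k < size q)%N -> local_piece q (vk k) `<=` region q.
  by move=> kq p lp; right; exists (vk k) => //; exact: mem_nth.
have chain k : (k.+1 < size q)%N -> joined (region q) (nz x) (ex (ek k) (vk k.+1)).
  elim: k => [|k IH] kq.
    apply: joined_trans (stepY 0%N kq); apply: joined_seg.
    apply: subset_trans (loc 0%N (ltnW kq)); rewrite /local_piece idx ?(ltnW kq) //=.
  apply: joined_trans (IH (ltnW kq)) _; apply: joined_trans (stepY k.+1 kq); apply: joined_seg.
  apply: subset_trans (loc k.+1 (ltnW kq)); rewrite /local_piece idx ?(ltnW kq) //=.
  rewrite (ltn_eqF kq) /ek (set_nth_default x) // ?(set_nth_default x (vk k.+1)) //.
  exact: ltnW (ltnW kq).
have sl : (size l).-1.+1 = size l by apply: prednK; move: sq.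
have lastE : last x l = vk (size l) by rewrite /vk (last_nth x).
apply: joined_trans (chain (size l).-1 _) _; first by rewrite sl /= ltnSn.
apply: joined_sym; apply: joined_seg; rewrite lastE sl.
have lq : (size l < size q)%N by rewrite /= ltnSn.
apply: subset_trans (loc _ lq); rewrite /local_piece idx //= eqxx /ek sl.
have l0 : (size l == 0)%N = false by rewrite -sl.
rewrite l0 (set_nth_default x) //; exact: leq_ltn_trans (leq_pred _) lq.
Qed.

(** Trimmed edges meet in old crossings, and local pieces only within one disc. An edge of one path
    meets a local piece of the other only if two exits on the circle coincide, which does not happen
    for distinct edges. *)
Lemma region_meet q q' p : valid q -> valid q' ->
  (forall e, e \in path_edges q -> e \in path_edges q' -> False) ->
  region q p -> region q' p ->
  (exists e f, [/\ e \in path_edges q, f \in path_edges q' & crossings D ([set e; f]%SET, p)]) \/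
  (exists v, [/\ v \in q, v \in q', local_piece q v p & local_piece q' v p]).
Proof.
have [sep Yd sx ne [_ cr _ _]] := star.
have mix q1 q2 e v : valid q1 -> valid q2 ->
    (forall e, e \in path_edges q1 -> e \in path_edges q2 -> False) ->
    e \in path_edges q1 -> v \in q2 -> Y e p -> local_piece q2 v p -> False.
  move=> v1 v2 dis eq vin Yp lp; have [_ _ E1] := v1; have [_ _ E2] := v2.
  have vV := valid_V v2 vin.
  have [ve pE] := Yd _ _ _ (E1 _ eq) vV Yp (local_disc v2 vin lp).
  have ps : sqd p (pos D v) = s by rewrite pE sx //; exact: E1.
  have [f [fq vf pF]] := local_circle v2 vin lp ps.
  have [ef|ef] := eqVneq e f; first by apply: (dis e) => //; rewrite ef.
  by apply: (ne e f v (E1 _ eq) (E2 _ fq) ef ve vf); rewrite -pE -pF.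
move=> vq vq' dis [[e eq Ye]|[v vin lv]] [[f fq Yf]|[u uin lu]].
- left; exists e, f; split=> //; have [_ _ E1] := vq; have [_ _ E2] := vq'.
  apply: cr => //; [exact: E1|exact: E2|].
  by apply/eqP => ef; apply: (dis e) => //; rewrite ef.
- by case: (mix q q' e u).
- by case: (mix q' q f v) => // g h1 h2; exact: dis h2 h1.
- right; exists v; have E1 : v = u.
    by apply: (sep v u p); [exact: valid_V vin|exact: valid_V uin|exact: local_disc lv|exact: local_disc lu].
  by subst u.
Qed.

(** One piece is a chord, and the other has at least one end at an exit. Two common points would
    make them collinear and put this exit on the line of the chord, hence at an end of the chord,
    although exits of distinct edges differ. *)
Lemma local_unique q q' v p p' : valid q -> valid q' ->
  (forall e, e \in path_edges q -> e \in path_edges q' -> False) ->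
  v \in q -> v \in q' -> ~~ (is_end q v && is_end q' v) ->
  local_piece q v p -> local_piece q' v p -> local_piece q v p' -> local_piece q' v p' -> p = p'.
Proof.
have [_ _ sx ne _] := star.
have aux q1 q2 : valid q1 -> valid q2 ->
    (forall e, e \in path_edges q1 -> e \in path_edges q2 -> False) ->
    v \in q1 -> v \in q2 -> ~~ is_end q1 v ->
    local_piece q1 v p -> local_piece q2 v p -> local_piece q1 v p' -> local_piece q2 v p' -> p = p'.
  move=> v1 v2 dis vin1 vin2 ni; have [_ _ E1] := v1; have [_ _ E2] := v2.
  have [[ie]|[_ [e [f [[eq fq] ef ve vf ->]]]]] := local_cases v1 vin1; first by rewrite ie in ni.
  have exf : ex e v != ex f v by apply/eqP; apply: ne => //; exact: E1.
  have [c [g [gq vg ->]]] : exists c g, [/\ g \in path_edges q2, v \in g & local_piece q2 v = seg c (ex g v)].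
    by have [[_ [g [gq vg ->]]]|[_ [g1 [g [[_ gq] _ _ vg ->]]]]] := local_cases v2 vin2;
      [exists (nz v), g|exists (ex g1 v), g].
  move=> h1 h2 h3 h4; apply/eqP; apply: contraT => pp.
  have [_ sg] := two_common h1 h3 h2 h4 pp.
  have gE := E2 _ gq.
  have [Eg|Eg] := line_circle (sx _ _ (E1 _ eq) ve) (sx _ _ (E1 _ fq) vf) exf sg (sx _ _ gE vg).
    have [ge|ge] := eqVneq g e; first by case: (dis e) => //; rewrite -ge.
    by case: (ne g e v gE (E1 _ eq) ge vg ve).
  have [ge|ge] := eqVneq g f; first by case: (dis f) => //; rewrite -ge.
  by case: (ne g f v gE (E1 _ fq) ge vg vf).
move=> vq vq' dis vin vin'; rewrite negb_and => /orP[ni|ni] h1 h2 h3 h4.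
  exact: (aux q q').
by apply: (aux q' q) => // e g1 g2; exact: dis g2 g1.
Qed.

(** A second common point would make [nz v] collinear with two exits, against its generic choice. *)
Lemma local_ends q q' v p : valid q -> valid q' ->
  (forall e, e \in path_edges q -> e \in path_edges q' -> False) ->
  v \in q -> v \in q' -> is_end q v -> is_end q' v ->
  local_piece q v p -> local_piece q' v p -> p = nz v.
Proof.
have [_ _ sx ne [_ _ _ gen]] := star.
move=> v1 v2 dis vin1 vin2 i1 i2; have [_ _ E1] := v1; have [_ _ E2] := v2.
have [[_ [e [eq ve ->]]]|[]] := local_cases v1 vin1; last by rewrite i1.
have [[_ [f [fq vf ->]]]|[]] := local_cases v2 vin2; last by rewrite i2.
have ef : e != f by apply/eqP => ef; apply: (dis e) => //; rewrite ef.
move=> h1 h2; apply/eqP; apply: contraT => pn.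
have [n1 _] := seg_ends (nz v) (ex e v); have [n2 _] := seg_ends (nz v) (ex f v).
have [_ sg] := two_common h1 n1 h2 n2 pn.
by have := gen e f v (E1 _ eq) (E2 _ fq) ef ve vf; rewrite -side_cycle sg eqxx.
Qed.

(** A path with [y] as an inner vertex passes its disc along a chord, which misses the generic point
    [nz y]. *)
Lemma region_avoids q y : valid q -> y \in V -> region q (nz y) -> y \in q /\ is_end q y.
Proof.
have [sep Yd sx ne [_ _ nzs gen]] := star.
move=> vq yV; have [_ _ qE] := vq; have dy := nz_disc yV; case=> [[e eq Ye]|[v vin lv]].
  have [ye E1] := Yd _ _ _ (qE _ eq) yV Ye dy.
  by have := nzs _ yV; rewrite E1 sx ?ltxx //; exact: qE.
have E1 : y = v.
  by apply: (sep y v (nz y)) => //; [exact: valid_V vin|exact: local_disc lv].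
subst v; split=> //.
have [[//]|[_ [e [f [[eq fq] ef ve vf lE]]]]] := local_cases vq vin.
have := gen e f y (qE _ eq) (qE _ fq) ef ve vf.
by rewrite lE in lv; rewrite (seg_side lv) eqxx.
Qed.

Variables (r : nat) (sg : 'I_r -> T) (rt : {set 'I_r} -> seq T).
Hypothesis sg_inj : injective sg.
Hypothesis sg_V : forall i, sg i \in V.
Hypothesis rt_valid : forall F : {set 'I_r}, #|F| = 2%N -> valid (rt F).
Hypothesis rt_ends2 : forall F : {set 'I_r}, #|F| = 2%N -> exists x l,
  rt F = x :: l /\ [set sg i | i in F]%SET = [set x; last x l]%SET.
Hypothesis rt_disjoint : forall (F H : {set 'I_r}) e, #|F| = 2%N -> #|H| = 2%N -> F != H ->
  e \in path_edges (rt F) -> e \in path_edges (rt H) -> False.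

Lemma is_end_cons x (l : seq T) v : uniq (x :: l) -> v \in x :: l -> is_end (x :: l) v ->
  v = x \/ v = last x l.
Proof.
move=> uq vin; rewrite /is_end => /orP[/eqP k0|/eqP kn].
  by left; rewrite -(nth_index x vin) k0.
by right; rewrite (last_nth x) -[v in LHS](nth_index x vin); congr nth; move: kn => /= [].
Qed.

Lemma rt_end_mem (F : {set 'I_r}) i : #|F| = 2%N -> sg i \in rt F -> is_end (rt F) (sg i) -> i \in F.
Proof.
move=> F2; have [uq _ _] := rt_valid F2; have [x [l [rE sE]]] := rt_ends2 F2.
move: uq; rewrite rE => uq vin ie.
have : sg i \in [set sg i | i in F]%SET.
  by rewrite sE finset.in_set2; have [->|->] := is_end_cons uq vin ie; rewrite eqxx ?orbT.
by move/imsetP => [j jF /sg_inj ->].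
Qed.

(** Choosing a simple arc in each region gives a drawing; its crossings are common points of
    regions, as classified by [region_meet]. *)
Lemma redraw : exists D' : drawing R (complete r), forall (P : {set {set 'I_r}}) p,
  crossings D' (P, p) -> exists F H : {set 'I_r},
  [/\ P = [set F; H]%SET, F != H, #|F| = 2%N, #|H| = 2%N &
    (exists e f, [/\ e \in path_edges (rt F), f \in path_edges (rt H) &
       crossings D ([set e; f]%SET, p)]) \/
    (exists v, [/\ v \in rt F /\ v \in rt H, local_piece (rt F) v p, local_piece (rt H) v p &
       ~~ (is_end (rt F) v && is_end (rt H) v)])].
Proof.
have [sep _ _ _ [_ _ nzs _]] := star.
have nz_inj i j : nz (sg i) = nz (sg j) -> i = j.
  move=> E1; apply: sg_inj; apply: (sep _ _ (nz (sg i))) => //; first exact: nz_disc.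
  by rewrite E1; exact: nz_disc.
have cE (F : {set 'I_r}) : F \in eset (complete r) -> #|F| = 2%N.
  by rewrite /= finset.in_set => /eqP.
have exg (F : {set 'I_r}) : exists g : R -> R * R, #|F| = 2%N ->
    [/\ continuous g, {in `[0, 1]%R &, injective g},
        [set g 0; g 1] = ((fun i => nz (sg i)) @` [set` F]) &
        forall t, t \in `[0, 1]%R -> region (rt F) (g t)].
  have [F2|F2] := eqVneq #|F| 2%N; last by exists (fun=> 0) => /eqP; rewrite (negbTE F2).
  have vF := rt_valid F2; have [x [l [rE sE]]] := rt_ends2 F2.
  have xl : x != last x l.
    have : #|[set sg i | i in F]%SET| = 2%N by rewrite card_imset.
    by rewrite sE cards2; case: eqP.
  have xin : x \in [set sg i | i in F]%SET by rewrite sE finset.in_set2 eqxx.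
  have lin : last x l \in [set sg i | i in F]%SET by rewrite sE finset.in_set2 eqxx orbT.
  have [i iF ix] := imsetP xin; have [j jF jl] := imsetP lin.
  have ij : i != j by apply: contraNneq xl => ij; rewrite jl ix ij.
  have FE : F = [set i; j]%SET.
    apply/esym/eqP; rewrite eqEcard F2 cards2 ij andbT.
    by apply/fintype.subsetP => k; rewrite finset.in_set2 => /orP[]/eqP->.
  have := vF; rewrite rE => vF'.
  have [E1|[Z [g [cg gi g0 g1 gZ]] ZX]] := region_joined vF'.
    by move: ij; rewrite (nz_inj i j) ?eqxx // -ix -jl.
  exists g => _; split=> //.
  - rewrite g0 g1 jl ix; apply/seteqP; split=> [p [->|->]|p [k /=]].
    + by exists i.
    + by exists j.
    + by rewrite FE finset.in_set2 => /orP[]/eqP-> <-; [left|right].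
  - by move=> t tI; apply: ZX; rewrite -gZ; exists t.
have [gm gmP] := choice exg.
have p_inj : {in vset (complete r) &, injective (fun i => nz (sg i))}.
  by move=> i j _ _; exact: nz_inj.
have p_cont F : F \in eset (complete r) -> {within `[0, 1], continuous (gm F)}.
  by move=> /cE/gmP[cg _ _ _]; exact: continuous_subspaceT.
have p_arc F : F \in eset (complete r) -> {in `[0, 1]%R &, injective (gm F)}.
  by move=> /cE/gmP[].
have p_ends F : F \in eset (complete r) ->
    [set gm F 0; gm F 1] = ((fun i => nz (sg i)) @` [set` F]).
  by move=> /cE/gmP[].
have p_av F : F \in eset (complete r) -> forall t i, t \in `]0, 1[%R -> i \in vset (complete r) ->
    gm F t <> nz (sg i).
  move=> /cE F2 t i tI _ E1; have [_ gi ge gr] := gmP _ F2.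
  have [t0 t1] : 0 < t /\ t < 1 by move: tI; rewrite in_itv /= => /andP.
  have tI' : t \in `[0, 1]%R by rewrite in_itv /= !ltW.
  have I0 : (0 : R) \in `[0, 1]%R by rewrite in_itv /= lexx ler01.
  have I1 : (1 : R) \in `[0, 1]%R by rewrite in_itv /= lexx ler01.
  have := gr _ tI'; rewrite E1 => rg.
  have [vin ie] := region_avoids (rt_valid F2) (sg_V i) rg.
  have iF := rt_end_mem F2 vin ie.
  have : [set gm F 0; gm F 1] (nz (sg i)) by rewrite ge; exists i.
  rewrite -E1 => -[/gi|/gi]; rewrite tI' ?I0 ?I1 => /(_ isT isT) E2.
    by rewrite E2 ltxx in t0.
  by rewrite E2 ltxx in t1.
exists (Drawing p_inj p_cont p_arc p_ends p_av) => P p [/= PE P2 Pint].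
have [F [H [FH PFH]]] : exists F H : {set 'I_r}, F != H /\ P = [set F; H]%SET.
  by move/eqP/cards2P: P2 => [F [H [? ?]]]; exists F, H.
have FP : F \in P by rewrite PFH finset.in_set2 eqxx.
have HP : H \in P by rewrite PFH finset.in_set2 eqxx orbT.
have F2 := cE _ (fintype.subsetP PE _ FP); have H2 := cE _ (fintype.subsetP PE _ HP).
exists F, H; split=> //.
have [t tI tp] := Pint _ FP; have [u uI up] := Pint _ HP; rewrite /= in tp up.
have sub (a : R) : `]0, 1[ a -> a \in `[0, 1]%R.
  by rewrite /= !in_itv /= => /andP[? ?]; rewrite !ltW.
have [_ _ _ grF] := gmP _ F2; have [_ _ _ grH] := gmP _ H2.
have rF := grF _ (sub _ tI); have rH := grH _ (sub _ uI); rewrite tp in rF; rewrite up in rH.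
have dis e := rt_disjoint (e := e) F2 H2 FH.
have [|[v [vF vH lF lH]]] := region_meet (rt_valid F2) (rt_valid H2) dis rF rH; first by left.
right; exists v; split=> //; apply/negP => /andP[iF iH].
(* If both paths ended at [v], the point would be the new vertex itself, which is not interior to an
   arc. *)
have pz := local_ends (rt_valid F2) (rt_valid H2) dis vF vH iF iH lF lH.
have [x [l [rE sE]]] := rt_ends2 F2.
have [i vi] : exists i, v = sg i.
  have [uq _ _] := rt_valid F2; rewrite rE in vF iF uq.
  have : v \in [set sg i | i in F]%SET.
    by rewrite sE finset.in_set2; have [->|->] := is_end_cons uq vF iF; rewrite eqxx ?orbT.
  by move/imsetP => [i _ ->]; exists i.
by apply: (p_av F (fintype.subsetP PE _ FP) t i tI); rewrite ?finset.in_setT // tp pz vi.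
Qed.

End Redraw.

(** * Many crossings between [W] and a set of common neighbours *)

Section Savings.
Local Open Scope classical_set_scope.
Local Notation pos := Defs.pos.
Variables (R : realType) (T : finType) (G : graph T) (D : drawing R G).
Implicit Types (w z : T) (p : R * R).

Lemma K33_in_drawing (a b : nat -> T) :
  (forall i j, (i < 3)%N -> (j < 3)%N -> [/\ [set a i; b j]%SET \in eset G, a i != b j,
     i != j -> a i != a j & i != j -> b i != b j]) ->
  exists i k j l p, [/\ (i < k < 3)%N, (j < 3)%N, (l < 3)%N, j != l &
    crossings D ([set [set a i; b j]; [set a k; b l]]%SET, p)].
Proof.
move=> ab.
have exg (ij : nat * nat) : exists g : R -> R * R, (ij.1 < 3)%N -> (ij.2 < 3)%N ->
    [/\ continuous g, g 0 = pos D (a ij.1), g 1 = pos D (b ij.2) &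
        forall t, t \in `[0, 1]%R -> edge_image D [set a ij.1; b ij.2]%SET (g t)].
  case: ij => i j /=; have [/andP[i3 j3]|no] := boolP ((i < 3) && (j < 3))%N; last first.
    by exists (fun=> 0) => i3 j3; rewrite i3 j3 in no.
  have [eE ne _ _] := ab _ _ i3 j3.
  have [g [cg _ g0 g1 gX]] := edge_is_arc D eE erefl ne.
  by exists g => _ _; split=> // t tI; rewrite -gX; exists t.
have [g gP] := choice exg.
have [|i [j [k [l [ik j3 l3 jl [s [t [sI tI E]]]]]]]] :=
    @K33_crossing R (fun i => pos D (a i)) (fun j => pos D (b j)) (fun i j => g (i, j)).
  by move=> i j i3 j3; have [] := gP (i, j) i3 j3.
have [ik' k3] := andP ik; have i3 := ltn_trans ik' k3.
exists i, k, j, l, (g (i, j) s); split=> //.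
have [_ _ _ g1] := gP (i, j) i3 j3; have [_ _ _ g2] := gP (k, l) k3 l3.
have [e1 n1 _ _] := ab _ _ i3 j3; have [e2 n2 _ _] := ab _ _ k3 l3.
have [_ _ nik _] := ab _ _ i3 k3; have [_ _ _ njl] := ab _ _ j3 l3.
have [_ nil _ _] := ab _ _ i3 l3; have [_ nkj _ _] := ab _ _ k3 j3.
have {}nik := nik (negbT (ltn_eqF ik')); have {}njl := njl jl.
have dj z : z \in [set a i; b j]%SET -> z \in [set a k; b l]%SET -> False.
  rewrite !finset.in_set2 => /orP[]/eqP-> /orP[]; apply/negP => //.
  by rewrite eq_sym.
apply: edge_crossing => //.
- by apply/eqP => E1; apply: (dj (a i)); rewrite ?E1 -?E1 finset.in_set2 eqxx.
- exact: g1.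
- by rewrite E; exact: g2.
- move=> z zV pz; apply: (dj z).
    by apply: (@edge_image_vertex _ _ _ D _ _ e1 zV); rewrite -pz; exact: g1.
  by apply: (@edge_image_vertex _ _ _ D _ _ e2 zV); rewrite -pz E; exact: g2.
Qed.

(** The values are crossings, hence not of a finite type; their positions in a duplicate-free list
    replace them in the double counting. *)
Lemma card_fibers (J : finType) (X : eqType) (kappa : J -> X) B :
  (forall x0, #|[set x | kappa x == kappa x0]%SET| <= B)%N ->
  (#|J| <= size (undup [seq kappa x | x <- enum J]) * B)%N.
Proof.
move=> fib; set s := undup _.
have ins x : (index (kappa x) s < size s)%N.
  by rewrite index_mem mem_undup; apply: map_f; rewrite mem_enum.
rewrite -sum1_card (partition_big (fun x => Ordinal (ins x)) xpredT) //=.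
have -> : (size s * B = \sum_(n < size s) B)%N by rewrite sum_nat_const card_ord.
apply: leq_sum => n _.
rewrite sum1_card; case: (pickP (fun x => Ordinal (ins x) == n)) => [x0 /eqP E|no]; last first.
  by rewrite eq_card0 // => x; rewrite unfold_in no.
apply: leq_trans (fib x0); apply: subset_leq_card; apply/fintype.subsetP => x.
rewrite unfold_in finset.in_set -E => /eqP[] Ei; apply/eqP.
have h y : kappa y = nth (kappa x0) s (index (kappa y) s) by rewrite nth_index // -index_mem.
by rewrite /= in Ei; rewrite (h x) Ei -h.
Qed.

(** Cut each side into three blocks, of size [q] and [m]. One vertex from each block gives
    [q ^ 3 * m ^ 3] copies of K_{3,3}, each with a crossing of disjoint edges, and a crossing arises
    from at most [q * m] of them. *)
Lemma savings (W U : {set T}) : (forall w z, w \in W -> z \in U -> w != z) ->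
  (forall w z, w \in W -> z \in U -> [set w; z]%SET \in eset G) ->
  exists L : seq ({set {set T}} * (R * R)),
  [/\ uniq L, ((#|W| %/ 3) ^ 2 * (#|U| %/ 3) ^ 2 <= size L)%N &
    forall c, c \in L -> crossings D c /\
      forall e, e \in c.1 -> exists w z, [/\ w \in W, z \in U & e = [set w; z]%SET]].
Proof.
move=> WU WUE; set q := (#|W| %/ 3)%N; set m := (#|U| %/ 3)%N.
have [->|q0] := posnP q; first by exists [::]; rewrite exp0n.
have [->|m0] := posnP m; first by exists [::]; rewrite exp0n // muln0.
have [w0 w0W] : exists w, w \in W.
  by apply/set0Pn; rewrite -card_gt0; move: q0; rewrite /q; case: #|_|.
(* The function [al] selects one vertex in each of three consecutive blocks of length [k] of the
   enumeration of [A]. *)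
pose blk (A : {set T}) k (al : {ffun 'I_3 -> 'I_k}) (i : nat) :=
  nth w0 (enum A) (i * k + al (inord i)).
have blk_lt (A : {set T}) k (al : {ffun 'I_3 -> 'I_k}) i : (k * 3 <= #|A|)%N -> (i < 3)%N ->
    (i * k + al (inord i) < size (enum A))%N.
  move=> kA i3; rewrite -cardE; apply: leq_trans kA; have := ltn_ord (al (inord i)).
  by move: (nat_of_ord (al _)) i3 => x; case: i => [|[|[|//]]]; lia.
have blk_mem (A : {set T}) k al i : (k * 3 <= #|A|)%N -> (i < 3)%N -> blk A k al i \in A.
  by move=> kA i3; rewrite -mem_enum mem_nth ?blk_lt.
have blk_inj (A : {set T}) k al al' i i' : (k * 3 <= #|A|)%N -> (i < 3)%N -> (i' < 3)%N ->
    blk A k al i = blk A k al' i' -> i = i' /\ al (inord i) = al' (inord i').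
  move=> kA i3 i'3 /eqP; rewrite nth_uniq ?blk_lt ?enum_uniq // => /eqP E.
  have x1 := ltn_ord (al (inord i)); have x2 := ltn_ord (al' (inord i')).
  have k0 : (0 < k)%N by exact: leq_ltn_trans x1.
  have := congr1 (fun x => x %/ k)%N E; have := congr1 (fun x => x %% k)%N E.
  by rewrite !modnMDl !divnMDl // !modn_small // !divn_small // !addn0 => /ord_inj-> ->.
have qW : (q * 3 <= #|W|)%N by exact: leq_divM.
have mU : (m * 3 <= #|U|)%N by exact: leq_divM.
pose J : finType := ({ffun 'I_3 -> 'I_q} * {ffun 'I_3 -> 'I_m})%type.
have exk (x : J) : exists c : {set {set T}} * (R * R), crossings D c /\
    exists i k j l, [/\ (i < k < 3)%N, (j < 3)%N, (l < 3)%N, j != l &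
      c.1 = [set [set blk W q x.1 i; blk U m x.2 j]; [set blk W q x.1 k; blk U m x.2 l]]%SET].
  have [|i [k [j [l [p [ik j3 l3 jl cr]]]]]] :=
      @K33_in_drawing (blk W q x.1) (blk U m x.2).
    move=> i j i3 j3; split.
    - by apply: WUE; exact: blk_mem.
    - by apply: WU; exact: blk_mem.
    - by apply: contraNneq => /blk_inj[] // ->.
    - by apply: contraNneq => /blk_inj[] // ->.
  by eexists; split; [exact: cr|exists i, k, j, l].
have [kappa kP] := choice exk.
exists (undup [seq kappa x | x <- enum J]); split; first exact: undup_uniq.
  (* The crossing determines its four end points, thus two of the three choices on each side; the
     third choices are free. *)
  have fib x0 : (#|[set x | kappa x == kappa x0]%SET| <= q * m)%N.
    have [_ [i [k [j [l [ik j3 l3 jl cE]]]]]] := kP x0.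
    have [ik' k3] := andP ik; have i3 := ltn_trans ik' k3.
    have third (a b : nat) : (a < 3)%N -> (b < 3)%N -> a != b ->
        exists c : 'I_3, forall d : 'I_3, [|| d == inord a, d == inord b | d == c].
      (* The three indices have sum 3. *)
      move=> a3 b3 ab; exists (inord (3 - a - b)) => d; rewrite -!val_eqE /= !inordK //.
        by have := ltn_ord d; move: (nat_of_ord d) a3 b3 ab; lia.
      by move: a3 b3 ab; lia.
    have [i' i'P] := third i k i3 k3 (negbT (ltn_eqF ik')).
    have [j' j'P] := third j l j3 l3 jl.
    have agree x : kappa x = kappa x0 -> [/\ x.1 (inord i) = x0.1 (inord i),
        x.1 (inord k) = x0.1 (inord k), x.2 (inord j) = x0.2 (inord j) &
        x.2 (inord l) = x0.2 (inord l)].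
      move=> kx; have [_ [i1 [k1 [j1 [l1 [ik1 j13 l13 jl1 cE1]]]]]] := kP x.
      have [ik1' k13] := andP ik1; have i13 := ltn_trans ik1' k13.
      have covE y : y \in finset.cover (kappa x0).1 ->
          (exists2 h, (h < 3)%N & y = blk W q x.1 h) \/ (exists2 h, (h < 3)%N & y = blk U m x.2 h).
        rewrite -kx cE1 => /finset.bigcupP[e]; rewrite finset.in_set2 => /orP[]/eqP->;
          rewrite finset.in_set2 => /orP[]/eqP->; try (by left; eexists; last reflexivity);
          by right; eexists; last reflexivity.
      have inc e y : e \in (kappa x0).1 -> y \in e -> y \in finset.cover (kappa x0).1.
        by move=> ee ye; apply/finset.bigcupP; exists e.
      have wE h : (h < 3)%N -> blk W q x0.1 h \in finset.cover (kappa x0).1 -> x.1 (inord h) = x0.1 (inord h).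
        move=> h3 /covE[[h' h'3 /blk_inj[] // <- ->]//|[h' h'3 E]].
        by have := WU _ _ (blk_mem W q x0.1 h qW h3) (blk_mem U m x.2 h' mU h'3); rewrite E eqxx.
      have zE h : (h < 3)%N -> blk U m x0.2 h \in finset.cover (kappa x0).1 -> x.2 (inord h) = x0.2 (inord h).
        move=> h3 /covE[[h' h'3 E]|[h' h'3 /blk_inj[] // <- ->]//].
        by have := WU _ _ (blk_mem W q x.1 h' qW h'3) (blk_mem U m x0.2 h mU h3); rewrite E eqxx.
      have e1 : [set blk W q x0.1 i; blk U m x0.2 j]%SET \in (kappa x0).1.
        by rewrite cE finset.in_set2 eqxx.
      have e2 : [set blk W q x0.1 k; blk U m x0.2 l]%SET \in (kappa x0).1.
        by rewrite cE finset.in_set2 eqxx orbT.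
      split; [apply: wE i3 (inc _ _ e1 _)|apply: wE k3 (inc _ _ e2 _)|
        apply: zE j3 (inc _ _ e1 _)|apply: zE l3 (inc _ _ e2 _)];
        by rewrite finset.in_set2 eqxx ?orbT.
    rewrite -[(q * m)%N](_ : #|{: 'I_q * 'I_m}| = _); last by rewrite card_prod !card_ord.
    rewrite -(@card_in_imset _ _ (fun x : J => (x.1 i', x.2 j'))); first exact: max_card.
    move=> x y; rewrite !finset.in_set => /eqP/agree[x1 x2 x3 x4] /eqP/agree[y1 y2 y3 y4] [e1 e2].
    rewrite [x]surjective_pairing [y]surjective_pairing; congr pair; apply/ffunP => d.
      by case/or3P: (i'P d) => /eqP->; rewrite ?x1 ?x2 ?y1 ?y2.
    by case/or3P: (j'P d) => /eqP->; rewrite ?x3 ?x4 ?y3 ?y4.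
  have := card_fibers fib; rewrite card_prod !card_ffun !card_ord.
  have qm : (0 < q * m)%N by rewrite muln_gt0 q0.
  move=> H; rewrite -(leq_pmul2r qm).
  have -> : (q ^ 2 * m ^ 2 * (q * m) = q ^ 3 * m ^ 3)%N by rewrite mulnACA -!expnSr.
  exact: H.
move=> c; rewrite mem_undup => /mapP[x _ ->]; have [cr [i [k [j [l [ik j3 l3 jl cE]]]]]] := kP x.
split=> // e; rewrite cE; have [ik' k3] := andP ik; have i3 := ltn_trans ik' k3.
rewrite finset.in_set2 => /orP[]/eqP->.
  by exists (blk W q x.1 i), (blk U m x.2 j); split=> //; exact: blk_mem.
by exists (blk W q x.1 k), (blk U m x.2 l); split=> //; exact: blk_mem.
Qed.

End Savings.

(** * Colourings of G as clique partitions of non-adjacency *)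

Section Colorings.
Import mathcomp.boot.finset mathcomp.boot.fintype.
Local Open Scope nat_scope.
Variables (T : finType) (G : graph T).
Implicit Types x y a : T.

Definition nonadj x y := [&& x \in vset G, y \in vset G, x != y & [set x; y] \notin eset G].

Lemma nonadj_sym : symmetric nonadj.
Proof. by move=> x y; rewrite /nonadj andbCA eq_sym setUC. Qed.

Lemma nonadj_irr : irreflexive nonadj.
Proof. by move=> x; rewrite /nonadj eqxx !andbF. Qed.

Lemma coloring_cpart (V' : {set T}) (c : T -> nat) k : V' \subset vset G ->
  (forall x y, x \in V' -> y \in V' -> [set x; y] \in eset G -> c x != c y) ->
  (forall x, x \in V' -> c x < k) -> exists2 P, cpart nonadj V' P & #|P| <= k.
Proof.
move=> VV cP ck; exists [set [set y in V' | c y == c x] | x in V'].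
  split.
  - move=> x xV; exists [set y in V' | c y == c x]; first by apply/imsetP; exists x.
    by rewrite inE xV eqxx.
  - move=> _ /imsetP[x xV ->]; split; first by apply/subsetP => y; rewrite inE => /andP[].
    by apply/set0Pn; exists x; rewrite inE xV eqxx.
  - move=> _ _ /imsetP[x xV ->] /imsetP[y yV ->] z; rewrite !inE => /andP[_ /eqP<-] /andP[_ /eqP E].
    by apply/setP => t; rewrite !inE E.
  - move=> _ /imsetP[x xV ->] y z; rewrite !inE => /andP[yV /eqP yc] /andP[zV /eqP zc] yz.
    rewrite /nonadj (subsetP VV _ yV) (subsetP VV _ zV) yz /=.
    by apply/negP => /(cP _ _ yV zV); rewrite yc zc eqxx.
pose fib (i : 'I_k) : {set T} := [set y in V' | c y == i].
rewrite -[X in _ <= X](card_ord k); apply: leq_trans (leq_imset_card fib 'I_k).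
apply: subset_leq_card; apply/subsetP => _ /imsetP[x xV ->].
by apply/imsetP; exists (Ordinal (ck _ xV)).
Qed.

Lemma cpart_colorable P : cpart nonadj (vset G) P -> colorable G #|P|.
Proof.
move=> cP; have partP := cpart_partition cP; have [_ _ _ cl] := cP.
have cov : cover P = vset G := cover_partition partP.
exists (fun x => index (pblock P x) (enum P)); split=> [x y xyE|x xV]; last first.
  by rewrite cardE index_mem mem_enum pblock_mem ?cov.
have /andP[xyV xy2] := esetP xyE.
have xV : x \in vset G by apply: (subsetP xyV); rewrite !inE eqxx.
have yV : y \in vset G by apply: (subsetP xyV); rewrite !inE eqxx orbT.
have xy : x != y by move: xy2; rewrite cards2; case: (x != y).
apply/eqP => /(congr1 (nth set0 (enum P))).
rewrite !nth_index ?mem_enum ?pblock_mem ?cov // => E.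
have := cl (pblock P x) _ x y; rewrite pblock_mem ?cov // mem_pblock cov xV E mem_pblock cov yV.
by move=> /(_ isT isT isT xy); rewrite /nonadj xyE !andbF.
Qed.

Lemma chromatic_number_le k : colorable G k -> chromatic_number G <= k.
Proof. by rewrite /chromatic_number => c; case: ex_minnP => m _; apply; apply/asboolP. Qed.

Lemma chromatic_number_colorable : colorable G (chromatic_number G).
Proof. by rewrite /chromatic_number; case: ex_minnP => m /asboolP. Qed.

Lemma opt_card_chromatic P : opt nonadj (vset G) P -> #|P| = chromatic_number G.
Proof.
move=> oP; have [cP _] := oP; apply/eqP; rewrite eqn_leq chromatic_number_le ?andbT //.
  have [c [pc lc]] := chromatic_number_colorable.
  have [Q cQ] := coloring_cpart (subxx _) (fun x y _ _ => pc x y) lc.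
  exact: leq_trans (opt_card oP cQ).
exact: cpart_colorable.
Qed.

End Colorings.

Lemma delete_ok (T : finType) (G : graph T) (a : T) :
  [forall e in [set e in eset G | a \notin e]%SET, (e \subset vset G :\ a)%SET && (#|e| == 2%N)].
Proof.
apply/forall_inP => e; rewrite finset.in_set => /andP[/esetP/andP[eV ->] ae]; rewrite andbT.
by rewrite finset.subsetD1 eV.
Qed.

Lemma critical_vertex_critical (T : finType) (G : graph T) r : critical r G ->
  vertex_critical (nonadj G) (vset G).
Proof.
move=> [Gr crit] P a oP aV; pose H := Graph (delete_ok G a).
have : proper_subgraph H G.
  split; first by split; [exact: finset.subsetDl|apply/fintype.subsetP => e; rewrite finset.in_set => /andP[]].
  by move=> E; move: aV; rewrite -E /= !finset.inE eqxx.
move=> /crit; have [c [pc lc]] := chromatic_number_colorable H.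
have [x y xV yV xyE|Q cQ leQ] := @coloring_cpart T G (vset G :\ a)%SET c _ (finset.subsetDl _ _) _ lc.
  apply: pc; rewrite /= finset.in_set xyE /= finset.in_set2; apply/norP.
  by move: xV yV; rewrite !finset.inE => /andP[xa _] /andP[ya _]; rewrite ![a == _]eq_sym.
rewrite -Gr -(opt_card_chromatic oP) => ltr; exists Q => //; exact: leq_ltn_trans ltr.
Qed.

(** * Comparison of crossing numbers through an injection *)

Section Transfer.
Local Open Scope classical_set_scope.

(** The relation assigns old crossings to new ones injectively; a choice of values shows at once
    that the new crossings are finite in number and at most [k]. *)
Lemma crossing_number_transfer (R : realType) (T T' : finType) (G : graph T) (G' : graph T')
    (D : drawing R G) (D' : drawing R G') k
    (rel : {set {set T'}} * (R * R) -> {set {set T}} * (R * R) -> Prop) :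
  (crossings D #= `I_k)%card ->
  (forall c, crossings D' c -> exists d, crossings D d /\ rel c d) ->
  (forall c c' d, rel c d -> rel c' d -> c = c') ->
  (crossing_number R G' <= k)%N.
Proof.
move=> Dk ex inj.
have exf c : exists d, crossings D' c -> crossings D d /\ rel c d.
  have [/ex[d dP]|no] := pselect (crossings D' c); first by exists d.
  by exists (finset.set0, 0) => /no.
have [f fP] := choice exf.
have f_inj : {in crossings D' &, injective f}.
  move=> c c'; rewrite !inE => /fP[_ cd] /fP[_ cd'] E; rewrite E in cd.
  exact: inj cd cd'.
have sub : f @` crossings D' `<=` crossings D by move=> _ [c /fP[? _] <-].
have fin : finite_set (crossings D') .
  rewrite -(eq_finite_set (inj_card_eq f_inj)); apply: sub_finite_set sub _.
  by apply/finite_setP; exists k.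
have [k' Dk'] := (finite_setP _).1 fin.
have le : (k' <= k)%N.
  rewrite -card_le_II -(card_le_eql Dk') -(card_le_eqr Dk) -(card_le_eql (inj_card_eq f_inj)).
  exact: subset_card_le.
apply: leq_trans le; rewrite /crossing_number; case: ex_minnP => m _; apply.
by apply/asboolP; exists D'.
Qed.

End Transfer.

(** * Injecting the crossings of the new drawing into those of the old one *)

Section Main.
Local Open Scope classical_set_scope.
Variables (R : realType) (T : finType) (G : graph T) (r : nat).
Hypothesis Gr : critical r G.

Lemma critical_transversal : exists S : {set T}, [/\ S \subset vset G, #|S| = r &
  forall m, (m + 3 * #|vset G :\: S| + 4 <= #|S|)%N ->
  exists (U2 : {set T}) (F0 : {set {set T}}) (rt : {set T} -> seq T),
  [/\ U2 \subset S /\ #|U2| = m,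
      forall w z, w \in vset G :\: S -> z \in U2 -> ~~ nonadj G w z,
      (#|F0| <= #|vset G :\: S| * #|vset G :\: S|.+1)%N,
      forall f : {set T}, f \subset S -> #|f| = 2%N -> exists x p,
        [/\ rt f = x :: p, f = [set x; last x p] /\ uniq (x :: p), (size p <= 4)%N,
            path (free_adj (nonadj G) (vset G)) x p & f \notin F0 -> size p = 1%N] &
      (forall (f g e : {set T}), f \subset S -> g \subset S -> #|f| = 2%N -> #|g| = 2%N -> f != g ->
        e \in path_edges (rt f) -> e \in path_edges (rt g) -> False) /\
      (forall (f e : {set T}) w z, f \subset S -> #|f| = 2%N -> e \in path_edges (rt f) ->
        w \in vset G :\: S -> z \in U2 -> e <> [set w; z])]]%SET.
Proof.
have [P oP] := opt_exists (nonadj G) (vset G).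
have hV x y : nonadj G x y -> y \in vset G by case/and4P.
have [S [[SV cS] US SK SX dg]] := gallai_transversal (@nonadj_sym _ G) (@nonadj_irr _ G) hV
  (critical_vertex_critical Gr) oP.
exists S; split=> //; first by rewrite cS (opt_card_chromatic oP) Gr.1.
move=> m mle.
exact: (routing (@nonadj_sym _ G) (@nonadj_irr _ G) hV SV US SK SX dg mle).
Qed.

Lemma free_adj_edge x y : free_adj (nonadj G) (vset G) x y -> [set x; y]%SET \in eset G.
Proof. by case/and4P => xV yV xy; rewrite /nonadj xV yV xy /= negbK. Qed.

Lemma free_path_edges x p e : path (free_adj (nonadj G) (vset G)) x p ->
  e \in path_edges (x :: p) -> e \in eset G.
Proof.
elim: p x => //= y p IH x /andP[/free_adj_edge xy yp].
by rewrite /path_edges /= inE => /orP[/eqP->//|]; exact: IH.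
Qed.

Lemma set2_eq (X : finType) (a b c d : X) : a != b -> a \in [set c; d]%SET -> b \in [set c; d]%SET ->
  [set a; b]%SET = [set c; d]%SET.
Proof.
move=> ab ac bc; apply/eqP; rewrite finset.eqEcard !finset.cards2 ab.
apply/andP; split; last by case: (c != d).
by apply/fintype.subsetP => z; rewrite finset.in_set2 => /orP[]/eqP->.
Qed.

(** A new crossing away from the vertices is an old crossing and is sent to itself. One near a
    vertex is encoded by a path, an inner position and a neighbour, and the codes embed into the
    list [L] of lost crossings, which no path can produce. *)
Lemma crossing_number_complete_le : let n := #|vset G| in let q := (n - r)%N in
  (3 * q + 4 <= r)%N ->
  (3 * n * (q * q.+1) <= (q %/ 3) ^ 2 * ((r - (3 * q + 4)) %/ 3) ^ 2)%N ->
  (crossing_number R (complete r) <= crossing_number R G)%N.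
Proof.
move=> n q qr num; have [S [SV cS rtS]] := critical_transversal.
have cW : #|vset G :\: S|%SET = q by rewrite finset.cardsD (finset.setIidPr SV) cS.
pose m := (r - (3 * q + 4))%N.
have [|U2 [F0 [rt0 [[U2S cU2] WU cF0 rtP [rt_dis rtWU]]]]] := rtS m.
  by rewrite cW cS /m; move: qr; clear; lia.
have [D Dk] : exists D : drawing R G, (crossings D #= `I_(crossing_number R G))%card.
  by rewrite /crossing_number; case: ex_minnP => k /asboolP.
have finD : finite_set (crossings D) by apply/finite_setP; eexists; exact: Dk.
have [s [Y [ex [nz star]]]] := star_exists finD.
have [L [uL sL LP]] : exists L : seq ({set {set T}} * (R * R)),
  [/\ uniq L, ((#|vset G :\: S|%SET %/ 3) ^ 2 * (#|U2| %/ 3) ^ 2 <= size L)%N &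
    forall c, c \in L -> crossings D c /\
      forall e, e \in c.1 -> exists w z, [/\ w \in (vset G :\: S)%SET, z \in U2 & e = [set w; z]%SET]].
  have WU2 w z : w \in (vset G :\: S)%SET -> z \in U2 -> w != z.
    move=> /finset.setDP[_ wS] /(fintype.subsetP U2S) zS; by apply: contraNneq wS => ->.
  apply: savings => // w z wW zU; apply: free_adj_edge; rewrite /free_adj WU2 // WU // !andbT.
  by have [-> _] := finset.setDP wW; rewrite (fintype.subsetP SV) ?(fintype.subsetP U2S).
rewrite cW cU2 in sL.
pose sg (i : 'I_r) := enum_val (cast_ord (esym cS) i).
have sg_inj : injective sg by move=> i j /enum_val_inj/cast_ord_inj.
have sgS i : sg i \in S by exact: enum_valP.
pose im (F : {set 'I_r}) := [set sg i | i in F]%SET.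
have imS F : im F \subset S by apply/fintype.subsetP => _ /imsetP[i _ ->].
have cim (F : {set 'I_r}) : #|F| = 2%N -> #|im F| = 2%N by move=> F2; rewrite finset.card_imset.
have im_inj : injective im by exact: finset.imset_inj.
pose rt F := rt0 (im F).
have rt_valid (F : {set 'I_r}) : #|F| = 2%N -> valid G (rt F).
  move=> F2; have [x [p [rE [fE up] _ pp _]]] := rtP _ (imS F) (cim F F2).
  rewrite /rt rE; split=> // [|e]; last exact: free_path_edges.
  have := cim F F2; rewrite fE /=; case: (p) => //=; rewrite finset.setUid finset.cards1 //.
have rt_ends2 (F : {set 'I_r}) : #|F| = 2%N -> exists x l,
    rt F = x :: l /\ [set sg i | i in F]%SET = [set x; last x l]%SET.
  move=> F2; have [x [p [rE [fE up] _ pp _]]] := rtP _ (imS F) (cim F F2).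
  by exists x, p.
have rt_disjoint (F H : {set 'I_r}) e : #|F| = 2%N -> #|H| = 2%N -> F != H ->
    e \in path_edges (rt F) -> e \in path_edges (rt H) -> False.
  by move=> F2 H2 FH; apply: rt_dis => //; [exact: cim|exact: cim|rewrite (inj_eq im_inj)].
have rt_same (F H : {set 'I_r}) e : #|F| = 2%N -> #|H| = 2%N ->
    e \in path_edges (rt F) -> e \in path_edges (rt H) -> F = H.
  by move=> F2 H2 eF eH; apply/eqP; apply: contraT => /rt_disjoint /(_ eF eH); case.
have sgV i : sg i \in vset G by exact: (fintype.subsetP SV).
have [D' D'P] := redraw star sg_inj sgV rt_valid rt_ends2 rt_disjoint.
(* The index [i] stands for position [i.+1]: a path on at most five vertices has at most three inner
   ones, and only paths for pairs in [F0] have any. *)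
pose codes : {set {set T} * 'I_3 * T} := [set c | (c.1.1 \in F0) && (c.2 \in vset G)]%SET.
have codesL : (#|codes| <= size L)%N.
  have -> : codes = finset.setX (finset.setX F0 [set: 'I_3]%SET) (vset G).
    by apply/setP => -[[f i] y]; rewrite !finset.inE /= andbT.
  rewrite !finset.cardsX cardsT card_ord; apply: leq_trans sL; apply: leq_trans num.
  by rewrite [X in (X <= _)%N]mulnAC -mulnA mulnC [(3 * n)%N]mulnC leq_mul // -cW.
pose iota c := nth (finset.set0, 0) L (index c (enum codes)).
have idx c : c \in codes -> (index c (enum codes) < size L)%N.
  by move=> cc; apply: leq_trans codesL; rewrite cardE index_mem mem_enum.
have iotaL c : c \in codes -> iota c \in L by move=> cc; rewrite mem_nth ?idx.
have iota_inj : {in codes &, injective iota}.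
  move=> c c' cc cc' /eqP; rewrite nth_uniq ?idx // => /eqP E.
  by rewrite -(nth_index c (_ : c \in enum codes)) ?mem_enum // E nth_index ?mem_enum.
apply: (@crossing_number_transfer _ _ _ _ _ D D' _ (fun c' c => exists F H : {set 'I_r},
  [/\ c'.1 = [set F; H]%SET, F != H, #|F| = 2%N, #|H| = 2%N &
  (exists e f, [/\ e \in path_edges (rt F), f \in path_edges (rt H) & c = ([set e; f]%SET, c'.2)]) \/
  (exists i u, let v := nth u (rt F) (nat_of_ord i).+1 in
    [/\ (i.+2 < size (rt F))%N, [set v; u]%SET \in path_edges (rt H),
        [/\ v \in rt H, local_piece ex nz (rt F) v c'.2 & local_piece ex nz (rt H) v c'.2],
        (im F, i, u) \in codes & c = iota (im F, i, u)])]) Dk) => /=.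
- move=> [P p] /D'P[F [H [PE FH F2 H2 [[e [f [eF fH cr]]]|[v [[vF vH] lF lH ends]]]]]].
    by exists ([set e; f]%SET, p); split=> //; exists F, H; split=> //; left; exists e, f.
  (* At least one of the two paths has [v] as an inner vertex, and it becomes the path in the
     code. *)
  wlog nF : F H PE FH F2 H2 vF vH lF lH ends / ~~ is_end (rt F) v.
    move=> wl; case/nandP: (ends) => [nF|nH]; first exact: (wl F H).
    by apply: (wl H F); rewrite 1?finset.setUC 1?eq_sym 1?andbC.
  (* The other path enters the code through one of its edges at [v], which identifies it by
     edge-disjointness. *)
  have [u uH] : exists u, [set v; u]%SET \in path_edges (rt H) /\ u \in vset G.
    have [e eH ve] : exists2 e, e \in path_edges (rt H) & v \in e.
      by have [[_ [e [eH ve _]]]|[_ [e [f [[eH _] _ ve _ _]]]]] := local_cases ex nz (rt_valid _ H2) vH; exists e.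
    have [_ _ /(_ _ eH) eG] := rt_valid _ H2.
    have /andP[eV /finset.cards2P[a [b [ab eE]]]] := esetP eG.
    move: ve; rewrite eE finset.in_set2 => /orP[]/eqP vE; subst v.
      by exists b; rewrite -eE; split=> //; apply: (fintype.subsetP eV); rewrite eE finset.in_set2 eqxx orbT.
    exists a; rewrite finset.setUC -eE; split=> //.
    by apply: (fintype.subsetP eV); rewrite eE finset.in_set2 eqxx.
  have [x [p' [rE _ p4 _ sF0]]] := rtP _ (imS F) (cim F F2).
  have iv : (index v (rt F) < size (rt F))%N by rewrite index_mem.
  move: nF; rewrite /is_end => /norP[i0 iN].
  have i2 : ((index v (rt F)).-1.+2 < size (rt F))%N.
    by rewrite prednK ?lt0n // ltn_neqAle iN.
  have i3 : ((index v (rt F)).-1 < 3)%N.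
    by move: i2 p4; rewrite {2}/rt rE /=; clear; lia.
  pose i := Ordinal i3.
  have vE : nth u (rt F) i.+1 = v by rewrite /= prednK ?lt0n // nth_index.
  have cod : (im F, i, u) \in codes.
    rewrite finset.in_set /= uH.2 andbT; apply: contraT => /sF0 p1.
    by move: i2; rewrite {2}/rt rE /= p1.
  exists (iota (im F, i, u)); split; first by have [] := LP _ (iotaL _ cod).
  exists F, H; split=> //; right; exists i, u; rewrite vE; split=> //.
  by case: uH.
- move=> [P p] [P' p'] d [F [H [/= PE FH F2 H2 c1]]] [F' [H' [/= PE' FH' F2' H2' c2]]].
  subst P P'.
  (* Crossings in [L] involve only edges between [W] and [U2], and no path uses these. *)
  have no (F1 : {set 'I_r}) e f (p1 : R * R) c : #|F1| = 2%N -> e \in path_edges (rt F1) -> c \in codes ->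
      ([set e; f]%SET, p1) <> iota c.
    move=> F12 eF1 /iotaL/LP[_ + E]; rewrite -E => /(_ e).
    rewrite /= finset.in_set2 eqxx => /(_ isT)[w [z [wW zU eE]]].
    exact: rtWU (imS F1) (cim _ F12) eF1 wW zU eE.
  case: c1 c2 => [[e [f [eF fH ->]]]|[i [u [i2 uH [vinH lF lH] cod ->]]]]
    [[e' [f' [eF' fH' E]]]|[i' [u' [i2' uH' [_ lF' lH'] cod' E]]]].
  + case: E => E ->; congr pair; apply: set2_eq => //.
      have : e \in [set e'; f']%SET by rewrite -E finset.in_set2 eqxx.
      rewrite !finset.in_set2 => /orP[]/eqP Ee; subst e.
        by rewrite (rt_same _ _ _ F2 F2' eF eF') eqxx.
      by rewrite (rt_same _ _ _ F2 H2' eF fH') eqxx orbT.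
    have : f \in [set e'; f']%SET by rewrite -E finset.in_set2 eqxx orbT.
    rewrite !finset.in_set2 => /orP[]/eqP Ef; subst f.
      by rewrite (rt_same _ _ _ H2 F2' fH eF') eqxx.
    by rewrite (rt_same _ _ _ H2 H2' fH fH') eqxx orbT.
  + by have := no _ _ _ _ _ F2 eF cod' E.
  + by have := no _ _ _ _ _ F2' eF' cod (esym E).
  (* The code yields [F], [v] and an edge of [H], hence [H]; since [v] is inner on the path of [F],
     [local_unique] yields the point. *)
  + move: (iota_inj _ _ cod cod' E) => [/im_inj ? ? ?]; subst F' i' u'.
    have ? := rt_same _ _ _ H2 H2' uH uH'; subst H'.
    congr pair; have vF := rt_valid _ F2; have [uF _ _] := vF; have vH := rt_valid _ H2.
    set v := nth u _ _ in uH vinH lF lH lF' lH'.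
    have vinF : v \in rt F by rewrite mem_nth // ltnW.
    apply: (local_unique star vF vH _ vinF vinH _ lF lH lF' lH').
      by move=> e0; exact: rt_disjoint.
    by rewrite /is_end index_uniq ?(ltnW i2) //= (ltn_eqF i2).
Qed.

End Main.

(** * Numerical estimates and the theorem *)

Lemma rerouting_cost_le (r n : nat) : (4000 <= r)%N -> (r + 100 <= n)%N -> (100 * n <= 123 * r)%N ->
  (3 * (n - r) + 4 <= r)%N /\
  (3 * n * ((n - r) * (n - r).+1) <= ((n - r) %/ 3) ^ 2 * ((r - (3 * (n - r) + 4)) %/ 3) ^ 2)%N.
Proof.
move=> r6 rn nr; have qr : (3 * (n - r) + 4 <= r)%N by lia.
split=> //; set q := (n - r)%N; set a := (q %/ 3)%N; set b := (_ %/ 3)%N.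
have qa : (q <= 3 * a + 2)%N by rewrite /a; lia.
have a33 : (33 <= a)%N by rewrite /a /q; lia.
(* Since [3 * q <= 0.69 * r], about [0.31 * r] universal vertices remain, and a third of that
   exceeds [r / 10]. *)
have rb : (r <= 10 * b)%N by rewrite /b /q; lia.
have qq : (q * q.+1 <= 10 * a ^ 2)%N.
  apply: leq_trans (_ : (3 * a + 2) * (3 * a + 3) <= _)%N; first by apply: leq_mul; lia.
  by move: a33; clear; nia.
(* [30 * n <= 36.9 * r <= 369 * b], and [400 <= b] because [4000 <= r]. The factor 30 is 3 from the
   number of inner vertices times 10 from [qq]. *)
have nb : (30 * n <= b ^ 2)%N.
  apply: leq_trans (_ : 400 * b <= _)%N; first by lia.
  by rewrite -mulnn leq_mul2r; apply/orP; right; lia.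
apply: leq_trans (leq_mul (leqnn _) qq) _.
by rewrite [(a ^ 2 * _)%N]mulnC mulnA leq_mul2r; apply/orP; right; lia.
Qed.

(** Put [z = y - x - 1]. As [x - 1 <= y - 1], the inequality gives
    [z ^+ 3 >= 27.48 * y * (y + 2 * x)]. From [4 * z <= x <= y] the right side is at least
    [27.48 * 48 * z ^+ 2], so [z] exceeds 1319. *)
Lemma gap_lower_bound (R : realFieldType) (x y : R) : 1 <= x -> x <= y -> y <= 123 / 100 * x ->
  2748 / 100 <= ((x - 1) ^+ 3 * (y - x - 1) ^+ 3) / ((y - 1) ^+ 3 * y * (y + 2 * x)) ->
  1000 <= y - x.
Proof.
move=> x1 xy yx H.
(* For [y = 1] the denominator vanishes, the quotient is 0 by convention, and [H] fails. *)
have y1 : 1 < y.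
  rewrite lt_neqAle (le_trans x1 xy) andbT; apply/eqP => y1.
  by move: H; rewrite -y1 subrr expr0n /= !mul0r invr0 mulr0; lra.
have d0 : 0 < y - 1 by lra.
have xd : 0 <= x - 1 by lra.
have D3 : 0 < (y - 1) ^+ 3 by exact: exprn_gt0.
have Dn : 0 < (y - 1) ^+ 3 * y * (y + 2 * x) by rewrite !mulr_gt0 //; lra.
move: H; rewrite ler_pdivlMr // => H.
set z := y - x - 1 in H *.
have xd3 : 0 <= (x - 1) ^+ 3 by exact: exprn_ge0.
have z0 : 0 < z.
  rewrite ltNge; apply/negP => z0.
  have z3 : z ^+ 3 <= 0 by rewrite exprS mulr_le0_ge0 // sqr_ge0.
  have := mulr_ge0_le0 xd3 z3; lra.
have z3 : 0 <= z ^+ 3 by rewrite exprn_ge0 // ltW.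
have le3 : (x - 1) ^+ 3 <= (y - 1) ^+ 3 by rewrite lerXn2r ?nnegrE //; lra.
have H1 : 2748 / 100 * (y * (y + 2 * x)) <= z ^+ 3.
  rewrite -(ler_pM2l D3); apply: le_trans (ler_wpM2r z3 le3); apply: le_trans H.
  by rewrite le_eqVlt; apply/orP; left; apply/eqP; ring.
have xz : 4 * z <= x by rewrite /z; lra.
have H2 : (2748 / 100 * 48) * z ^+ 2 <= z ^+ 3.
  apply: le_trans H1; rewrite -mulrA ler_pM2l; last by lra.
  have : (4 * z) * (12 * z) <= y * (y + 2 * x) by apply: ler_pM; lra.
  by move=> h; apply: le_trans h; rewrite le_eqVlt; apply/orP; left; apply/eqP; ring.
move: H2; rewrite [z ^+ 3]exprS ler_pM2r ?exprn_gt0 // /z; lra.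
Qed.

Theorem theorem7 (R : realType) (r n : nat) (T : finType) (G : graph T) :
  (0 < r)%N -> critical r G -> #|vset G| = n ->
  n%:R <= 123 / 100 * r%:R :> R ->
  [/\ 2748 / 100 <=
        ((r%:R - 1) ^+ 3 * (n%:R - r%:R - 1) ^+ 3) /
        ((n%:R - 1) ^+ 3 * n%:R * (n%:R + 2 * r%:R)) :> R ->
      (crossing_number R (complete r) <= crossing_number R G)%N,
      (125 * 1000 <= r)%N -> 110 / 100 * r%:R <= n%:R :> R ->
      (crossing_number R (complete r) <= crossing_number R G)%N &
      (825 * 1000 <= r)%N -> 105 / 100 * r%:R <= n%:R :> R ->
      (crossing_number R (complete r) <= crossing_number R G)%N].
Proof.
move=> r0 Gr Gn nr.
have rn : (r <= n)%N.
  have [S [SV <- _]] := critical_transversal Gr.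
  by rewrite -Gn; exact: fintype.subset_leq_card.
have nr' : (100 * n <= 123 * r)%N by rewrite -(ler_nat R) !natrM; move: nr; lra.
have main : (4000 <= r)%N -> (r + 100 <= n)%N ->
    (crossing_number R (complete r) <= crossing_number R G)%N.
  move=> r6 rn'; have [] := rerouting_cost_le r6 rn' nr'; rewrite -Gn.
  exact: crossing_number_complete_le.
split=> [H|r1 n1|r1 n1].
- have [] : (1000 <= n - r)%N.
    rewrite -(ler_nat R) natrB //; apply: gap_lower_bound H => //; first by rewrite ler1n.
    by rewrite ler_nat.
  by move=> q; apply: main; lia.
- have q1 : (110 * r <= 100 * n)%N by rewrite -(ler_nat R) !natrM; move: n1; lra.
  by apply: main; lia.
- have q1 : (105 * r <= 100 * n)%N by rewrite -(ler_nat R) !natrM; move: n1; lra.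
  by apply: main; lia.
Qed.
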